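(* Let $a\ge b\ge2$ be natural numbers, $A=\{0,1,\dots,a-1\}$, $B=\{0,1,\dots,b-1\}$. Let $\Omega\subset(A\times B)^{\mathbb{N}}$ be a nonempty subshift (closed, $\sigma(\Omega)\subset\Omega$), let $\pi:(A\times B)^{\mathbb{N}}\to B^{\mathbb{N}}$ be the natural projection, $\Omega'=\pi(\Omega)$, and let $X_\Omega\subset[0,1]^{\mathbb{N}}\times[0,1]^{\mathbb{N}}$ be the carpet system \[ X_\Omega=\left\{\left(\sum_{m=1}^\infty\frac{x_m}{a^m},\sum_{m=1}^\infty\frac{y_m}{b^m}\right) : (x_m,y_m)\in\Omega\text{ for all }m\ge1\right\}, \] where $x_m\in A^{\mathbb{N}}$ and $y_m\in B^{\mathbb{N}}$ are regarded as elements of $\ell^\infty$ and the sums are taken in $\ell^\infty$. Equip $X_\Omega$ with the shift $\sigma((x_n)_n,(y_n)_n)=((x_{n+1})_n,(y_{n+1})_n)$ and the metric $d((x,y),(x',y'))=\sum_{n=1}^\infty2^{-n}\max(|x_n-x'_n|,|y_n-y'_n|)$. Then the mean Hausdorff dimension and metric mean dimension of $(X_\Omega,\sigma,d)$ exist and are given by \[ \mathrm{mdim}_{\mathrm{H}}(X_\Omega,\sigma,d)=\frac{h_{\mathrm{top}}^{\log_ab}(\pi,\Omega,\sigma)}{\log b}, \] \[ \mathrm{mdim}_{\mathrm{M}}(X_\Omega,\sigma,d)=\frac{h_{\mathrm{top}}(\Omega,\sigma)}{\log a}+\left(\frac1{\log b}-\frac1{\log a}\right)h_{\mathrm{top}}(\Omega',\sigma),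 \] where $h_{\mathrm{top}}^{\log_ab}(\pi,\Omega,\sigma)$ is the weighted topological entropy of the factor map $\pi:(\Omega,\sigma)\to(\Omega',\sigma)$ with weight $\log_ab=\log b/\log a$.
   Context: $\mathbb{N}=\{1,2,3,\dots\}$; $\sigma$ also denotes the one-sided shift on $(A\times B)^{\mathbb{N}}$ and on $B^{\mathbb{N}}$; $(A\times B)^{\mathbb{N}}$ is identified with $A^{\mathbb{N}}\times B^{\mathbb{N}}$. For a compact metric space $(X,d)$ and $\varepsilon>0$, the covering number $\#(X,d,\varepsilon)$ is the minimum $n$ such that $X$ has an open cover $\{U_1,\dots,U_n\}$ with $\mathrm{Diam}\,U_i<\varepsilon$ for all $i$. Set $\dim_{\mathrm{M}}(X,d,\varepsilon)=\log\#(X,d,\varepsilon)/\log(1/\varepsilon)$. For $s\ge 0$ set $\mathcal{H}^s_\varepsilon(X,d)=\inf\{\sum_{i=1}^\infty(\mathrm{Diam}\,E_i)^s : X=\bigcup_{i=1}^\infty E_i,\ \mathrm{Diam}\,E_i<\varepsilon\ \forall i\}$, with conventions $0^0=1$ and $(\mathrm{Diam}\,\emptyset)^s=0$ for all $s\ge0$. The $\varepsilon$-scale Hausdorff dimension $\dim_{\mathrm{H}}(X,d,\varepsilon)$ is the supremum of $s\ge0$ with $\mathcal{H}^s_\varepsilon(X,d)\ge1$. For a continuous map $T:X\to X$ and $N\ge1$ let $d_N(x,y)=\max_{0\le n<N}d(T^nx,T^ny)$. The topological entropy is $h_{\mathrm{top}}(X,T)=\lim_{\varepsilon\to0}\lim_{N\to\infty}\frac1N\log\#(X,d_N,\varepsilon)$.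 The upper and lower metric mean dimensions of $(X,T,d)$ are the $\limsup$ and $\liminf$ as $\varepsilon\to0$ of $\lim_{N\to\infty}\dim_{\mathrm{M}}(X,d_N,\varepsilon)/N$; if equal, the common value is $\mathrm{mdim}_{\mathrm{M}}(X,T,d)$. The upper and lower mean Hausdorff dimensions are $\lim_{\varepsilon\to0}\limsup_{N\to\infty}\dim_{\mathrm{H}}(X,d_N,\varepsilon)/N$ and $\lim_{\varepsilon\to0}\liminf_{N\to\infty}\dim_{\mathrm{H}}(X,d_N,\varepsilon)/N$; if equal, the common value is $\mathrm{mdim}_{\mathrm{H}}(X,T,d)$. Weighted topological entropy: let $\pi:(X,T)\to(Y,S)$ be a factor map (continuous surjection between compact metrizable spaces with $\pi\circ T=S\circ\pi$), $0\le w\le1$, and $d,d'$ metrics on $X,Y$, with $d_N(x_1,x_2)=\max_{0\le n<N}d(T^nx_1,T^nx_2)$ on $X$ and $d'_N(y_1,y_2)=\max_{0\le n<N}d'(S^ny_1,S^ny_2)$ on $Y$. For $U\subset X$, $\#(U,d_N,\varepsilon)$ is the minimum $n\ge1$ such that there are open subsets $U_1,\dots,U_n$ of $X$ with $U\subset U_1\cup\dots\cup U_n$ and $\mathrm{Diam}(U_k,d_N)<\varepsilon$ for all $k$ (and it is $0$ if $U=\emptyset$). Let $\#^w(\pi,X,d_N,d'_N,\varepsilon)$ be the minimum of $\sum_{k=1}^n(\#(\pi^{-1}(V_k),d_N,\varepsilon))^w$ over all open covers $Y=V_1\cup\dots\cup V_n$ with $\mathrm{Diam}(V_k,d'_N)<\varepsilon$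 for all $k$. Then $h_{\mathrm{top}}^w(\pi,X,T)=\lim_{\varepsilon\to0}\lim_{N\to\infty}\frac1N\log\#^w(\pi,X,d_N,d'_N,\varepsilon)$; this does not depend on the choice of $d,d'$. *)

(* Defs.v *)
From mathcomp Require Import all_boot all_order all_algebra.
From mathcomp Require Import all_classical all_reals all_analysis.

Set Implicit Arguments.
Unset Strict Implicit.
Unset Printing Implicit Defensive.

Import Order.TTheory GRing.Theory Num.Theory.
Import numFieldNormedType.Exports.

Local Open Scope classical_set_scope.
Local Open Scope ring_scope.

(* A compact metric space is a set X in a carrier T together with a function d
   whose values matter on X only.  Sequences indexed by {1, 2, 3, ...} are
   functions on nat, with a shift of the index by one. *)

Definition metric_on (R : realType) (T : Type) (X : set T) (d : T -> T -> R) :=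
  [/\ forall x y, X x -> X y -> 0 <= d x y,
      forall x y, X x -> X y -> (d x y = 0 <-> x = y),
      forall x y, X x -> X y -> d x y = d y x &
      forall x y z, X x -> X y -> X z -> d x z <= d x y + d y z].

Definition open_in (R : realType) (T : Type) (X : set T) (d : T -> T -> R)
    (U : set T) :=
  U `<=` X /\
  forall x, U x -> exists2 r : R, 0 < r & forall y, X y -> d x y < r -> U y.

Definition compatible_metric (R : realType) (T : topologicalType) (X : set T)
    (d : T -> T -> R) :=
  metric_on X d /\
  forall U : set T, open_in X d U <-> exists2 O, open O & U = X `&` O.

(* The spaces considered are bounded, so that the real-valued sup is the
   supremum; it is 0 on the empty set. *)
Definition diam (R : realType) (T : Type) (d : T -> T -> R) (U : set T) : R :=
  sup [set d x y | x in U & y in U].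

Definition minimum (disp : Order.disp_t) (T : porderType disp) (x0 : T)
    (S : set T) : T :=
  xget x0 [set x | S x /\ lbound S x].

(* d_N *)
Definition dynd (R : realType) (T : Type) (f : T -> T) (d : T -> T -> R)
    (N : nat) (x y : T) : R :=
  \big[Num.max/0]_(n < N) d (iter n f x) (iter n f y).

(* #(U, d, eps), with open sets taken in X; #(X, d, eps) is the case U = X.
   The value is 0 when U is empty, and at least 1 otherwise. *)
Definition covnum (R : realType) (T : Type) (X : set T) (d : T -> T -> R)
    (U : set T) (eps : R) : nat :=
  minimum 0%N [set n | exists V : 'I_n -> set T,
    [/\ forall k, open_in X d (V k), U `<=` \bigcup_k V k &
        forall k, diam d (V k) < eps]].

Definition dimM (R : realType) (T : Type) (X : set T) (d : T -> T -> R)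
    (eps : R) : R :=
  ln (covnum X d X eps)%:R / ln (eps^-1).

(* (Diam E)^s, where 0 `^ 0 = 1 but the empty set always contributes 0 *)
Definition diam_pow (R : realType) (T : Type) (d : T -> T -> R) (s : R)
    (E : set T) : R :=
  if E == set0 then 0 else diam d E `^ s.

Definition hausdorff_content (R : realType) (T : Type) (X : set T)
    (d : T -> T -> R) (s eps : R) : \bar R :=
  ereal_inf [set (\sum_(0 <= i <oo) (diam_pow d s (E i))%:E)%E |
    E in [set E : nat -> set T | X = \bigcup_i E i /\
                                 forall i, diam d (E i) < eps]].

Definition dimH (R : realType) (T : Type) (X : set T) (d : T -> T -> R)
    (eps : R) : \bar R :=
  ereal_sup [set s%:E |
    s in [set s : R | 0 <= s /\ (1%:E <= hausdorff_content X d s eps)%E]].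

Definition htop (R : realType) (T : Type) (X : set T) (f : T -> T)
    (d : T -> T -> R) : \bar R :=
  lim ((limn (fun N => ln (covnum X (dynd f d N) X eps)%:R / N%:R))%:E
    @[eps --> 0^'+]).

Definition mdimM_at (R : realType) (T : Type) (X : set T) (f : T -> T)
    (d : T -> T -> R) (eps : R) : R :=
  limn (fun N => dimM X (dynd f d N) eps / N%:R).

Definition umdimM (R : realType) (T : Type) (X : set T) (f : T -> T)
    (d : T -> T -> R) : \bar R :=
  limf_esup (fun eps => (mdimM_at X f d eps)%:E) 0^'+.

Definition lmdimM (R : realType) (T : Type) (X : set T) (f : T -> T)
    (d : T -> T -> R) : \bar R :=
  limf_einf (fun eps => (mdimM_at X f d eps)%:E) 0^'+.

Definition has_mdimM (R : realType) (T : Type) (X : set T) (f : T -> T)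
    (d : T -> T -> R) (v : \bar R) :=
  umdimM X f d = v /\ lmdimM X f d = v.

Definition umdimH (R : realType) (T : Type) (X : set T) (f : T -> T)
    (d : T -> T -> R) : \bar R :=
  lim (limn_esup (fun N => dimH X (dynd f d N) eps * (N%:R^-1)%:E)%E
    @[eps --> 0^'+]).

Definition lmdimH (R : realType) (T : Type) (X : set T) (f : T -> T)
    (d : T -> T -> R) : \bar R :=
  lim (limn_einf (fun N => dimH X (dynd f d N) eps * (N%:R^-1)%:E)%E
    @[eps --> 0^'+]).

Definition has_mdimH (R : realType) (T : Type) (X : set T) (f : T -> T)
    (d : T -> T -> R) (v : \bar R) :=
  umdimH X f d = v /\ lmdimH X f d = v.

(* #^w(pi, X, d, d', eps), where pi maps X onto Y *)
Definition wcovnum (R : realType) (T S : Type) (w : R) (p : T -> S)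
    (X : set T) (d : T -> T -> R) (Y : set S) (d' : S -> S -> R)
    (eps : R) : R :=
  minimum 0 [set r | exists n (V : 'I_n -> set S),
    [/\ forall k, open_in Y d' (V k), Y = \bigcup_k V k,
        forall k, diam d' (V k) < eps &
        r = \sum_(k < n) (covnum X d (X `&` p @^-1` V k) eps)%:R `^ w]].

Definition whtop (R : realType) (T S : Type) (w : R) (p : T -> S)
    (X : set T) (f : T -> T) (d : T -> T -> R)
    (Y : set S) (g : S -> S) (d' : S -> S -> R) : \bar R :=
  lim ((limn (fun N => ln (wcovnum w p X (dynd f d N) Y (dynd g d' N) eps)
                       / N%:R))%:E @[eps --> 0^'+]).

Definition seq_shift (T : Type) (u : nat -> T) : nat -> T := fun n => u n.+1.

(* C^N with the product of the discrete topologies *)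
Notation fullshift C := (prod_topology (fun _ : nat => discrete_topology C)).

Definition proj_snd (C D : choiceType) (u : fullshift (C * D)%type) :
    fullshift D :=
  fun n => (u n).2.

(* (A x B)^N is identified with A^N x B^N: the point z m encodes (x_m, y_m).
   Convergence of the partial sums is in the sup norm of l^oo. *)
Definition carpet (R : realType) (a b : nat)
    (Om : set (fullshift ('I_a * 'I_b)%type)) :
    set ((nat -> R) * (nat -> R)) :=
  [set p : (nat -> R) * (nat -> R) | exists z : nat -> nat -> 'I_a * 'I_b,
    [/\ forall m, Om (z m),
        {uniform, (fun M n => \sum_(m < M) (z m n).1%:R / a%:R ^+ m.+1)
          @ \oo --> p.1} &
        {uniform, (fun M n => \sum_(m < M) (z m n).2%:R / b%:R ^+ m.+1)
          @ \oo --> p.2}]].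

Definition carpet_shift (R : realType) (p : (nat -> R) * (nat -> R)) :=
  (seq_shift p.1, seq_shift p.2).

Definition carpet_dist (R : realType) (p q : (nat -> R) * (nat -> R)) : R :=
  limn (series (fun n =>
    Num.max `|p.1 n - q.1 n| `|p.2 n - q.2 n| / 2 ^+ n.+1)).

(* Main.v *)
(* A point of X is coded by a sequence z of points z_0, z_1, ... of Omega, z_m
   carrying its m-th digits.  Observed during N units of time, at precision a^-L
   in x and b^-l in y with a^-L close to b^-l, it is given by its approximate
   square: the N-words of z_m for m < L and their projections to B for
   L <= m < l.  Points of one square are close; conversely, a set of small
   d_N-diameter meets at most 25^N squares, a factor that is negligible once the
   logarithm is divided by N log(1/eps).  Counting squares gives mdim_M.

   For mdim_H, let t_v be the number of N-words of Omega above an N-word v of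
   Omega', and Z_N the sum of the t_v^w with w = log_a b, so that log Z_N / N
   tends to the weighted entropy.  Upper bound: under McMullen's product measure
   a square has mass Z_N^-l exp(w S(l) - S(L)), where S(l) is the sum over m < l
   of the log t_(v_m) and L = w l.  Along the scales l, w l, w^2 l, ... the
   differences w S(l) - S(w l) telescope after normalization, so that boundedly
   many scales suffice for every point to lie in a square of mass at least
   exp(- eta N l) Z_N^-l, and these squares form an efficient cover.  Lower
   bound: by pigeonhole Z_N is, up to a factor linear in N, n T^w for n words v
   with T <= t_v < 2 T; on the words above these, the measure with uniform
   projection and uniform fibers gives each square a mass at most n^-l T^-L
   without any law of large numbers.  Since the squares are cylinders, countable
   covers reduce to finite ones and the measures are finite sums. *)

Require Import Defs.
From mathcomp Require Import all_boot all_order all_algebra.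
From mathcomp Require Import all_classical all_reals all_analysis.
From mathcomp Require Import ring lra zify.

Import Order.TTheory GRing.Theory Num.Theory.
Import numFieldNormedType.Exports.

Set Implicit Arguments.
Unset Strict Implicit.
Unset Printing Implicit Defensive.

Local Open Scope classical_set_scope.
Local Open Scope ring_scope.

(** * Semilimits, diameters and covering numbers *)

(** The order of the limits shapes the estimates. N tends to infinity at fixed eps, so whatever
    depends on eps alone is constant in N: the K extra coordinates after which the tail of the
    metric is at most 2^-K, the number J of scales, the scales themselves. Words of length N + K
    then grow at the same rate as words of length N, and a union over J scales costs a factor J
    against a gain exponential in N. The linear factor of the pigeonhole, the number of dyadic
    classes of integers up to a^N, vanishes in the same way. Limits and minima are total functions
    with default values. Convergence therefore has to be proved before a limit is evaluated, which
    is where subadditivity enters, and minima have to be attained. For the weighted covering number,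
    a minimum over a set of reals, this holds because sums of w-th powers of naturals take finitely
    many values below any bound. Entropies do not depend on the metric because, at small scales, a
    covering number lies between the word counts (weighted or not) of lengths N and N + L, with L
    independent of N. *)

Lemma minimum_natP (S : set nat) : S !=set0 ->
  S (minimum 0%N S) /\ lbound S (minimum 0%N S).
Proof.
move=> [m Sm]; apply: (@xgetPex _ 0%N [set x | S x /\ lbound S x]).
have ex : exists n, `[< S n >] by exists m; apply/asboolP.
case: (ex_minnP ex) => n /asboolP Sn min_n.
by exists n; split=> // k Sk; apply: min_n; apply/asboolP.
Qed.

Lemma limf_esup_le (T : choiceType) (X : filteredType T) (R : realType)
    (f : X -> \bar R) (F : set (set X)) (c : \bar R) :
  F [set x | (f x <= c)%E] -> (limf_esup f F <= c)%E.
Proof.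
move=> Fc; apply: ge_ereal_inf; exists (ereal_sup (f @` [set x | (f x <= c)%E])).
  by exists [set x | (f x <= c)%E].
by apply: ge_ereal_sup => _ [x fx <-].
Qed.

Lemma limf_einf_ge (T : choiceType) (X : filteredType T) (R : realType)
    (f : X -> \bar R) (F : set (set X)) (c : \bar R) :
  Filter F -> F [set x | (c <= f x)%E] -> (c <= limf_einf f F)%E.
Proof.
move=> FF Fc; rewrite leeNr; apply: limf_esup_le.
apply: filterS Fc => x /= cx; by rewrite leeN2.
Qed.

Lemma limf_einf_le_esup (T : choiceType) (X : filteredType T) (R : realType)
    (f : X -> \bar R) (F : set (set X)) : ProperFilter F ->
  (limf_einf f F <= limf_esup f F)%E.
Proof.
move=> PF; rewrite leeNl; apply: le_ereal_inf_tmp => _ [V FV <-].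
rewrite leeNl; apply: le_ereal_inf_tmp => _ [W FW <-].
have [x [Vx Wx]] : (V `&` W) !=set0 := @filter_ex _ F PF _ (filterI FV FW).
apply: (@le_trans _ _ (f x)); last by apply: ereal_sup_ubound; exists x.
by rewrite leeNl; apply: ereal_sup_ubound; exists x.
Qed.

Lemma limf_esup_einf_eq (T : choiceType) (X : filteredType T) (R : realType)
    (f : X -> \bar R) (F : set (set X)) (l : R) : ProperFilter F ->
  (forall e, 0 < e -> F [set x | ((l - e)%:E <= f x <= (l + e)%:E)%E]) ->
  limf_esup f F = l%:E /\ limf_einf f F = l%:E.
Proof.
move=> PF h.
have hu : (limf_esup f F <= l%:E)%E.
  apply/lee_addgt0Pr => e e0; rewrite -EFinD; apply: limf_esup_le.
  by apply: filterS (h e e0) => x /= /andP[].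
have hl : (l%:E <= limf_einf f F)%E.
  apply/lee_subgt0Pr => e e0; rewrite -EFinB; apply: limf_einf_ge.
  by apply: filterS (h e e0) => x /= /andP[].
have hm := limf_einf_le_esup f PF.
by split; apply/le_anti/andP; split=> //; [exact: le_trans hm | exact: le_trans hm hu].
Qed.

(** Divide n by a period [m.+1] at which the quotient [u n / n] nearly attains its infimum; the
    remainder adds a bounded cost, which vanishes after division by n. *)
Lemma fekete (R : realType) (u : nat -> R) :
  (forall n, 0 <= u n) -> (forall m n, u (m + n)%N <= u m + u n) ->
  exists2 l : R, 0 <= l & u n / n%:R @[n --> \oo] --> l.
Proof.
move=> u0 usub; set S := [set u n.+1 / n.+1%:R | n in setT].
have Slb : lbound S 0 by move=> _ [n _ <-]; rewrite divr_ge0.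
have S0 : S !=set0 by exists (u 1%N / 1); exists 0%N.
have Shi : has_inf S by split=> //; exists 0.
exists (inf S); first exact: lb_le_inf.
apply/cvgrPdist_le => /= e e0.
have [_ [m _ <-] hm] : exists2 x, S x & x < inf S + e / 2.
  by apply: inf_adherent => //; rewrite divr_gt0.
(* [C] bounds the cost of every remainder. It includes [u 0], which subadditivity does not force to
   vanish. *)
pose C := \sum_(r < m.+1) u r.
have uC n : u n <= (n %/ m.+1)%:R * u m.+1 + C.
  rewrite {1}(divn_eq n m.+1).
  have umul k : u (k * m.+1)%N <= k%:R * u m.+1 + u 0%N.
    elim: k => [|k IH]; first by rewrite mul0n mul0r add0r.
    rewrite mulSn (le_trans (usub _ _))// -natr1 mulrDl mul1r; lra.
  case hr: (n %% m.+1)%N => [|r].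
    rewrite addn0 (le_trans (umul _))// lerD2l /C big_ord_recl lerDl.
    exact: sumr_ge0.
  have rm : (r < m)%N by rewrite -ltnS -hr ltn_mod.
  rewrite (le_trans (usub _ _))//.
  have : u 0%N + u r.+1 <= C.
    rewrite /C big_ord_recl lerD2l (bigD1 (Ordinal rm))//= lerDl.
    exact: sumr_ge0.
  have := umul (n %/ m.+1)%N; lra.
have C0 : 0 <= C by exact: sumr_ge0.
near=> n.
have n0 : 0 < n%:R :> R by rewrite ltr0n; near: n; exists 1%N.
have hC : C <= e / 2 * n%:R.
  rewrite mulrC -ler_pdivrMr ?divr_gt0//; near: n; exact: nbhs_infty_ger.
have hl : inf S <= u n / n%:R.
  apply: ge_inf; first by exists 0.
  exists n.-1 => //; rewrite prednK//.
  by move: n0; rewrite ltr0n.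
rewrite ler_distlC; apply/andP; split.
  by apply: le_trans hl; rewrite gerBl ltW.
rewrite ler_pdivrMr//.
have h1 := uC n; apply: (le_trans h1).
have h2 : (n %/ m.+1)%:R * u m.+1 <= n%:R * (u m.+1 / m.+1%:R).
  rewrite mulrCA mulrC ler_wpM2l// ler_pdivlMr// -natrM ler_nat.
  exact: leq_trunc_div.
have h3 : n%:R * (u m.+1 / m.+1%:R) <= n%:R * (inf S + e / 2).
  by rewrite ler_wpM2l// ltW.
have -> : (inf S + e) * n%:R = n%:R * (inf S + e / 2) + e / 2 * n%:R by field.
by rewrite lerD// (le_trans h2 h3).
Unshelve. all: by end_near. Qed.

Section Diameter.
Context {R : realType} {T : Type}.
Implicit Types (d : T -> T -> R) (U X : set T).

Lemma diam_le d U r : 0 <= r -> (forall x y, U x -> U y -> d x y <= r) ->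
  diam d U <= r.
Proof.
move=> r0 h; rewrite /diam; have [->|/set0P S0] := eqVneq [set d x y | x in U & y in U] set0.
  by rewrite sup0.
by apply: ge_sup => // _ [x Ux [y Uy <-]]; exact: h.
Qed.

Lemma diam_ge d U B x y : (forall x y, U x -> U y -> d x y <= B) ->
  U x -> U y -> d x y <= diam d U.
Proof.
move=> h Ux Uy; apply: ub_le_sup; last by exists x => //; exists y.
by exists B => _ [x' Ux' [y' Uy' <-]]; exact: h.
Qed.

Lemma diam_set0 d : diam d set0 = 0.
Proof.
rewrite /diam (_ : [set _ | _ in _ & _ in _] = set0) ?sup0//.
by apply/seteqP; split=> // z [].
Qed.

(** Separation is left out because [dynd f d 0] is identically 0. The bound is included because
    [diam] is a real supremum, which is meaningful on bounded sets only. *)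
Definition bounded_pmetric X d := [/\
  forall x y, X x -> X y -> 0 <= d x y,
  forall x, X x -> d x x = 0,
  forall x y, X x -> X y -> d x y = d y x,
  forall x y z, X x -> X y -> X z -> d x z <= d x y + d y z &
  exists B, forall x y, X x -> X y -> d x y <= B].

Lemma diam_ge_sub X d U x y : bounded_pmetric X d -> U `<=` X -> U x -> U y ->
  d x y <= diam d U.
Proof.
move=> [_ _ _ _ [B hB]] UX; apply: (@diam_ge _ _ B) => x' y' /UX ? /UX ?.
exact: hB.
Qed.

Lemma diam_ge0 X d U : bounded_pmetric X d -> U `<=` X -> 0 <= diam d U.
Proof.
move=> hd UX; have [->|/set0P[x Ux]] := eqVneq U set0; first by rewrite diam_set0.
have [_ d0 _ _ _] := hd; rewrite -(d0 x (UX _ Ux)).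
exact: diam_ge_sub hd UX _ _.
Qed.

Lemma dynd_leP (f : T -> T) d N x y r :
  reflect (0 <= r /\ forall n, (n < N)%N -> d (iter n f x) (iter n f y) <= r)
          (dynd f d N x y <= r).
Proof.
apply: (iffP idP) => [/bigmax_leP[r0 h]|[r0 h]].
  by split=> // n nN; exact: (h (Ordinal nN)).
by apply/bigmax_leP; split=> // i _; exact: h.
Qed.

Lemma dynd_ltP (f : T -> T) d N x y r :
  reflect (0 < r /\ forall n, (n < N)%N -> d (iter n f x) (iter n f y) < r)
          (dynd f d N x y < r).
Proof.
apply: (iffP idP) => [/bigmax_ltP[r0 h]|[r0 h]].
  by split=> // n nN; exact: (h (Ordinal nN)).
by apply/bigmax_ltP; split=> // i _; exact: h.
Qed.

Lemma dynd_ge (f : T -> T) d N x y n : (n < N)%N ->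
  d (iter n f x) (iter n f y) <= dynd f d N x y.
Proof. by have /dynd_leP[_] := lexx (dynd f d N x y); exact. Qed.

Lemma dynd_ge0 (f : T -> T) d N x y : 0 <= dynd f d N x y.
Proof. by have /dynd_leP[] := lexx (dynd f d N x y). Qed.

Lemma iter_stable X (f : T -> T) : (forall x, X x -> X (f x)) ->
  forall n x, X x -> X (iter n f x).
Proof. by move=> fX; elim=> //= n IH x /IH /fX. Qed.

Lemma bounded_pmetric_dynd X (f : T -> T) d N : (forall x, X x -> X (f x)) ->
  bounded_pmetric X d -> bounded_pmetric X (dynd f d N).
Proof.
move=> /iter_stable fX [d0 dxx dC dD [B hB]]; split.
- by move=> x y _ _; exact: dynd_ge0.
- move=> x Xx; apply/le_anti/andP; split; last exact: dynd_ge0.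
  by apply/dynd_leP; split=> // n _; rewrite dxx//; exact: fX.
- move=> x y Xx Xy; rewrite /dynd; apply: eq_bigr => i _.
  by rewrite dC//; exact: fX.
- move=> x y z Xx Xy Xz; apply/dynd_leP; split; first by rewrite addr_ge0// dynd_ge0.
  move=> n nN; rewrite (le_trans (dD _ (iter n f y) _ _ _ _)) ?lerD//; try exact: fX;
    exact: dynd_ge.
- exists (Num.max 0 B) => x y Xx Xy; apply/dynd_leP; split.
    by rewrite le_max lexx.
  by move=> n nN; rewrite le_max hB ?orbT//; exact: fX.
Qed.

End Diameter.

Section CoveringNumber.
Context {R : realType} {T : Type} (X : set T).
Implicit Types (d : T -> T -> R) (U : set T).

Lemma covnum_le_open d U eps (I : finType) (V : I -> set T) :
  (forall k, open_in X d (V k)) -> U `<=` \bigcup_k V k ->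
  (forall k, diam d (V k) < eps) -> (covnum X d U eps <= #|I|)%N.
Proof.
move=> Vo UV Vd; have h : exists W : 'I_#|I| -> set T, [/\
    forall k, open_in X d (W k), U `<=` \bigcup_k W k &
    forall k, diam d (W k) < eps].
  exists (V \o enum_val); split=> [k|x /UV[i _ Vix]|k] /=; [exact: Vo| |exact: Vd].
  by exists (enum_rank i) => //=; rewrite enum_rankK.
rewrite /covnum; set S := (X in minimum _ X).
by have [_ lb] := @minimum_natP S (ex_intro _ _ h); exact: lb.
Qed.

Lemma covnum_open d U eps (I : finType) (V : I -> set T) :
  (forall k, open_in X d (V k)) -> U `<=` \bigcup_k V k ->
  (forall k, diam d (V k) < eps) ->
  exists V : 'I_(covnum X d U eps) -> set T, [/\
    forall k, open_in X d (V k), U `<=` \bigcup_k V k &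
    forall k, diam d (V k) < eps].
Proof.
move=> Vo UV Vd; have h : exists W : 'I_#|I| -> set T, [/\
    forall k, open_in X d (W k), U `<=` \bigcup_k W k &
    forall k, diam d (W k) < eps].
  exists (V \o enum_val); split=> [k|x /UV[i _ Vix]|k] /=; [exact: Vo| |exact: Vd].
  by exists (enum_rank i) => //=; rewrite enum_rankK.
rewrite /covnum; set S := (X in minimum _ X).
by have [] := @minimum_natP S (ex_intro _ _ h).
Qed.

(** The [e / 2]-neighbourhood. It turns covers by arbitrary small pieces into the open covers that
    [covnum] asks for. *)
Lemma open_enlargement d (E : set T) (e r : R) : bounded_pmetric X d ->
  E `<=` X -> 0 < e -> 0 <= r -> (forall x y, E x -> E y -> d x y <= r) ->
  exists V, [/\ open_in X d V, E `<=` V & diam d V <= r + e].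
Proof.
move=> [d0 dxx dC dD _] EX e0 r0 Er.
exists [set y | X y /\ exists2 x, E x & d x y < e / 2]; split.
- split=> [y []//|y [Xy [x Ex xy]]].
  exists (e / 2 - d x y) => [|z Xz yz]; first by rewrite subr_gt0.
  split=> //; exists x => //; have Xx := EX _ Ex.
  have := dD x y z Xx Xy Xz; lra.
- move=> x Ex; split; first exact: EX.
  by exists x => //; rewrite dxx ?divr_gt0//; exact: EX.
- apply: diam_le => [|y z [Xy [x Ex xy]] [Xz [x' Ex' xz]]]; first lra.
  have Xx := EX _ Ex; have Xx' := EX _ Ex'.
  have h1 := dD y x z Xy Xx Xz; have h2 := dD x x' z Xx Xx' Xz.
  have h3 := Er _ _ Ex Ex'; rewrite (dC y x)// in h1; lra.
Qed.

(** The second conclusion records that the minimum is attained by a genuine cover, so that lower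
    bounds can be read off from it. *)
Lemma covnum_cover d U eps r (I : finType) (P : {set I}) (E : I -> set T) :
  bounded_pmetric X d -> 0 <= r -> r < eps ->
  (forall i, E i `<=` X) ->
  (forall x, U x -> exists2 i, i \in P & E i x) ->
  (forall i x y, E i x -> E i y -> d x y <= r) ->
  (covnum X d U eps <= #|P|)%N /\
  exists V : 'I_(covnum X d U eps) -> set T, [/\
    forall k, open_in X d (V k), U `<=` \bigcup_k V k &
    forall k, diam d (V k) < eps].
Proof.
move=> hd r0 reps EX UE Er.
have e0 : 0 < (eps - r) / 2 by rewrite divr_gt0// subr_gt0.
have [V hV] := choice (fun i => open_enlargement hd (EX i) e0 r0 (Er i)).
pose W (k : 'I_#|P|) := V (enum_val k).
have Wo k : open_in X d (W k) by case: (hV (enum_val k)).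
have UW : U `<=` \bigcup_k W k.
  move=> x /UE[i iP Eix]; exists (enum_rank_in iP i) => //.
  by rewrite /W enum_rankK_in//; have [_ h _] := hV i; exact: h.
have Wd k : diam d (W k) < eps.
  have [_ _ h] := hV (enum_val k); rewrite (le_lt_trans h)//; lra.
split; first by rewrite (leq_trans (covnum_le_open Wo UW Wd))// card_ord.
exact: covnum_open Wo UW Wd.
Qed.

Lemma covnum_gt0 d U eps (V : 'I_(covnum X d U eps) -> set T) :
  U `<=` \bigcup_k V k -> U !=set0 -> (0 < covnum X d U eps)%N.
Proof. by move=> UV [x /UV[k _ _]]; exact: leq_ltn_trans (ltn_ord k). Qed.

(** Intersect a cover that is small for [d_M] with the preimage under the M-th iterate of a cover
    that is small for [d_N]. Together with [fekete] this gives the limit in N inside [mdimM_at]. *)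
Lemma covnum_dyndD d (f : T -> T) eps M N :
  (forall x, X x -> X (f x)) -> bounded_pmetric X d -> 0 < eps ->
  (forall N, exists V : 'I_(covnum X (dynd f d N) X eps) -> set T, [/\
    forall k, open_in X (dynd f d N) (V k), X `<=` \bigcup_k V k &
    forall k, diam (dynd f d N) (V k) < eps]) ->
  (covnum X (dynd f d (M + N)) X eps <=
   covnum X (dynd f d M) X eps * covnum X (dynd f d N) X eps)%N.
Proof.
move=> fX hd eps0 hcov.
have [V [Vo XV Vd]] := hcov M; have [W [Wo XW Wd]] := hcov N.
pose U (k : 'I_(covnum X (dynd f d M) X eps) * 'I_(covnum X (dynd f d N) X eps)) :=
  V k.1 `&` (iter M f @^-1` W k.2).
have fMX := iter_stable fX M.
have leM x y : dynd f d M x y <= dynd f d (M + N) x y.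
  apply/dynd_leP; split=> [|n nM]; first exact: dynd_ge0.
  by apply: dynd_ge; rewrite ltn_addr.
have leN x y : dynd f d N (iter M f x) (iter M f y) <= dynd f d (M + N) x y.
  apply/dynd_leP; split=> [|n nN]; first exact: dynd_ge0.
  by rewrite -!iterD; apply: dynd_ge; rewrite addnC ltn_add2l.
have leMN x y r : dynd f d M x y <= r -> dynd f d N (iter M f x) (iter M f y) <= r ->
    dynd f d (M + N) x y <= r.
  move=> /dynd_leP[r0 h1] /dynd_leP[_ h2]; apply/dynd_leP; split=> // n.
  have [nM _|Mn nMN] := ltnP n M; first exact: h1.
  by have := h2 (n - M)%N; rewrite -!iterD subnK// ltn_subLR//; exact.
have hU : (covnum X (dynd f d (M + N)) X eps <= #|{: 'I_(covnum X (dynd f d M) X eps) * 'I_(covnum X (dynd f d N) X eps)}|)%N.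
  apply: (@covnum_le_open _ _ _ _ U).
  - move=> k; split=> [x [Vx _]|x [Vx Wx]]; first by case: (Vo k.1) => + _; exact.
    have [_ /(_ _ Vx)[r r0 hr]] := Vo k.1; have [_ /(_ _ Wx)[s s0 hs]] := Wo k.2.
    exists (Num.min r s) => [|y Xy]; first by rewrite lt_min r0.
    rewrite lt_min => /andP[xyr xys]; split.
      by apply: hr => //; exact: le_lt_trans (leM _ _) xyr.
    by apply: hs; [exact: fMX|exact: le_lt_trans (leN _ _) xys].
  - move=> x Xx; have [i _ Vi] := XV _ Xx; have [j _ Wj] := XW _ (fMX _ Xx).
    by exists (i, j).
  - move=> k; pose r := Num.max (diam (dynd f d M) (V k.1)) (diam (dynd f d N) (W k.2)).
    have VX : V k.1 `<=` X by case: (Vo k.1).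
    have WX : W k.2 `<=` X by case: (Wo k.2).
    have hM := bounded_pmetric_dynd M fX hd; have hN := bounded_pmetric_dynd N fX hd.
    apply: (@le_lt_trans _ _ r); last by rewrite gt_max Vd Wd.
    apply: diam_le => [|x y [Vx Wx] [Vy Wy]].
      by rewrite le_max (diam_ge0 hM VX).
    by apply: leMN; rewrite le_max; apply/orP; [left|right];
      [exact: diam_ge_sub hM VX _ _|exact: diam_ge_sub hN WX _ _].
by rewrite (leq_trans hU)// card_prod !card_ord.
Qed.

End CoveringNumber.

(** * The full shift *)

Definition agree (C : Type) (N : nat) (x y : nat -> C) :=
  forall i, (i < N)%N -> x i = y i.

Section FullShift.
Context {C : choiceType}.

Lemma open_cylinder N (x : fullshift C) :
  open [set y : fullshift C | agree N x y].
Proof.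
elim: N => [|N IH].
  rewrite (_ : [set _ | _] = setT); first exact: openT.
  by apply/seteqP; split=> // y _ i.
rewrite (_ : [set _ | _] =
  [set y | agree N x y] `&` (proj N : fullshift C -> _) @^-1` [set x N]).
  apply: openI => //; apply: open_comp; last exact: discrete_open.
  by move=> y _; exact: proj_continuous.
apply/seteqP; split=> y /= => [h|[h hN] i].
  by split=> [i iN|]; [apply: h; rewrite ltnS ltnW|rewrite /proj h].
by rewrite ltnS leq_eqVlt => /orP[/eqP->//|]; exact: h.
Qed.

(** Otherwise points outside [O] that agree with [x] on longer and longer prefixes would converge to
    [x]. *)
Lemma open_subcylinder (O : set (fullshift C)) x : open O -> O x ->
  exists N, forall y : fullshift C, agree N x y -> O y.
Proof.
move=> oO Ox; apply: contrapT => h.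
have /choice[y hy] : forall N, exists y : fullshift C, agree N x y /\ ~ O y.
  move=> N; apply: contrapT => h'; apply: h; exists N => y xy.
  by apply: contrapT => Oy; apply: h'; exists y.
have cy : y @ \oo --> x.
  apply/cvg_sup => i U [V] [[W oW <-] Wx WU].
  exists i.+1 => // N /= iN; apply: WU => /=.
  by rewrite -(hy N).1.
have [N _ /(_ N)] := cy O (open_nbhs_nbhs (conj oO Ox)).
by move=> /(_ (leqnn _)); case: (hy N).
Qed.

End FullShift.

Section FiniteAlphabet.
Context {C : finType}.

Lemma fullshift_compact : compact [set: fullshift C].
Proof.
have cC : compact [set: discrete_topology C].
  by move=> F; apply: (@finite_compact (discrete_topology C)); exact: (@finite_finset C setT).
have := @tychonoff nat (fun=> discrete_topology C) (fun=> setT) (fun=> cC).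
by congr compact; apply/seteqP; split.
Qed.

(** The form of compactness used throughout: a threshold that works on a cylinder around each point
    becomes uniform. It yields the uniform modulus, the Lebesgue number, boundedness and Koenig's
    lemma. *)
Lemma compact_cylinder_uniform (X : set (fullshift C))
    (P : nat -> fullshift C -> Prop) : compact X ->
  (forall x, X x -> exists n k0, forall y k, X y -> agree n x y ->
     (k0 <= k)%N -> P k y) ->
  exists k, forall x, X x -> P k x.
Proof.
move=> /compact_near_coveringP cX h.
have [|k _ /(_ k (leqnn k)) hk] := cX nat \oo (fun k x => X x -> P k x) _.
  move=> x /h[n [k0 hP]].
  exists ([set y | agree n x y], [set k | (k0 <= k)%N]) => /=.
    split; last exact: nbhs_infty_ge.
    by apply: open_nbhs_nbhs; split; [exact: open_cylinder|move=> i].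
  by move=> [y k] /= [xy k0k] Xy; exact: hP.
by exists k => x Xx; exact: (hk x Xx Xx).
Qed.

End FiniteAlphabet.

Section CompatibleMetric.
Context {R : realType} {C : finType} (X : set (fullshift C)).
Variable d : fullshift C -> fullshift C -> R.
Hypotheses (cX : compact X) (hd : compatible_metric X d).

Lemma compatible_cylinder x e : X x -> 0 < e ->
  exists N, forall y, X y -> agree N x y -> d x y < e.
Proof.
move=> Xx e0; case: (hd) => [[d0 d00 dC dD] dtop].
have dxx : d x x = 0 by apply/d00.
have [G oG GE] : exists2 G, open G & [set y | X y /\ d x y < e] = X `&` G.
  apply/dtop; split=> [y []//|y [Xy xy]].
  exists (e - d x y) => [|z Xz yz]; first by rewrite subr_gt0.
  split=> //; have h := dD x y z Xx Xy Xz; lra.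
have Gx : G x.
  have : [set y | X y /\ d x y < e] x by split=> //; rewrite dxx.
  by rewrite GE => -[].
have [N hN] := open_subcylinder oG Gx; exists N => y Xy xy.
have : (X `&` G) y by split=> //; exact: hN.
by rewrite -GE => -[].
Qed.

Lemma compatible_open_cylinder N x :
  open_in X d [set y | X y /\ agree N x y].
Proof.
by apply/hd.2; exists [set y : fullshift C | agree N x y] => //; exact: open_cylinder.
Qed.

Lemma compatible_uniform_cylinder e : 0 < e ->
  exists N, forall x y, X x -> X y -> agree N x y -> d x y < e.
Proof.
move=> e0; have [[d0 d00 dC dD] _] := hd.
have [x Xx|N hN] := @compact_cylinder_uniform _ X
  (fun N x => forall y, X y -> agree N x y -> d x y < e) cX; last by exists N => x y /hN; apply.
have e20 : 0 < e / 2 by rewrite divr_gt0.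
have [N hN] := compatible_cylinder Xx e20; exists N, N => y k Xy xy Nk z Xz yz.
have xz : agree N x z by move=> i iN; rewrite xy// yz// (leq_trans iN).
have := hN _ Xy xy; have := hN _ Xz xz; have := dD y x z Xy Xx Xz.
rewrite (dC y x)//; lra.
Qed.

(** A Lebesgue number for the cover by cylinders of length one, hence an expansivity constant:
    orbits closer than [r] during N steps spell the same N-word. *)
Lemma compatible_lebesgue :
  exists2 r, 0 < r & forall x y, X x -> X y -> d x y < r -> x 0%N = y 0%N.
Proof.
have [[d0 d00 dC dD] _] := hd.
have [x Xx|k hk] := @compact_cylinder_uniform _ X
  (fun k x => forall y, X y -> d x y < k.+1%:R^-1 -> x 0%N = y 0%N) cX; last first.
  by exists k.+1%:R^-1 => // x y /hk; apply.
have [_ /(_ x)[//|r r0 hr]] := compatible_open_cylinder 1 x.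
have r20 : 0 < r / 2 by rewrite divr_gt0.
have [N hN] := compatible_cylinder Xx r20.
exists (maxn 1 N), (Num.truncn (r / 2)^-1) => y k Xy xy kr z Xz yz.
have h1 : d x y < r / 2 by apply: hN => // i iN; rewrite xy// leq_max iN orbT.
have h2 : d y z < r / 2.
  rewrite (lt_le_trans yz)// invf_ple ?posrE//.
  by rewrite (le_trans (ltW (truncnS_gt _)))// ler_nat ltnS.
have [_ xz] : X z /\ agree 1 x z.
  by apply: hr => //; have h := dD x y z Xx Xy Xz; lra.
by rewrite -xz// -xy// leq_max.
Qed.

Lemma compatible_bounded_pmetric : bounded_pmetric X d.
Proof.
have [[d0 d00 dC dD] _] := hd; split=> //; first by move=> x Xx; apply/d00.
have [->|/set0P[x0 Xx0]] := eqVneq X set0; first by exists 0 => x y.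
have [x Xx|k hk] := @compact_cylinder_uniform _ X (fun k x => d x0 x <= k%:R) cX.
  have [N hN] := compatible_cylinder Xx ltr01.
  exists N, (Num.truncn (d x0 x + 1)).+1 => y k Xy xy kr.
  apply: (@le_trans _ _ (d x0 x + 1)).
    by have := hN _ Xy xy; have := dD x0 x y Xx0 Xx Xy; lra.
  by rewrite (le_trans (ltW (truncnS_gt _)))// ler_nat.
exists (k%:R + k%:R) => x y Xx Xy; have := hk _ Xx; have := hk _ Xy.
have := dD x x0 y Xx Xx0 Xy; rewrite (dC x x0)//; lra.
Qed.

End CompatibleMetric.

(** * Words of a subshift and its covering numbers *)

Section Words.
Context {C : finType}.
Implicit Types (z : nat -> C) (U : set (nat -> C)).

Definition word N z : {ffun 'I_N -> C} := [ffun i : 'I_N => z i].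

Definition words N U : {set {ffun 'I_N -> C}} :=
  [set u | `[< exists2 z, U z & word N z = u >]].

Lemma word_agree N x y : word N x = word N y <-> agree N x y.
Proof.
split=> [/ffunP h i iN|h]; first by have := h (Ordinal iN); rewrite !ffunE.
by apply/ffunP => i; rewrite !ffunE h.
Qed.

Lemma wordsP N U u : reflect (exists2 z, U z & word N z = u) (u \in words N U).
Proof. by rewrite inE; exact: asboolP. Qed.

Lemma mem_words N U z : U z -> word N z \in words N U.
Proof. by move=> Uz; apply/wordsP; exists z. Qed.

Lemma iter_seq_shift (T : Type) n (z : nat -> T) :
  iter n (@seq_shift T) z = fun k => z (n + k)%N.
Proof.
by elim: n => //= n ->; apply/funext => k; rewrite /seq_shift addnS.
Qed.

Definition split_word M N (u : {ffun 'I_(M + N) -> C}) :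
    {ffun 'I_M -> C} * {ffun 'I_N -> C} :=
  ([ffun i => u (lshift N i)], [ffun i => u (rshift M i)]).

Lemma split_word_inj M N : injective (@split_word M N).
Proof.
move=> u v [/ffunP hl /ffunP hr]; apply/ffunP => i.
case: (split_ordP i) => j ->.
  by have := hl j; rewrite !ffunE.
by have := hr j; rewrite !ffunE.
Qed.

Lemma split_wordE M N z : split_word (word (M + N) z) = (word M z, word N (iter M (@seq_shift C) z)).
Proof.
by congr pair; apply/ffunP => i; rewrite !ffunE// iter_seq_shift.
Qed.

Section Subshift.
Variable X : set (nat -> C).
Hypothesis hX : forall z, X z -> X (seq_shift z).

Lemma split_words M N u : u \in words (M + N) X ->
  (split_word u).1 \in words M X /\ (split_word u).2 \in words N X.
Proof.
move=> /wordsP[z Xz <-]; rewrite split_wordE; split; apply: mem_words => //.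
exact: iter_stable.
Qed.

Lemma card_wordsD M N : (#|words (M + N) X| <= #|words M X| * #|words N X|)%N.
Proof.
rewrite -cardsX -(card_imset _ (@split_word_inj M N)).
by apply/subset_leq_card/fintype.subsetP => _ /imsetP[u /split_words[h1 h2] ->]; rewrite inE h1.
Qed.

End Subshift.

Lemma card_words_gt0 N U : U !=set0 -> (0 < #|words N U|)%N.
Proof. by move=> [z Uz]; apply/card_gt0P; exists (word N z); exact: mem_words. Qed.

(** A cell shows at most one word of length N, so the map from a cell to its word, or to [None],
    reaches every word. *)
Lemma card_words_le_cover N U (I : finType) (V : I -> set (nat -> C)) :
  U `<=` \bigcup_k V k ->
  (forall k x y, U x -> U y -> V k x -> V k y -> agree N x y) -> (#|words N U| <= #|I|)%N.
Proof.
move=> UV hV.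
pose f k := [pick u | `[< exists2 x, U x /\ V k x & word N x = u >]].
rewrite -(card_imset _ (@Some_inj _)).
apply: leq_trans (leq_imset_card f I); apply/subset_leq_card/fintype.subsetP.
move=> _ /imsetP[_ /wordsP[z Uz <-] ->].
have [k _ Vz] := UV _ Uz; apply/imsetP; exists k => //; rewrite /f.
case: pickP => [u /asboolP[x [Ux Vx] <-]|/(_ (word N z)) /asboolP[]].
  by congr Some; apply/word_agree; exact: hV Vz Vx.
by exists z.
Qed.

End Words.

Section SubshiftEntropy.
Context {R : realType} {C : finType} (X : set (fullshift C)).
Variable d : fullshift C -> fullshift C -> R.
Hypotheses (cX : compact X) (hd : compatible_metric X d).
Hypothesis hX : forall z, X z -> X (seq_shift z).

(** At time [n < N] precision [e] involves only the [L] symbols starting at [n], hence the window of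
    length [N + L]. *)
Lemma dynd_seq_shift_lt N L e x y : 0 < e ->
  (forall x y, X x -> X y -> agree L x y -> d x y < e) ->
  X x -> X y -> agree (N + L) x y -> dynd (@seq_shift _) d N x y < e.
Proof.
move=> e0 hL Xx Xy xy; apply/dynd_ltP; split=> // n nN.
apply: hL; [exact: iter_stable|exact: iter_stable|move=> i iL].
by rewrite !iter_seq_shift xy//; lia.
Qed.

Lemma agree_dynd_seq_shift N r x y :
  (forall x y, X x -> X y -> d x y < r -> x 0%N = y 0%N) ->
  X x -> X y -> dynd (@seq_shift _) d N x y < r -> agree N x y.
Proof.
move=> hr Xx Xy /dynd_ltP[_ h] n nN.
have := hr _ _ (iter_stable hX n Xx) (iter_stable hX n Xy) (h n nN).
by rewrite !iter_seq_shift addn0.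
Qed.

(** [U] need not be all of [X]: the weighted covering number counts covers of preimages. *)
Lemma covnum_le_words (U : set (fullshift C)) N L e e' : 0 < e' -> e' < e -> U `<=` X ->
  (forall x y, X x -> X y -> agree L x y -> d x y < e') ->
  (covnum X (dynd (@seq_shift _) d N) U e <= #|words (N + L) U|)%N /\
  exists V : 'I_(covnum X (dynd (@seq_shift _) d N) U e) -> set (fullshift C), [/\
    forall k, open_in X (dynd (@seq_shift _) d N) (V k), U `<=` \bigcup_k V k &
    forall k, diam (dynd (@seq_shift _) d N) (V k) < e].
Proof.
move=> e'0 ee' UX hL.
apply: (@covnum_cover _ _ X _ U e e' _ _ (fun u => [set x | X x /\ word (N + L) x = u])) => //.
- exact: bounded_pmetric_dynd hX (compatible_bounded_pmetric cX hd).
- exact: ltW.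
- by move=> u x [].
- by move=> x Ux; exists (word (N + L) x); [exact: mem_words|split=> //; exact: UX].
- move=> u x y [Xx <-] [Xy yx]; apply/ltW/dynd_seq_shift_lt => //; first exact: hL.
  exact/word_agree.
Qed.

End SubshiftEntropy.

Lemma cvg_inv_nat (R : realType) : (n%:R^-1 : R) @[n --> \oo] --> (0 : R).
Proof.
rewrite -(cvg_shiftn 1); apply: cvg_trans (@cvg_harmonic R).
by apply: near_eq_cvg; apply: nearW => n /=; rewrite addn1.
Qed.

Lemma cvg_shift_div (R : realType) (u : nat -> R) (h : R) L :
  u n / n%:R @[n --> \oo] --> h -> u (n + L)%N / n%:R @[n --> \oo] --> h.
Proof.
rewrite -(cvg_shiftn L) => uh.
have h1 : 1 + L%:R * n%:R^-1 @[n --> \oo] --> 1 + L%:R * (0 : R).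
  by apply: cvgD; [exact: cvg_cst|apply: cvgM; [exact: cvg_cst|exact: cvg_inv_nat]].
rewrite mulr0 addr0 in h1.
have hc : u (n + L)%N / (n + L)%:R * (1 + L%:R * n%:R^-1) @[n --> \oo] --> h.
  by rewrite -[h]mulr1; exact: cvgM uh h1.
apply: cvg_trans hc.
apply: near_eq_cvg; near=> n => /=.
have n0 : n%:R != 0 :> R by rewrite pnatr_eq0 -lt0n; near: n; exists 1%N.
rewrite natrD; field; rewrite n0/= -natrD pnatr_eq0 addn_eq0 -(pnatr_eq0 R).
by rewrite (negPf n0).
Unshelve. all: by end_near. Qed.

Lemma squeeze_shift (R : realType) (u v : nat -> R) (h : R) L :
  (forall n, (0 < n)%N -> u n <= v n <= u (n + L)%N) -> u n / n%:R @[n --> \oo] --> h ->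
  v n / n%:R @[n --> \oo] --> h.
Proof.
move=> uv uh; apply: squeeze_cvgr (uh) (cvg_shift_div L uh).
near=> n; have /andP[h1 h2] : u n <= v n <= u (n + L)%N.
  by apply: uv; near: n; exists 1%N.
by rewrite !ler_wpM2r.
Unshelve. all: by end_near. Qed.

Lemma ler_ln_nat (R : realType) (m n : nat) : (0 < m)%N -> (m <= n)%N ->
  ln (m%:R : R) <= ln n%:R.
Proof.
by move=> m0 mn; rewrite ler_ln ?posrE ?ltr0n ?ler_nat// (leq_trans m0).
Qed.

Lemma ln_nat_ge0 (R : realType) n : 0 <= ln (n%:R : R).
Proof.
case: n => [|n]; first by rewrite ln0.
by rewrite ln_ge0// ler1n.
Qed.

(** By expansivity the growth rate at scale [e] is constant for small [e], so the limit over scales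
    is that of an eventually constant function. *)
Lemma lim_right_eq (R : realType) (g : R -> R) (h e0 : R) : 0 < e0 ->
  (forall e, 0 < e -> e < e0 -> g e = h) ->
  lim ((g e)%:E @[e --> 0^'+]) = h%:E.
Proof.
move=> e00 gh; apply: lim_near_cst => //.
near=> e; congr EFin; apply: gh; first by near: e; exact: nbhs_right_gt.
by near: e; exact: nbhs_right_lt.
Unshelve. all: by end_near. Qed.

(** * Topological entropy as the growth rate of words *)

Section TopologicalEntropy.
Context {R : realType} {C : finType} (X : set (fullshift C)).
Hypotheses (cX : compact X) (X0 : X !=set0).
Hypothesis hX : forall z, X z -> X (seq_shift z).

Lemma word_entropy_cvg :
  exists2 h : R, 0 <= h & ln #|words N X|%:R / N%:R @[N --> \oo] --> h.
Proof.
apply: (@fekete _ (fun N => ln #|words N X|%:R)) => [n|m n]; first exact: ln_nat_ge0.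
rewrite -lnM ?posrE ?ltr0n ?card_words_gt0// -natrM.
by apply: ler_ln_nat; [exact: card_words_gt0|exact: card_wordsD].
Qed.

(** A set of small [d_N]-diameter shows a single N-word, and cylinders of length [N + L] are small
    for [d_N]. *)
Lemma htop_word_entropy (d : fullshift C -> fullshift C -> R) (h : R) :
  compatible_metric X d -> ln #|words N X|%:R / N%:R @[N --> \oo] --> h ->
  htop X (@seq_shift _) d = h%:E.
Proof.
move=> hd hh; have [r r0 hr] := compatible_lebesgue cX hd.
apply: (lim_right_eq r0) => e e0 er; apply: cvg_lim => //.
have e20 : 0 < e / 2 by rewrite divr_gt0.
have [L hL] := compatible_uniform_cylinder cX hd e20.
apply: (@squeeze_shift _ (fun N => ln #|words N X|%:R) _ _ L) hh => N _.
have e2e : e / 2 < e by rewrite ltr_pdivrMr// mulr2n mulrDr mulr1 ltrDl.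
have XX : X `<=` X by [].
have [h1 [V [Vo XV Vd]]] := covnum_le_words cX hd hX N e20 e2e XX hL.
have hdN := bounded_pmetric_dynd N hX (compatible_bounded_pmetric cX hd).
have h2 : (#|words N X| <= covnum X (dynd (@seq_shift _) d N) X e)%N.
  rewrite -[leqRHS]card_ord; apply: card_words_le_cover XV _ => k x y Xx Xy Vx Vy.
  apply: agree_dynd_seq_shift hr Xx Xy _ => //.
  apply: le_lt_trans er; apply: le_trans (ltW (Vd k)).
  by apply: (diam_ge_sub hdN) => //; case: (Vo k).
have w0 := card_words_gt0 N X0.
by rewrite !ler_ln_nat// (leq_trans w0).
Qed.

End TopologicalEntropy.

(** For two summands, each share [q = z / (x + y)] lies in [0, 1], so [q <= q ^ w]; multiplying by
    [(x + y) ^ w] and adding both shares gives the claim. *)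
Lemma powR_sum_subadd (R : realType) (w : R) (I : finType) (F : I -> R) :
  0 < w -> w <= 1 -> (forall i, 0 <= F i) ->
  (\sum_i F i) `^ w <= \sum_i F i `^ w.
Proof.
move=> w0 w1 F0.
have sub x y : 0 <= x -> 0 <= y -> (x + y) `^ w <= x `^ w + y `^ w.
  move=> x0 y0; have [xy|xy] := ltP 0 (x + y); last first.
    have -> : x = 0 by lra.
    have -> : y = 0 by lra.
    by rewrite addr0 powR0 ?gt_eqF// addr0.
  have h z : 0 <= z -> z <= x + y -> z / (x + y) * (x + y) `^ w <= z `^ w.
    move=> z0 zxy; have q0 : 0 <= z / (x + y) by rewrite divr_ge0// ltW.
    have -> : z `^ w = (z / (x + y)) `^ w * (x + y) `^ w.
      by rewrite -powRM ?divfK ?gt_eqF// ltW.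
    rewrite ler_wpM2r ?powR_ge0//.
    have [->|qn0] := eqVneq (z / (x + y)) 0; first exact: powR_ge0.
    have qp : 0 < z / (x + y) by rewrite lt_neqAle eq_sym qn0.
    by apply: ger1_powR => //; rewrite qp ler_pdivrMr// mul1r.
  have -> : (x + y) `^ w = x / (x + y) * (x + y) `^ w + y / (x + y) * (x + y) `^ w.
    by rewrite -mulrDl -mulrDl divff ?mul1r// gt_eqF.
  by apply: lerD; apply: h => //; lra.
suff [] : 0 <= \sum_i F i /\ (\sum_i F i) `^ w <= \sum_i F i `^ w by [].
elim/big_rec2: _ => [|i x y _ [y0 h]]; first by rewrite powR0 ?gt_eqF.
by split; [rewrite addr_ge0|rewrite (le_trans (sub _ _ _ _))// lerD2l].
Qed.

Lemma finite_set_min (R : realType) (A : set R) : finite_set A -> A !=set0 ->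
  exists2 m, A m & lbound A m.
Proof.
move=> /finite_seqP[s ->] [x0 /= x0s].
have : s != [::] by case: s x0s.
elim: s {x0 x0s} => // x s IH _; have [->|/IH[m ms mlb]] := eqVneq s [::].
  by exists x => /= [|y]; rewrite /= mem_seq1 // => /eqP->.
exists (Num.min x m) => /= [|y].
  by rewrite inE; case: leP => _; rewrite ?eqxx// ms orbT.
by rewrite /= inE ge_min => /orP[/eqP->|/mlb->]; rewrite ?lexx ?orbT.
Qed.

(** A set of reals need not have a least element. Here a nonzero term is at least 1, so a sum of
    value at most K has at most K nonzero terms, each the w-th power of an integer at most K^(1/w).
    Terms with [c k = 0] vanish because [w > 0], so the unbounded length [n] does no harm: only
    finitely many values are at most K. *)
Lemma minimum_powR_sum (R : realType) (w : R) (S : set R) : 0 < w ->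
  (forall r, S r -> exists n (c : 'I_n -> nat), r = \sum_(k < n) (c k)%:R `^ w) ->
  S !=set0 -> S (minimum 0 S) /\ lbound S (minimum 0 S).
Proof.
move=> w0 hS [r0 Sr0]; apply: (@xgetPex _ 0 [set x | S x /\ lbound S x]).
pose K := (Num.truncn r0).+1; have r0K : r0 <= K%:R by exact/ltW/truncnS_gt.
pose M := (Num.truncn (K%:R `^ w^-1)).+1.
pose F := [set (m%:R `^ w : R) | m in `I_M].
have finF : finite_set F by apply: finite_image; exact: finite_II.
(* [G k] holds the sums of at most [k] elements of [F]. *)
pose G := fix G k : set R := if k is j.+1 then G j `|` [set x + y | x in F & y in G j] else [set 0].
have finG k : finite_set (G k).
  elim: k => [|k IH] /=; first exact: finite_set1.
  by rewrite finite_setU; split=> //; exact: finite_image2.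
have G0 k : G k 0 by elim: k => //= k IH; left.
have key n (c : 'I_n -> nat) k : (k <= K)%N ->
    \sum_(i < n) (c i)%:R `^ w <= k%:R :> R -> G k (\sum_(i < n) (c i)%:R `^ w).
  elim: n c k => [|n IH] c k kK; first by rewrite big_ord0.
  rewrite big_ord_recl; case c0 : (c ord0) => [|m].
    by rewrite powR0 ?gt_eqF// add0r => h; apply: IH.
  have s0 : 0 <= \sum_(i < n) (c (lift ord0 i))%:R `^ w :> R.
    by apply: sumr_ge0 => i _; exact: powR_ge0.
  have m1 : 1 <= m.+1%:R `^ w :> R by rewrite -[leLHS](powRr0 m.+1%:R) ler_powR ?ler1n// ltW.
  case: k kK => [|k] kK h; first lra.
  right; exists (m.+1%:R `^ w).
    exists m.+1 => //=.
    have : m.+1%:R `^ w <= K%:R :> R.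
      by apply: le_trans (_ : k.+1%:R <= _); [lra|rewrite ler_nat].
    move=> mK; rewrite /M ltnS truncn_ge_nat ?powR_ge0//.
    have -> : m.+1%:R = (m.+1%:R `^ w) `^ w^-1 :> R.
      by rewrite -powRrM mulfV ?gt_eqF// powRr1.
    by apply: ge0_ler_powR; rewrite ?nnegrE ?invr_ge0 ?powR_ge0 ?ler0n ?(ltW w0).
  exists (\sum_(i < n) (c (lift ord0 i))%:R `^ w) => //.
  apply: IH; first exact: ltnW.
  by move: h; rewrite -[k.+1%:R]natr1; lra.
have finS : finite_set (S `&` [set r | r <= K%:R]).
  apply: sub_finite_set (finG K) => r [Sr rK].
  by have [n [c rE]] := hS _ Sr; rewrite rE; apply: key => //; rewrite -rE.
have [|m [Sm mK] mlb] := finite_set_min finS; first by exists r0.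
exists m; split=> // r Sr; have [rK|/ltW Kr] := leP r K%:R; first exact: mlb.
exact: le_trans Kr.
Qed.

(** * Weighted entropy as a sum over words *)

Lemma proj_snd_continuous (A D : choiceType) : continuous (@proj_snd A D).
Proof.
move=> x O; rewrite nbhsE => -[U [oU Ux] UO].
have [N hN] := open_subcylinder oU Ux.
apply: (@filterS _ _ _ [set y : fullshift (A * D)%type | agree N x y]).
  by move=> y xy; apply: UO; apply: hN => i iN; rewrite /proj_snd xy.
by apply: open_nbhs_nbhs; split; [exact: open_cylinder|move=> i].
Qed.

Section Fibers.
Context {R : realType} {A D : finType}.
Implicit Types (X : set (fullshift (A * D)%type)) (w : R).

Definition snd_word N (u : {ffun 'I_N -> A * D}) : {ffun 'I_N -> D} :=
  [ffun i => (u i).2].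

Definition fiber_words N X (v : {ffun 'I_N -> D}) :=
  [set u in words N X | snd_word u == v].

Lemma mem_fiber_words N X v u :
  (u \in @fiber_words N X v) = (u \in words N X) && (snd_word u == v).
Proof. by rewrite /fiber_words inE. Qed.

(** This is Z_N. It interpolates between the number of words of the projection (w = 0) and of [X] (w
    = 1). *)
Definition weighted_sum w N X : R :=
  \sum_(v in words N (@proj_snd A D @` X)) #|fiber_words X v|%:R `^ w.

Lemma word_proj_snd N (z : fullshift (A * D)%type) :
  word N (@proj_snd A D z) = snd_word (word N z).
Proof. by apply/ffunP => i; rewrite !ffunE. Qed.

Lemma snd_word_words N X u : u \in words N X ->
  snd_word u \in words N (@proj_snd A D @` X).
Proof.
move=> /wordsP[z Xz <-]; rewrite -word_proj_snd; apply: mem_words.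
by exists z.
Qed.

Lemma fiber_words_gt0 N X v : v \in words N (@proj_snd A D @` X) ->
  (0 < #|fiber_words X v|)%N.
Proof.
move=> /wordsP[_ [z Xz <-] <-]; apply/card_gt0P; exists (word N z).
by rewrite mem_fiber_words mem_words//= word_proj_snd.
Qed.

Lemma card_fiber_words_le N X v : (#|@fiber_words N X v| <= #|A| ^ N)%N.
Proof.
pose f (u : {ffun 'I_N -> A * D}) : {ffun 'I_N -> A} := [ffun i => (u i).1].
have inj : {in fiber_words X v &, injective f}.
  move=> x y; rewrite !mem_fiber_words.
  move=> /andP[_ /eqP/ffunP xv] /andP[_ /eqP/ffunP yv] /ffunP xy.
  apply/ffunP => i; have := xy i; have := xv i; have := yv i; rewrite !ffunE.
  by case: (x i) (y i) => [x1 x2] [y1 y2] /= -> -> ->.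
by rewrite -(card_in_imset inj) (leq_trans (max_card _))// card_ffun !card_ord.
Qed.

Section Weight.
Variables (X : set (fullshift (A * D)%type)) (w : R).
Hypotheses (X0 : X !=set0) (w0 : 0 < w).
Hypothesis hX : forall z, X z -> X (seq_shift z).

Lemma weighted_sum_ge1 N : 1 <= weighted_sum w N X.
Proof.
have [z Xz] := X0; have vW : word N (@proj_snd A D z) \in words N (@proj_snd A D @` X).
  by apply: mem_words; exists z.
rewrite /weighted_sum (bigD1 (word N (@proj_snd A D z)))//=.
have h : 1 <= #|fiber_words X (word N (@proj_snd A D z))|%:R `^ w :> R.
  by rewrite -[leLHS](powRr0 #|fiber_words X (word N (@proj_snd A D z))|%:R)
    ler_powR ?(ltW w0)// ler1n fiber_words_gt0.
apply: (le_trans h); rewrite lerDl; apply: sumr_ge0 => i _; exact: powR_ge0.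
Qed.

Lemma split_snd_word M N (u : {ffun 'I_(M + N) -> A * D}) :
  split_word (snd_word u) = (snd_word (split_word u).1, snd_word (split_word u).2).
Proof. by congr pair; apply/ffunP => i; rewrite !ffunE. Qed.

Lemma card_fiber_wordsD M N (v : {ffun 'I_(M + N) -> D}) :
  (#|fiber_words X v| <= #|fiber_words X (split_word v).1| * #|fiber_words X (split_word v).2|)%N.
Proof.
rewrite -cardsX -(card_imset _ (@split_word_inj _ M N)).
apply/subset_leq_card/fintype.subsetP => _ /imsetP[u + ->].
rewrite mem_fiber_words => /andP[/(split_words hX)[h1 h2] /eqP <-].
by rewrite finset.in_setX !mem_fiber_words h1 h2 split_snd_word !eqxx.
Qed.

Lemma seq_shift_proj_snd z : (@proj_snd A D @` X) z -> (@proj_snd A D @` X) (seq_shift z).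
Proof. by move=> [x Xx <-]; exists (seq_shift x) => //; exact: hX. Qed.

(** Cutting a word in two is injective and fibers are submultiplicative; pairs of words that cannot
    be concatenated only add nonnegative terms on the right. *)
Lemma weighted_sumD M N : weighted_sum w (M + N) X <= weighted_sum w M X * weighted_sum w N X.
Proof.
pose G (p : {ffun 'I_M -> D} * {ffun 'I_N -> D}) : R :=
  #|fiber_words X p.1|%:R `^ w * #|fiber_words X p.2|%:R `^ w.
have G0 p : 0 <= G p by rewrite mulr_ge0// powR_ge0.
set W := fun N => words N (@proj_snd A D @` X).
have -> : weighted_sum w M X * weighted_sum w N X = \sum_(p in finset.setX (W M) (W N)) G p.
  rewrite /weighted_sum big_distrlr/= pair_big; apply: eq_bigl => -[p q].
  by rewrite finset.in_setX.
apply: (@le_trans _ _ (\sum_(p in [set split_word u | u in W (M + N)%N]%SET) G p)).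
  rewrite big_imset/=; last by move=> x y _ _; exact: split_word_inj.
  apply: ler_sum => v _; rewrite /G -powRM ?ler0n//.
  apply: ge0_ler_powR; rewrite ?nnegrE ?(ltW w0) ?mulr_ge0 ?ler0n// -natrM ler_nat.
  exact: card_fiber_wordsD.
rewrite [leRHS](big_setID [set split_word u | u in W (M + N)%N]%SET)/=.
rewrite (_ : (_ :&: _)%SET = [set split_word u | u in W (M + N)%N]%SET).
  by rewrite lerDl sumr_ge0.
apply/finset.setIidPr/fintype.subsetP => _ /imsetP[v vW ->].
have [h1 h2] := split_words seq_shift_proj_snd vW.
by rewrite finset.in_setX h1 h2.
Qed.

Lemma weighted_entropy_cvg :
  exists2 h : R, 0 <= h & ln (weighted_sum w N X) / N%:R @[N --> \oo] --> h.
Proof.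
have pos N : 0 < weighted_sum w N X by exact: lt_le_trans (weighted_sum_ge1 N).
apply: (@fekete _ (fun N => ln (weighted_sum w N X))) => [n|m n].
  by rewrite ln_ge0 ?weighted_sum_ge1.
by rewrite -lnM ?posrE// ler_ln ?posrE ?mulr_gt0 ?weighted_sumD.
Qed.

End Weight.
End Fibers.

Lemma open_in_le (R : realType) (T : Type) (X U : set T) (d e : T -> T -> R) :
  (forall x y, d x y <= e x y) -> open_in X d U -> open_in X e U.
Proof.
move=> de [UX hU]; split=> // x /hU[r r0 hr]; exists r => // y Xy xy.
by apply: hr => //; exact: le_lt_trans (de x y) xy.
Qed.

Lemma compact_proj_snd (A D : choiceType) (X : set (fullshift (A * D)%type)) :
  compact X -> compact (@proj_snd A D @` X).
Proof.
move=> cX; apply: continuous_compact cX; apply: continuous_subspaceT.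
exact: proj_snd_continuous.
Qed.

Section WeightedEntropy.
Context {R : realType} {A D : finType} (X : set (fullshift (A * D)%type)).
Variables (d : fullshift (A * D)%type -> fullshift (A * D)%type -> R).
Variables (d' : fullshift D -> fullshift D -> R) (w : R).
Hypotheses (cX : compact X) (X0 : X !=set0) (w0 : 0 < w) (w1 : w <= 1).
Hypothesis hX : forall z, X z -> X (seq_shift z).
Let p := @proj_snd A D.
Hypotheses (hd : compatible_metric X d) (hd' : compatible_metric (p @` X) d').

Let cY : compact (p @` X). Proof. exact: compact_proj_snd. Qed.

Let hY : forall y, (p @` X) y -> (p @` X) (seq_shift y).
Proof. exact: seq_shift_proj_snd. Qed.

Let dN N := dynd (@seq_shift (A * D)%type) d N.
Let dN' N := dynd (@seq_shift D) d' N.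

(** Cover the factor by cylinders of length [N + L]: the words seen above one of them form a single
    fiber. The first conclusion exhibits a cover attaining the minimum, to which the lower bound is
    then applied. *)
Lemma wcovnum_le_weighted_sum N L e : 0 < e -> (0 < N)%N ->
  (forall x y, X x -> X y -> agree L x y -> d x y < e / 2) ->
  (forall x y, (p @` X) x -> (p @` X) y -> agree L x y -> d' x y < e / 2) ->
  (exists n (V : 'I_n -> set (fullshift D)), [/\
    forall k, open_in (p @` X) (dN' N) (V k), p @` X = \bigcup_k V k,
    forall k, diam (dN' N) (V k) < e &
    wcovnum w p X (dN N) (p @` X) (dN' N) e =
      \sum_(k < n) (covnum X (dN N) (X `&` p @^-1` V k) e)%:R `^ w]) /\
  wcovnum w p X (dN N) (p @` X) (dN' N) e <= weighted_sum w (N + L) X.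
Proof.
move=> e0 N0 hL hL'.
have e20 : 0 < e / 2 by rewrite divr_gt0.
have e2e : e / 2 < e by rewrite ltr_pdivrMr// mulr2n mulrDr mulr1 ltrDl.
pose W := words (N + L) (p @` X).
pose V (k : 'I_#|W|) := [set y | (p @` X) y /\ word (N + L) y = enum_val k].
have Vo k : open_in (p @` X) (dN' N) (V k).
  have /wordsP[y Yy yk] := enum_valP k.
  (* [d'_N] dominates [d'] through its term of index 0, which is where [0 < N] enters. *)
  apply: (@open_in_le _ _ _ _ d') => [u v|]; first exact: (@dynd_ge _ _ _ d' N u v 0).
  rewrite (_ : V k = [set z | (p @` X) z /\ agree (N + L) y z]).
    exact: compatible_open_cylinder.
  apply/seteqP; split=> z [Yz].
    by rewrite -yk => zy; split=> //; exact/word_agree.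
  by move=> /word_agree yz; split=> //; rewrite -yk.
have YV : p @` X = \bigcup_k V k.
  apply/seteqP; split=> [y Yy|y [k _ []]//].
  have yW : word (N + L) y \in W by exact: mem_words.
  by exists (enum_rank_in yW (word (N + L) y)) => //; split=> //; rewrite enum_rankK_in.
have Vd k : diam (dN' N) (V k) < e.
  apply: le_lt_trans e2e; apply: diam_le => [|x y [Yx xk] [Yy yk]]; first exact: ltW.
  apply/ltW/(dynd_seq_shift_lt hY e20 hL' Yx Yy).
  by apply/word_agree; rewrite xk.
set S := [set r | exists n (V : 'I_n -> set (fullshift D)), [/\
    forall k, open_in (p @` X) (dN' N) (V k), p @` X = \bigcup_k V k,
    forall k, diam (dN' N) (V k) < e &
    r = \sum_(k < n) (covnum X (dN N) (X `&` p @^-1` V k) e)%:R `^ w]].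
have [| |[n [V' hV']] lb] := @minimum_powR_sum _ w S w0.
- move=> r [n [V' [_ _ _ ->]]].
  by exists n, (fun k => covnum X (dN N) (X `&` p @^-1` V' k) e).
- by eexists; exists #|W|, V; split=> //.
split; first by exists n, V'.
apply: (@le_trans _ _ (\sum_(k < #|W|) (covnum X (dN N) (X `&` p @^-1` V k) e)%:R `^ w)).
  by apply: lb; exists #|W|, V; split.
have -> : weighted_sum w (N + L) X = \sum_(k < #|W|) #|fiber_words X (enum_val k)|%:R `^ w :> R.
  by rewrite /weighted_sum big_enum_val.
apply: ler_sum => k _.
apply: ge0_ler_powR; rewrite ?nnegrE ?ler0n ?(ltW w0)// ler_nat.
have UX : X `&` p @^-1` V k `<=` X by move=> x [].
have [h _] := covnum_le_words cX hd hX N e20 e2e UX hL.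
apply: leq_trans h _; apply/subset_leq_card/fintype.subsetP => u /wordsP[z [Xz [_ zk]] <-].
by rewrite mem_fiber_words mem_words//= -word_proj_snd zk.
Qed.

(** The fiber above [v] is distributed among the sets [V k], and subadditivity of the power w splits
    its weight accordingly. After exchanging the sums, each [V k] keeps one term at most, because a
    set of small [d'_N]-diameter shows a single word [v]. *)
Lemma weighted_sum_le_cover N e n (V : 'I_n -> set (fullshift D)) L : 0 < e ->
  (forall x y, X x -> X y -> d x y < e -> x 0%N = y 0%N) ->
  (forall x y, (p @` X) x -> (p @` X) y -> d' x y < e -> x 0%N = y 0%N) ->
  (forall x y, X x -> X y -> agree L x y -> d x y < e / 2) ->
  (forall k, open_in (p @` X) (dN' N) (V k)) -> p @` X = \bigcup_k V k ->
  (forall k, diam (dN' N) (V k) < e) ->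
  weighted_sum w N X <= \sum_(k < n) (covnum X (dN N) (X `&` p @^-1` V k) e)%:R `^ w.
Proof.
move=> e0 he he' hL Vo YV Vd.
have e20 : 0 < e / 2 by rewrite divr_gt0.
have e2e : e / 2 < e by rewrite ltr_pdivrMr// mulr2n mulrDr mulr1 ltrDl.
have hdN := bounded_pmetric_dynd N hX (compatible_bounded_pmetric cX hd).
have hdN' := bounded_pmetric_dynd N hY (compatible_bounded_pmetric cY hd').
pose U k := X `&` p @^-1` V k.
have cov k : (#|words N (U k)| <= covnum X (dN N) (U k) e)%N.
  have UX : U k `<=` X by move=> x [].
  have [_ [V' [Vo' UV' Vd']]] := covnum_le_words cX hd hX N e20 e2e UX hL.
  rewrite -[leqRHS]card_ord; apply: card_words_le_cover UV' _.
  move=> j x y /UX Xx /UX Xy Vx Vy.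
  apply: agree_dynd_seq_shift he Xx Xy _ => //; apply: le_lt_trans (Vd' j).
  by apply: (diam_ge_sub hdN) => //; case: (Vo' j).
(* The number of words of the fiber above [v] that are realized over [V k]. *)
pose F k (v : {ffun 'I_N -> D}) : nat := #|words N (U k) :&: fiber_words X v|.
have step1 v : v \in words N (p @` X) ->
    #|fiber_words X v|%:R `^ w <= \sum_k (F k v)%:R `^ w :> R.
  move=> vW; apply: le_trans (powR_sum_subadd w0 w1 _); last by move=> k; exact: ler0n.
  apply: ge0_ler_powR; rewrite ?nnegrE ?ler0n ?(ltW w0) ?sumr_ge0// -natr_sum ler_nat.
  have sub : fiber_words X v \subset (\bigcup_k (words N (U k) :&: fiber_words X v))%SET.
    apply/fintype.subsetP => u ufib.
    have := ufib; rewrite mem_fiber_words => /andP[/wordsP[z Xz zu] _].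
    have : (p @` X) (p z) by exists z.
    rewrite YV => -[k _ Vz]; apply/finset.bigcupP; exists k => //.
    by rewrite finset.in_setI ufib -zu andbT; exact: mem_words.
  apply: leq_trans (subset_leq_card sub) _.
  elim/big_rec2: _ => [|k m B _ Bm]; first by rewrite cards0.
  by rewrite cardsU (leq_trans (leq_subr _ _))// leq_add2l.
apply: (@le_trans _ _ (\sum_(v in words N (p @` X)) \sum_k (F k v)%:R `^ w)).
  by apply: ler_sum => v vW; exact: step1.
rewrite exchange_big/=; apply: ler_sum => k _.
have F0 v : F k v != 0%N -> forall v', v' != v -> F k v' = 0%N.
  rewrite /F -lt0n => /card_gt0P[u]; rewrite finset.in_setI mem_fiber_words.
  move=> /and3P[/wordsP[x [Xx Vx] <-] _ /eqP vE] v' v'v.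
  apply/eqP; rewrite -leqn0 leqNgt; apply/negP => /card_gt0P[u'].
  rewrite finset.in_setI mem_fiber_words.
  move=> /and3P[/wordsP[x' [Xx' Vx'] <-] _ /eqP vE']; case/eqP: v'v.
  rewrite -vE -vE' -!word_proj_snd; apply/word_agree.
  apply: agree_dynd_seq_shift he' _ _ _ => //; [by exists x'|by exists x|].
  apply: le_lt_trans (Vd k); apply: (diam_ge_sub hdN') => //.
  by case: (Vo k).
have Fle v : (F k v)%:R `^ w <= (covnum X (dN N) (U k) e)%:R `^ w :> R.
  apply: ge0_ler_powR; rewrite ?nnegrE ?ler0n ?(ltW w0)// ler_nat.
  by apply: leq_trans (cov k); exact/subset_leq_card/finset.subsetIl.
have [/existsP[v /andP[vW Fv]]|] := boolP [exists v, (v \in words N (p @` X)) && (F k v != 0%N)].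
  rewrite (bigD1 v)//= big1 ?addr0// => v' /andP[_ /(F0 _ Fv) ->].
  by rewrite powR0 ?gt_eqF.
move=> /existsPn h; rewrite big1 ?powR_ge0// => v vW.
by have := h v; rewrite vW/= negbK => /eqP->; rewrite powR0 ?gt_eqF.
Qed.

Lemma whtop_weighted_sum (h : R) :
  ln (weighted_sum w N X) / N%:R @[N --> \oo] --> h ->
  whtop w p X (@seq_shift _) d (p @` X) (@seq_shift _) d' = h%:E.
Proof.
move=> hh; have [r r0 hr] := compatible_lebesgue cX hd.
have [r' r'0 hr'] := compatible_lebesgue cY hd'.
have m0 : 0 < Num.min r r' by rewrite lt_min r0.
apply: (lim_right_eq m0) => e e0; rewrite lt_min => /andP[er er'].
apply: cvg_lim => //.
have e20 : 0 < e / 2 by rewrite divr_gt0.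
have [L hL] := compatible_uniform_cylinder cX hd e20.
have [L' hL'] := compatible_uniform_cylinder cY hd' e20.
have agreeW C m n (x y : nat -> C) : (m <= n)%N -> agree n x y -> agree m x y.
  by move=> mn xy i im; apply: xy; exact: leq_trans mn.
have hM x y : X x -> X y -> agree (maxn L L') x y -> d x y < e / 2.
  by move=> Xx Xy /agreeW xy; apply: hL => //; apply: xy; exact: leq_maxl.
have hM' x y : (p @` X) x -> (p @` X) y -> agree (maxn L L') x y -> d' x y < e / 2.
  by move=> Xx Xy /agreeW xy; apply: hL' => //; apply: xy; exact: leq_maxr.
apply: (@squeeze_shift _ (fun N => ln (weighted_sum w N X)) _ _ (maxn L L')) hh => N N0.
have [[n [V [Vo YV Vd Ve]]] up] := wcovnum_le_weighted_sum e0 N0 hM hM'.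
have lo : weighted_sum w N X <= wcovnum w p X (dN N) (p @` X) (dN' N) e.
  rewrite Ve; apply: weighted_sum_le_cover hM Vo YV Vd => //.
    by move=> x y Xx Xy xy; apply: hr => //; exact: lt_trans er.
  by move=> x y Xx Xy xy; apply: hr' => //; exact: lt_trans er'.
have w1N := weighted_sum_ge1 X0 w0.
have pos : 0 < wcovnum w p X (dN N) (p @` X) (dN' N) e.
  by apply: lt_le_trans lo; exact: lt_le_trans (w1N N).
by rewrite !ler_ln ?posrE ?lo ?up//; exact: lt_le_trans (w1N _).
Qed.

End WeightedEntropy.

(** * Digit expansions and the carpet metric *)

Section DigitExpansion.
Context {R : realType} (c : nat).
Hypothesis c2 : (2 <= c)%N.
Implicit Types x : nat -> nat.

Definition digit_sum M x : R := \sum_(m < M) (x m)%:R / c%:R ^+ m.+1.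

Definition digit_val x : R := limn (fun M => digit_sum M x).

(** The numerator of the partial sum over the denominator c^M. Integers turn closeness of values
    into finitely many alternatives. *)
Fixpoint digit_int M x : nat :=
  if M is M'.+1 then (c * digit_int M' x + x M')%N else 0%N.

Let c0 : 0 < c%:R :> R. Proof. by rewrite ltr0n (leq_trans _ c2). Qed.

Lemma digit_sumS M x : digit_sum M.+1 x = digit_sum M x + (x M)%:R / c%:R ^+ M.+1.
Proof. by rewrite /digit_sum big_ord_recr. Qed.

Lemma digit_sum_int M x : digit_sum M x = (digit_int M x)%:R / c%:R ^+ M.
Proof.
elim: M => [|M IH]; first by rewrite /digit_sum big_ord0 mul0r.
rewrite digit_sumS IH /= natrD natrM exprS; field.
by rewrite ?expf_neq0 ?gt_eqF.
Qed.

Lemma digit_int_inj M x y : (forall m, (x m < c)%N) -> (forall m, (y m < c)%N) ->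
  digit_int M x = digit_int M y -> forall m, (m < M)%N -> x m = y m.
Proof.
move=> xc yc; elim: M => //= M IH e m.
have cp : (0 < c)%N by rewrite (leq_trans _ c2).
have eM : x M = y M.
  by have := congr1 (modn^~ c) e; rewrite ![(c * _)%N]mulnC !modnMDl !modn_small.
have : digit_int M x = digit_int M y.
  by move/eqP: e; rewrite eM eqn_add2r eqn_pmul2l// => /eqP.
by move=> /IH h; rewrite ltnS leq_eqVlt => /orP[/eqP->|/h].
Qed.

Lemma digit_sum_nd x : nondecreasing_seq (fun M => digit_sum M x).
Proof.
apply/nondecreasing_seqP => M; rewrite digit_sumS lerDl.
by rewrite divr_ge0 ?exprn_ge0 ?ler0n.
Qed.

(** A digit is at most c - 1, so the term of index m contributes at most c^-m - c^-(m+1), and these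
    bounds telescope. *)
Lemma digit_sum_tail x M k : (forall m, (x m < c)%N) ->
  digit_sum (M + k) x <= digit_sum M x + c%:R ^- M - c%:R ^- (M + k).
Proof.
move=> xc; elim: k => [|k IH]; first by rewrite addn0 addrK.
rewrite addnS digit_sumS.
have h : (x (M + k)%N)%:R / c%:R ^+ (M + k).+1 <= c%:R ^- (M + k) - c%:R ^- (M + k).+1 :> R.
  have -> : c%:R ^- (M + k) - c%:R ^- (M + k).+1 = (c%:R - 1) / c%:R ^+ (M + k).+1 :> R.
    by rewrite exprS; field; rewrite ?expf_neq0 ?gt_eqF.
  rewrite ler_wpM2r ?invr_ge0 ?exprn_ge0 ?ler0n//.
  by rewrite lerBrDr natr1 ler_nat.
lra.
Qed.

Lemma digit_val_cvg x : (forall m, (x m < c)%N) ->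
  digit_sum M x @[M --> \oo] --> digit_val x.
Proof.
move=> xc; apply: nondecreasing_is_cvgn; first exact: digit_sum_nd.
exists 1 => _ [M _ <-]; have := @digit_sum_tail x 0 M xc.
rewrite add0n {2}/digit_sum big_ord0 expr0 invr1.
have : 0 <= c%:R ^- M :> R by rewrite invr_ge0 exprn_ge0 ?ler0n.
lra.
Qed.

Lemma digit_val_ge M x : (forall m, (x m < c)%N) -> digit_sum M x <= digit_val x.
Proof.
move=> xc; apply: limr_ge; first exact: (cvgP _ (digit_val_cvg xc)).
by near=> k; apply: digit_sum_nd; near: k; exact: nbhs_infty_ge.
Unshelve. all: by end_near. Qed.

Lemma digit_val_le M x : (forall m, (x m < c)%N) ->
  digit_val x <= digit_sum M x + c%:R ^- M.
Proof.
move=> xc; apply: limr_le; first exact: (cvgP _ (digit_val_cvg xc)).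
near=> k; have Mk : (M <= k)%N by near: k; exact: nbhs_infty_ge.
rewrite -(subnKC Mk) (le_trans (digit_sum_tail _ _ xc))// gerBl.
by rewrite invr_ge0 exprn_ge0 ?ler0n.
Unshelve. all: by end_near. Qed.

Lemma digit_val01 x : (forall m, (x m < c)%N) -> 0 <= digit_val x <= 1.
Proof.
move=> xc; have := digit_val_ge 0 xc; have := digit_val_le 0 xc.
by rewrite /digit_sum big_ord0 expr0 invr1 add0r => -> ->.
Qed.

Lemma digit_val_close M x y : (forall m, (x m < c)%N) -> (forall m, (y m < c)%N) ->
  (forall m, (m < M)%N -> x m = y m) -> `|digit_val x - digit_val y| <= c%:R ^- M.
Proof.
move=> xc yc xy; have -> : c%:R ^- M = digit_sum M x + c%:R ^- M - digit_sum M y :> R.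
  have -> : digit_sum M x = digit_sum M y by apply: eq_bigr => i _; rewrite xy.
  by rewrite addrC addrA addNr add0r.
have exy : digit_sum M x = digit_sum M y by apply: eq_bigr => i _; rewrite xy.
have := digit_val_ge M xc; have := digit_val_le M xc.
have := digit_val_ge M yc; have := digit_val_le M yc.
rewrite ler_norml exy; lra.
Qed.

(** Expansions are not unique, so closeness does not give equal digits. Of the 2 units of c^-M, one
    is the distance and the other the neglected tail of [y]. *)
Lemma digit_int_close M x y : (forall m, (x m < c)%N) -> (forall m, (y m < c)%N) ->
  `|digit_val x - digit_val y| <= c%:R ^- M -> (digit_int M x <= digit_int M y + 2)%N.
Proof.
move=> xc yc; rewrite ler_norml => /andP[_ h].
have h1 := digit_val_ge M xc; have h2 := digit_val_le M yc.
have : digit_sum M x <= digit_sum M y + 2 * c%:R ^- M by lra.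
rewrite !digit_sum_int -mulrDl ler_pM2r ?invr_gt0 ?exprn_gt0//.
by rewrite -natrD ler_nat.
Qed.

End DigitExpansion.

(** * Series with weights 2^-n *)

Section HalfSeries.
Context {R : realType}.
Implicit Types g : nat -> R.

Definition half_series g : R := limn (series (fun n => g n / 2 ^+ n.+1)).

Lemma half_series_tail g K n : (forall n, 0 <= g n <= 1) ->
  series (fun n => g n / 2 ^+ n.+1) (K + n)%N <=
  series (fun n => g n / 2 ^+ n.+1) K + 2 ^- K - 2 ^- (K + n).
Proof.
move=> g01; elim: n => [|n IH]; first by rewrite addn0 addrK.
rewrite addnS seriesSr /=.
have h : g (K + n)%N / 2 ^+ (K + n).+1 <= 2 ^- (K + n).+1.
  by rewrite ler_pdivrMr ?exprn_gt0// mulVf ?expf_neq0//; have /andP[] := g01 (K + n)%N.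
have e : 2 ^- (K + n) = 2 ^- (K + n).+1 + 2 ^- (K + n).+1 :> R.
  by rewrite exprS; field; rewrite ?expf_neq0.
lra.
Qed.

Lemma half_series_nd g : (forall n, 0 <= g n <= 1) ->
  nondecreasing_seq (series (fun n => g n / 2 ^+ n.+1)).
Proof.
move=> g01; apply/nondecreasing_seqP => n; rewrite seriesSr lerDl.
by rewrite divr_ge0 ?exprn_ge0//; have /andP[] := g01 n.
Qed.

Lemma is_cvg_half_series g : (forall n, 0 <= g n <= 1) ->
  cvgn (series (fun n => g n / 2 ^+ n.+1)).
Proof.
move=> g01; apply: nondecreasing_is_cvgn; first exact: half_series_nd.
exists 1 => _ [n _ <-]; have := half_series_tail 0 n g01.
rewrite add0n {2}/series/= big_nil expr0 invr1.
have : 0 <= 2 ^- n :> R by rewrite invr_ge0 exprn_ge0.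
lra.
Qed.

Lemma half_series_ge K g : (forall n, 0 <= g n <= 1) ->
  series (fun n => g n / 2 ^+ n.+1) K <= half_series g.
Proof.
move=> g01; apply: limr_ge; first exact: is_cvg_half_series.
by near=> k; apply: half_series_nd => //; near: k; exact: nbhs_infty_ge.
Unshelve. all: by end_near. Qed.

Lemma half_series_le K g : (forall n, 0 <= g n <= 1) ->
  half_series g <= series (fun n => g n / 2 ^+ n.+1) K + 2 ^- K.
Proof.
move=> g01; apply: limr_le; first exact: is_cvg_half_series.
near=> k; have Kk : (K <= k)%N by near: k; exact: nbhs_infty_ge.
rewrite -(subnKC Kk) (le_trans (half_series_tail _ _ g01))// gerBl.
by rewrite invr_ge0 exprn_ge0.
Unshelve. all: by end_near. Qed.

Lemma half_series_ge0 g : (forall n, 0 <= g n <= 1) -> 0 <= half_series g.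
Proof. by move=> /(half_series_ge 0); rewrite {1}/series/= big_nil. Qed.

Lemma half_series_le1 g : (forall n, 0 <= g n <= 1) -> half_series g <= 1.
Proof. by move=> /(half_series_le 0); rewrite {1}/series/= big_nil add0r expr0 invr1. Qed.

Lemma half_series_ge_head g : (forall n, 0 <= g n <= 1) -> g 0%N / 2 <= half_series g.
Proof.
by move=> /(half_series_ge 1); rewrite {1}/series/= big_nat1 expr1.
Qed.

(** The first [K] weights have total 1 - 2^-K, and the remaining terms, each with [g n <= 1], add at
    most 2^-K. *)
Lemma half_series_le_cut K (r : R) g : (forall n, 0 <= g n <= 1) -> 0 <= r ->
  (forall n, (n < K)%N -> g n <= r) -> half_series g <= r + 2 ^- K.
Proof.
move=> g01 r0 gr; apply: le_trans (half_series_le K g01) _.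
rewrite lerD2r.
suff : series (fun n => g n / 2 ^+ n.+1) K <= r * (1 - 2 ^- K).
  by move=> h; apply: (le_trans h); exact: ler_piMr.
elim: K gr => [|K IH] gr; first by rewrite /series/= big_nil expr0 invr1 subrr mulr0.
rewrite seriesSr /=; have hK := IH (fun n nK => gr n (ltnW nK)).
have h : g K / 2 ^+ K.+1 <= r / 2 ^+ K.+1.
  by rewrite ler_wpM2r ?invr_ge0 ?exprn_ge0// gr.
have e : 2 ^- K = 2 ^- K.+1 + 2 ^- K.+1 :> R.
  by rewrite exprS; field; rewrite ?expf_neq0.
rewrite e in hK; apply: le_trans (lerD hK h) _.
by rewrite le_eqVlt; apply/orP; left; apply/eqP; ring.
Qed.

Lemma half_seriesD g h k : (forall n, 0 <= g n <= 1) -> (forall n, 0 <= h n <= 1) ->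
  (forall n, 0 <= k n <= 1) -> (forall n, g n <= h n + k n) ->
  half_series g <= half_series h + half_series k.
Proof.
move=> g01 h01 k01 ghk; rewrite -limD; [|exact: is_cvg_half_series..].
apply: ler_lim; [exact: is_cvg_half_series|apply: is_cvgD; exact: is_cvg_half_series|].
apply: nearW => n; rewrite fctE /series/= -big_split/=; apply: ler_sum => i _.
by rewrite -mulrDl ler_wpM2r// invr_ge0 exprn_ge0.
Qed.

End HalfSeries.

Lemma uniform_cvgP (R : realType) (f : nat -> nat -> R) (g : nat -> R) :
  {uniform, f @ \oo --> g} <->
  forall e, 0 < e -> \forall M \near \oo, forall n, `|g n - f M n| < e.
Proof.
split=> [fg e e0|h P /uniform_nbhs[E [entE EP]]].
  have hn : nbhs (g : {uniform nat -> R}) [set h | forall n, setT n -> ball (g n) e (h n)].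
    apply/uniform_nbhs; exists [set xy | ball xy.1 e xy.2]; split=> //.
    by rewrite -entourage_ballE; exists e.
  have h : \forall M \near \oo, forall n, setT n -> ball (g n) e (f M n) := fg _ hn.
  by apply: filterS h => M hM n; exact: (hM n I).
move: entE; rewrite -entourage_ballE => -[e /= e0 eE].
apply: filterS (h e e0) => M hM; apply: EP => n _; apply: eE.
exact: hM.
Qed.

Lemma bounded_pmetric_sub (R : realType) (T : Type) (X Y : set T) (d : T -> T -> R) : X `<=` Y ->
  bounded_pmetric Y d -> bounded_pmetric X d.
Proof.
move=> XY [d0 dxx dC dD [B hB]]; split.
- by move=> x y /XY ? /XY ?; exact: d0.
- by move=> x /XY ?; exact: dxx.
- by move=> x y /XY ? /XY ?; exact: dC.
- by move=> x y z /XY ? /XY ? /XY ?; exact: dD.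
- by exists B => x y /XY ? /XY ?; exact: hB.
Qed.

(** * The carpet metric on the Hilbert cube *)

Section Cube.
Context {R : realType}.
Implicit Types p q : (nat -> R) * (nat -> R).

(** The differences of coordinates are at most 1 on this set, so the series defining the metric
    converges and the metric estimates can be proved once, before restriction to a carpet. *)
Definition cube : set ((nat -> R) * (nat -> R)) :=
  [set p | forall n, 0 <= p.1 n <= 1 /\ 0 <= p.2 n <= 1].

Definition coord_dist p q n : R := Num.max `|p.1 n - q.1 n| `|p.2 n - q.2 n|.

Lemma carpet_distE p q : carpet_dist p q = half_series (coord_dist p q).
Proof. by []. Qed.

Lemma coord_dist01 p q n : cube p -> cube q -> 0 <= coord_dist p q n <= 1.
Proof.
move=> /(_ n)[/andP[? ?] /andP[? ?]] /(_ n)[/andP[? ?] /andP[? ?]].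
rewrite le_max normr_ge0/= ge_max !ler_norml; lra.
Qed.

Lemma coord_dist_leP p q n (r : R) :
  reflect (`|p.1 n - q.1 n| <= r /\ `|p.2 n - q.2 n| <= r) (coord_dist p q n <= r).
Proof. by rewrite ge_max; apply: (iffP andP). Qed.

Lemma bounded_pmetric_cube : bounded_pmetric cube (@carpet_dist R).
Proof.
have d01 p q : cube p -> cube q -> forall n, 0 <= coord_dist p q n <= 1.
  by move=> hp hq n; exact: coord_dist01.
split.
- by move=> p q hp hq; rewrite carpet_distE half_series_ge0//; exact: d01.
- move=> p hp; rewrite carpet_distE; apply/le_anti; rewrite half_series_ge0 ?andbT; last exact: d01.
  have h0 n : coord_dist p p n = 0 by rewrite /coord_dist !subrr normr0 maxxx.
  rewrite /half_series.
  have -> : series (fun n => coord_dist p p n / 2 ^+ n.+1) = cst 0.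
    by apply/funext => K; rewrite /series/= big1// => n _; rewrite h0 mul0r.
  by rewrite lim_cst.
- move=> p q hp hq; rewrite !carpet_distE; congr half_series; apply/funext => n.
  by rewrite /coord_dist distrC [X in Num.max _ X]distrC.
- move=> p q r hp hq hr; rewrite !carpet_distE; apply: half_seriesD; [exact: d01..|].
  move=> n; apply/coord_dist_leP.
  have /coord_dist_leP[h1 h2] := lexx (coord_dist p q n).
  have /coord_dist_leP[h3 h4] := lexx (coord_dist q r n).
  split; [rewrite (le_trans (ler_distD (q.1 n) _ _))// lerD//|
          rewrite (le_trans (ler_distD (q.2 n) _ _))// lerD//].
- by exists 1 => p q hp hq; rewrite carpet_distE half_series_le1//; exact: d01.
Qed.

Lemma iter_carpet_shift n p :
  iter n (@carpet_shift R) p = (fun k => p.1 (n + k)%N, fun k => p.2 (n + k)%N).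
Proof.
elim: n => [|n IH] /=; first by case: p.
by rewrite IH /carpet_shift /seq_shift/=; congr pair; apply/funext => k; rewrite addnS.
Qed.

Lemma dynd_carpet_le N K (s : R) p q : cube p -> cube q -> 0 <= s ->
  (forall n, (n < N + K)%N -> coord_dist p q n <= s) ->
  dynd (@carpet_shift R) (@carpet_dist R) N p q <= s + 2 ^- K.
Proof.
move=> hp hq s0 h; apply/dynd_leP; split=> [|n nN].
  by rewrite addr_ge0// invr_ge0 exprn_ge0.
rewrite !iter_carpet_shift carpet_distE; apply: half_series_le_cut => // k.
  by have := coord_dist01 (n + k) hp hq.
by move=> kK; apply: (h (n + k)%N); lia.
Qed.

(** The term of index 0 at time [n] has weight 1/2, hence the factor 2. *)
Lemma dynd_carpet_ge N p q n : cube p -> cube q -> (n < N)%N ->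
  coord_dist p q n <= 2 * dynd (@carpet_shift R) (@carpet_dist R) N p q.
Proof.
move=> hp hq nN; have := dynd_ge (@carpet_shift R) (@carpet_dist R) p q nN.
rewrite !iter_carpet_shift carpet_distE => h.
rewrite mulrC -ler_pdivrMr//; apply: le_trans h.
have -> : coord_dist p q n = coord_dist (fun k => p.1 (n + k)%N, fun k => p.2 (n + k)%N)
    (fun k => q.1 (n + k)%N, fun k => q.2 (n + k)%N) 0%N.
  by rewrite /coord_dist /= addn0.
by apply: half_series_ge_head => k; have := coord_dist01 (n + k) hp hq.
Qed.

End Cube.

(** * Coding of the carpet by arrays of digits *)

Section CarpetCoding.
Context {R : realType} (a b : nat).
Hypotheses (a2 : (2 <= a)%N) (b2 : (2 <= b)%N).
Implicit Types (z : nat -> nat -> 'I_a * 'I_b) (p q : (nat -> R) * (nat -> R)).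

(** In [z m n] the digit position comes first and the time second: a point of Omega is a row, while
    a coordinate of the carpet reads a column. *)
Definition xdigits z n m : nat := (z m n).1.
Definition ydigits z n m : nat := (z m n).2.

Lemma xdigits_lt z n m : (xdigits z n m < a)%N. Proof. exact: ltn_ord. Qed.
Lemma ydigits_lt z n m : (ydigits z n m < b)%N. Proof. exact: ltn_ord. Qed.
Local Hint Resolve xdigits_lt ydigits_lt : core.

Definition carpet_point z : (nat -> R) * (nat -> R) :=
  (fun n => digit_val a (xdigits z n), fun n => digit_val b (ydigits z n)).

Lemma digit_val_uniform (c : nat) (x : nat -> nat -> nat) : (2 <= c)%N ->
  (forall n m, (x n m < c)%N) ->
  {uniform, (fun M n => digit_sum c M (x n)) @ \oo --> (fun n => digit_val c (x n) : R)}.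
Proof.
move=> c2 xc; apply/uniform_cvgP => e e0.
have c1 : 1 < c%:R :> R by rewrite ltr1n.
have : (c%:R^-1 : R) ^+ M @[M --> \oo] --> (0 : R).
  apply: cvg_expr; rewrite ger0_norm ?invr_ge0 ?ler0n//.
  by rewrite invf_lt1// (lt_trans _ c1).
move=> /cvgrPdist_lt /(_ e e0); apply: filterS => M; rewrite sub0r normrN => hM n.
apply: le_lt_trans hM; rewrite ger0_norm; last first.
  by rewrite subr_ge0; exact: digit_val_ge.
rewrite lerBlDl (le_trans (digit_val_le c2 M (xc n)))// lerD2l exprVn.
exact: ler_norm.
Qed.

(** The tail bound c^-M does not depend on the time, so every array converges uniformly; by
    uniqueness of the limit, the carpet is the image of the arrays with rows in [Om]. *)
Lemma carpetE (Om : set (fullshift ('I_a * 'I_b)%type)) :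
  @carpet R a b Om = carpet_point @` [set z | forall m, Om (z m)].
Proof.
have uniq (f : nat -> nat -> R) (g h : nat -> R) :
    {uniform, f @ \oo --> g} -> {uniform, f @ \oo --> h} -> g = h.
  move=> /uniform_cvgP fg /uniform_cvgP fh; apply/funext => n.
  apply/eqP; rewrite -subr_eq0 -normr_le0; apply/ler_addgt0Pr => e e0.
  have e20 : 0 < e / 2 by rewrite divr_gt0.
  near \oo => M.
  have h1 : `|g n - f M n| < e / 2 by near: M; apply: filterS (fg _ e20) => M; exact.
  have h2 : `|h n - f M n| < e / 2 by near: M; apply: filterS (fh _ e20) => M; exact.
  rewrite add0r (_ : g n - h n = (g n - f M n) - (h n - f M n)); last by ring.
  by rewrite (le_trans (ler_normB _ _))//; lra.
apply/seteqP; split=> [[p1 p2] [z [Omz /= z1 z2]]|_ [z Omz <-]].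
  exists z => //; congr pair.
    exact: uniq (digit_val_uniform a2 (xdigits_lt z)) z1.
  exact: uniq (digit_val_uniform b2 (ydigits_lt z)) z2.
exists z; split=> //; first exact: digit_val_uniform a2 (xdigits_lt z).
exact: digit_val_uniform b2 (ydigits_lt z).
Unshelve. all: by end_near. Qed.

Lemma carpet_point_cube z : cube (carpet_point z).
Proof. by move=> n; split; exact: digit_val01. Qed.

Lemma carpet_cube Om : @carpet R a b Om `<=` cube.
Proof. by rewrite carpetE => _ [z _ <-]; exact: carpet_point_cube. Qed.

Lemma bounded_pmetric_carpet Om : bounded_pmetric (@carpet R a b Om) (@carpet_dist R).
Proof. exact: bounded_pmetric_sub (@carpet_cube Om) bounded_pmetric_cube. Qed.

Lemma carpet_shift_point z :
  carpet_shift (carpet_point z) = carpet_point (fun m => @seq_shift ('I_a * 'I_b)%type (z m)).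
Proof. by []. Qed.

Lemma carpet_shift_stable (Om : set (fullshift ('I_a * 'I_b)%type)) :
  (forall x, Om x -> Om (@seq_shift _ x)) ->
  forall p, @carpet R a b Om p -> @carpet R a b Om (carpet_shift p).
Proof.
move=> hOm; rewrite carpetE => _ [z Omz <-]; rewrite carpet_shift_point.
by exists (fun m => @seq_shift ('I_a * 'I_b)%type (z m)) => // m; exact: hOm.
Qed.

End CarpetCoding.

(** * Approximate squares *)

Section Squares.
Context {A D : finType}.
Implicit Types (X : set (fullshift (A * D)%type)).

(** The sum type gives both kinds of positions one alphabet, so that squares are finite
    functions. *)
Definition square N L l (u : nat -> {ffun 'I_N -> A * D}) :
    {ffun 'I_l -> {ffun 'I_N -> A * D} + {ffun 'I_N -> D}} :=
  [ffun m : 'I_l => if (m < L)%N then inl (u m) else inr (snd_word (u m))].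

Definition square_digit_set N L X (m : nat) : {set {ffun 'I_N -> A * D} + {ffun 'I_N -> D}} :=
  if (m < L)%N then [set inl u | u in words N X]%SET
  else [set inr v | v in words N (@proj_snd A D @` X)]%SET.

(** A full product: the rows of a point are chosen in Omega independently of each other. Exact
    counting and product measures rest on this. *)
Definition squares N L l X :
    {set {ffun 'I_l -> {ffun 'I_N -> A * D} + {ffun 'I_N -> D}}} :=
  [set q in family (fun m : 'I_l => square_digit_set N L X m)]%SET.

Definition word_array N (z : nat -> nat -> A * D) : nat -> {ffun 'I_N -> A * D} :=
  fun m => word N (z m).

Lemma square_squares N L l X u : (forall m, u m \in words N X) ->
  square L l u \in squares N L l X.
Proof.
move=> uX; rewrite inE; apply/familyP => m; rewrite ffunE /square_digit_set.
by case: ifP => _; apply: imset_f => //; exact: snd_word_words.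
Qed.

Lemma word_array_words N X z : (forall m, X (z m)) ->
  forall m, word_array N z m \in words N X.
Proof. by move=> Xz m; exact: mem_words. Qed.

Lemma words_word_array N X (u : nat -> {ffun 'I_N -> A * D}) :
  (forall m, u m \in words N X) -> exists2 z, (forall m, X (z m)) & word_array N z = u.
Proof.
move=> uX; have /choice[z hz] m : exists x, X x /\ word N x = u m.
  by have /wordsP[x Xx xu] := uX m; exists x.
by exists z => [m|]; [case: (hz m)|apply/funext => m; case: (hz m)].
Qed.

Lemma squares_square N L l X q : X !=set0 -> q \in squares N L l X ->
  exists2 u, (forall m, u m \in words N X) & square L l u = q.
Proof.
move=> [x0 Xx0]; rewrite inE => /familyP hq.
have /choice[u hu] m : exists w, w \in words N X /\ forall ml : (m < l)%N,
    (if (m < L)%N then inl w else inr (snd_word w)) = q (Ordinal ml).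
  have [ml|lm] := pselect (m < l)%N; last by exists (word N x0); split; [exact: mem_words|].
  have := hq (Ordinal ml); rewrite /square_digit_set /=; case: ifP => mL /imsetP[w wX e].
    by exists w; split=> // ml'; rewrite -e; congr (q _); exact: val_inj.
  move: wX => /wordsP[_ [z Xz <-] e'].
  exists (word N z); split; first exact: mem_words.
  by move=> ml'; rewrite -word_proj_snd e' -e; congr (q _); exact: val_inj.
exists u; first by move=> m; case: (hu m).
apply/ffunP => -[m ml]; rewrite ffunE /=; case: (hu m) => _ /(_ ml) <-.
by [].
Qed.

Lemma card_squares N L l X : (L <= l)%N ->
  #|squares N L l X| =
  (#|words N X| ^ L * #|words N (@proj_snd A D @` X)| ^ (l - L))%N.
Proof.
move=> Ll; rewrite cardsE card_family foldrE big_map big_enum /=.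
have -> : (\prod_(m < l) #|square_digit_set N L X m| = \prod_(0 <= m < l) #|square_digit_set N L X m|)%N.
  by rewrite big_mkord.
rewrite (big_cat_nat _ Ll)//=; congr muln.
  rewrite -[in RHS](subn0 L) -prod_nat_const_nat; apply: eq_big_nat => m /andP[_ mL].
  by rewrite /square_digit_set mL card_imset//; move=> x y [].
rewrite -prod_nat_const_nat; apply: eq_big_nat => m /andP[Lm _].
by rewrite /square_digit_set ltnNge Lm /= card_imset//; move=> x y [].
Qed.

Lemma square_eqP N L l (u v : nat -> {ffun 'I_N -> A * D}) : (L <= l)%N ->
  square L l u = square L l v <->
  (forall m, (m < L)%N -> u m = v m) /\ forall m, (m < l)%N -> snd_word (u m) = snd_word (v m).
Proof.
move=> Ll; split=> [/ffunP e|[h1 h2]].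
  have h1 m : (m < L)%N -> u m = v m.
    move=> mL; have := e (Ordinal (leq_trans mL Ll)); rewrite !ffunE /= mL.
    by move=> [].
  split=> // m ml; have [/h1->//|Lm] := ltnP m L.
  by have := e (Ordinal ml); rewrite !ffunE /= ltnNge Lm /= => -[].
by apply/ffunP => m; rewrite !ffunE; case: ifP => [/h1->//|_]; rewrite h2.
Qed.

End Squares.

Section CarpetSquares.
Context {R : realType} (a b : nat).
Hypotheses (a2 : (2 <= a)%N) (b2 : (2 <= b)%N).
Implicit Types (z : nat -> nat -> 'I_a * 'I_b).

Lemma square_digitsP N L l z z' : (L <= l)%N ->
  square L l (word_array N z) = square L l (word_array N z') <->
  forall n, (n < N)%N ->
    (forall m, (m < L)%N -> xdigits z n m = xdigits z' n m) /\
    (forall m, (m < l)%N -> ydigits z n m = ydigits z' n m).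
Proof.
move=> Ll; apply: iff_trans (square_eqP _ _ Ll) _; split=> [[h1 h2] n nN|h].
  split=> m.
    by move=> /h1/ffunP/(_ (Ordinal nN)); rewrite !ffunE /xdigits /= => ->.
  by move=> /h2/ffunP/(_ (Ordinal nN)); rewrite !ffunE /ydigits /= => ->.
have hy m : (m < l)%N -> snd_word (word_array N z m) = snd_word (word_array N z' m).
  move=> ml; apply/ffunP => n; rewrite !ffunE; apply: val_inj.
  by have [_ ] := h n (ltn_ord n); exact.
split=> // m mL; apply/ffunP => n; rewrite !ffunE.
have [h1 h2] := h n (ltn_ord n).
have := h1 m mL; have := h2 m (leq_trans mL Ll); rewrite /xdigits /ydigits.
by case: (z m n) (z' m n) => [x y] [x' y'] /= /val_inj -> /val_inj ->.
Qed.

Lemma square_dynd_le N K L l (s : R) z z' : (L <= l)%N ->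
  a%:R ^- L <= s -> b%:R ^- l <= s ->
  square L l (word_array (N + K) z) = square L l (word_array (N + K) z') ->
  dynd (@carpet_shift R) (@carpet_dist R) N (carpet_point z) (carpet_point z') <= s + 2 ^- K.
Proof.
move=> Ll aL bl /(square_digitsP _ _ _ Ll) h.
apply: (dynd_carpet_le (carpet_point_cube a2 b2 z) (carpet_point_cube a2 b2 z')) => [|n nN].
  by apply: le_trans aL; rewrite invr_ge0 exprn_ge0.
have [h1 h2] := h n nN; apply/coord_dist_leP; split.
  apply: le_trans aL; apply: (@digit_val_close R a a2 L (xdigits z n) (xdigits z' n)) => // m; exact: ltn_ord.
apply: le_trans bl; apply: (@digit_val_close R b b2 l (ydigits z n) (ydigits z' n)) => // m; exact: ltn_ord.
Qed.

(* Points at distance at most c^-L have integer parts at scale c^-L that differ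
   by at most 2, so that in each of the 2N coordinates the set E meets at most
   5 of them. *)
Lemma card_squares_hit N L l (dl : R)
    (E : set ((nat -> R) * (nat -> R)))
    (Q : {set {ffun 'I_l -> {ffun 'I_N -> 'I_a * 'I_b} + {ffun 'I_N -> 'I_b}}}) :
  (L <= l)%N -> 2 * dl <= a%:R ^- L -> 2 * dl <= b%:R ^- l ->
  (forall p q, E p -> E q -> dynd (@carpet_shift R) (@carpet_dist R) N p q <= dl) ->
  (forall q, q \in Q -> exists z, E (carpet_point z) /\ square L l (word_array N z) = q) ->
  (#|Q| <= 25 ^ N)%N.
Proof.
move=> Ll haL hbl hE hQ.
have [->|[q0 /hQ[z0 [Ez0 _]]]] := set_0Vmem Q; first by rewrite cards0.
pose Z q := xget z0 [set z | E (carpet_point z) /\ square L l (word_array N z) = q].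
have hZ q : q \in Q -> E (carpet_point (Z q)) /\ square L l (word_array N (Z q)) = q.
  move=> /hQ[z hz]; exact: (@xgetPex _ z0 [set z | _] (ex_intro _ z hz)).
(* The offset 2 keeps the truncated subtraction exact: integer parts differ by at most 2 either way,
   so the codes run from 0 to 4. *)
pose code q : {ffun 'I_N -> 'I_5 * 'I_5} := [ffun n : 'I_N =>
  (inord (digit_int a L (xdigits (Z q) n) + 2 - digit_int a L (xdigits z0 n)),
   inord (digit_int b l (ydigits (Z q) n) + 2 - digit_int b l (ydigits z0 n)))].
have close z z' n : (n < N)%N -> E (carpet_point z) -> E (carpet_point z') ->
    (digit_int a L (xdigits z n) <= digit_int a L (xdigits z' n) + 2)%N /\
    (digit_int b l (ydigits z n) <= digit_int b l (ydigits z' n) + 2)%N.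
  move=> nN Ez Ez'.
  have h' := @dynd_carpet_ge R _ _ _ _ (carpet_point_cube a2 b2 z) (carpet_point_cube a2 b2 z') nN.
  have h := hE _ _ Ez Ez'; have : coord_dist (carpet_point z) (carpet_point z') n <= 2 * dl.
    by rewrite (le_trans h')// ler_wpM2l.
  move=> /coord_dist_leP[h1 h2]; split.
    apply: (@digit_int_close R) => //; try (move=> m; exact: ltn_ord).
    exact: le_trans haL.
  apply: (@digit_int_close R) => //; try (move=> m; exact: ltn_ord).
  exact: le_trans hbl.
have inj : {in Q &, injective code}.
  move=> q q' /hZ[Eq qE] /hZ[Eq' qE'] /ffunP e; rewrite -qE -qE'.
  apply/square_digitsP => // n nN; have := e (Ordinal nN); rewrite !ffunE /=.
  have [c1 c2] := close _ _ _ nN Eq Ez0; have [c3 c4] := close _ _ _ nN Ez0 Eq.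
  have [c1' c2'] := close _ _ _ nN Eq' Ez0; have [c3' c4'] := close _ _ _ nN Ez0 Eq'.
  move=> [/(congr1 val) + /(congr1 val)]; rewrite /= !inordK; [|lia..].
  move=> e1 e2; split.
    apply: (digit_int_inj a2); [move=> m; exact: ltn_ord..|lia].
  apply: (digit_int_inj b2); [move=> m; exact: ltn_ord..|lia].
rewrite -(card_in_imset inj) (leq_trans (max_card _))//.
by rewrite card_ffun card_prod !card_ord.
Qed.

End CarpetSquares.

(** * Metric mean dimension *)

Section MetricMeanDimension.
Context {R : realType} (a b : nat) (Om : set (fullshift ('I_a * 'I_b)%type)).
Hypotheses (ab : (b <= a)%N) (b2 : (2 <= b)%N).
Hypothesis Om0 : Om !=set0.
Hypothesis hOm : forall x, Om x -> Om (@seq_shift _ x).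

Let a2 : (2 <= a)%N. Proof. exact: leq_trans ab. Qed.
Let X := @carpet R a b Om.
Let dN N := dynd (@carpet_shift R) (@carpet_dist R) N.
Let c N := #|words N Om|.
Let c' N := #|words N (@proj_snd 'I_a 'I_b @` Om)|.
Let Om'0 : (@proj_snd 'I_a 'I_b @` Om) !=set0.
Proof. by have [z Omz] := Om0; exists (@proj_snd 'I_a 'I_b z), z. Qed.

Let hX : forall p, X p -> X (carpet_shift p).
Proof. exact: carpet_shift_stable a2 b2 Om hOm. Qed.

Lemma carpet_pointP z : (forall m, Om (z m)) -> X (carpet_point z).
Proof. by move=> Omz; rewrite /X carpetE//; exists z. Qed.

Lemma carpet_nonempty : X !=set0.
Proof. by have [z Omz] := Om0; exists (carpet_point (fun=> z)); exact: carpet_pointP. Qed.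

(** One quarter of [e] goes to the neglected digits and one to the tail 2^-K; the other half leaves
    room to make the pieces open. *)
Lemma covnum_carpet_le N K L l (e : R) : 0 < e -> (L <= l)%N ->
  a%:R ^- L <= e / 4 -> b%:R ^- l <= e / 4 -> 2 ^- K <= e / 4 ->
  (covnum X (dN N) X e <= c (N + K) ^ L * c' (N + K) ^ (l - L))%N /\
  exists V : 'I_(covnum X (dN N) X e) -> set ((nat -> R) * (nat -> R)), [/\
    forall k, open_in X (dN N) (V k), X `<=` \bigcup_k V k &
    forall k, diam (dN N) (V k) < e].
Proof.
move=> e0 Ll aL bl K2; rewrite -card_squares//.
apply: (@covnum_cover _ _ X (dN N) X e (e / 2) _ _ (fun q =>
  [set p | exists z, [/\ forall m, Om (z m), carpet_point z = p &
    square L l (word_array (N + K) z) = q]])).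
- exact: bounded_pmetric_dynd hX (bounded_pmetric_carpet a2 b2 Om).
- by rewrite divr_ge0// ltW.
- by rewrite ltr_pdivrMr// mulr2n mulrDr mulr1 ltrDl.
- by move=> q _ [z [Omz <- _]]; exact: carpet_pointP.
- move=> p; rewrite /X carpetE// => -[z Omz <-].
  exists (square L l (word_array (N + K) z)); last by exists z.
  by apply: square_squares; exact: word_array_words.
- move=> q _ _ [z [_ <- <-]] [z' [_ <- zz']].
  have -> : e / 2 = e / 4 + e / 4 by field.
  apply: le_trans (_ : e / 4 + 2 ^- K <= _); last by rewrite lerD2l.
  exact: square_dynd_le Ll aL bl (esym zz').
Qed.

Lemma covnum_carpet_ge N L l (e : R) n (V : 'I_n -> set ((nat -> R) * (nat -> R))) :
  0 < e -> (L <= l)%N -> 2 * e <= a%:R ^- L -> 2 * e <= b%:R ^- l ->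
  (forall k, V k `<=` X) -> X `<=` \bigcup_k V k -> (forall k, diam (dN N) (V k) < e) ->
  (c N ^ L * c' N ^ (l - L) <= n * 25 ^ N)%N.
Proof.
move=> e0 Ll aL bl VX XV Vd; rewrite -card_squares//.
have hd := bounded_pmetric_dynd N hX (bounded_pmetric_carpet a2 b2 Om).
pose hit k : {set {ffun 'I_l -> {ffun 'I_N -> 'I_a * 'I_b} + {ffun 'I_N -> 'I_b}}} :=
  [set q | `[< exists z, V k (carpet_point z) /\ square L l (word_array N z) = q >]]%SET.
have hitP k : (#|hit k| <= 25 ^ N)%N.
  apply: (@card_squares_hit R a b a2 b2 N L l e (V k)) => //.
    move=> p q Vp Vq; apply: ltW; apply: le_lt_trans (Vd k).
    exact: (diam_ge_sub hd).
  by move=> q; rewrite inE => /asboolP.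
have sub : squares N L l Om \subset (\bigcup_k hit k)%SET.
  apply/fintype.subsetP => q /(squares_square Om0)[u /words_word_array[z Omz <-] <-].
  have [k _ Vk] := XV _ (carpet_pointP Omz).
  by apply/finset.bigcupP; exists k => //; rewrite inE; apply/asboolP; exists z.
apply: leq_trans (subset_leq_card sub) _.
rewrite -[n in (n * _)%N]card_ord -sum_nat_const.
apply: (@leq_trans (\sum_k #|hit k|)); last by apply: leq_sum => k _.
elim/big_rec2: _ => [|k m B _ Bm]; first by rewrite cards0.
by rewrite cardsU (leq_trans (leq_subr _ _))// leq_add2l.
Qed.

Variables (h1 h0 : R).
Hypothesis hh1 : ln (c N)%:R / N%:R @[N --> \oo] --> h1.
Hypothesis hh0 : ln (c' N)%:R / N%:R @[N --> \oo] --> h0.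

Let c_gt0 N : (0 < c N)%N. Proof. exact: card_words_gt0. Qed.
Let c'_gt0 N : (0 < c' N)%N. Proof. exact: card_words_gt0. Qed.

Let ln_prod N L m : ln (c N ^ L * c' N ^ m)%:R = L%:R * ln (c N)%:R + m%:R * ln (c' N)%:R :> R.
Proof.
rewrite natrM !natrX lnM ?posrE ?exprn_gt0 ?ltr0n// !lnXn ?ltr0n//.
by rewrite !mulr_natl.
Qed.

Let cvg_prod (L m : nat) :
  (L%:R * ln (c N)%:R + m%:R * ln (c' N)%:R) / N%:R @[N --> \oo] --> L%:R * h1 + m%:R * h0.
Proof.
have h : L%:R * (ln (c N)%:R / N%:R) + m%:R * (ln (c' N)%:R / N%:R) @[N --> \oo] -->
    L%:R * h1 + m%:R * h0.
  by apply: cvgD; apply: cvgM => //; exact: cvg_cst.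
apply: cvg_trans h; apply: near_eq_cvg; apply: nearW => N /=.
by rewrite mulrDl -!mulrA.
Qed.

(** Two grids are compared with [e]: one of mesh at least [2 * e], of which a set of diameter below
    [e] meets at most 25^N squares, and one of mesh at most [e / 4], whose squares have small
    diameter. The loss [ln 25] does not depend on [e]. *)
Lemma mdimM_at_bounds (e : R) L l L' l' : 0 < e -> e < 1 ->
  (L <= l)%N -> 2 * e <= a%:R ^- L -> 2 * e <= b%:R ^- l ->
  (L' <= l')%N -> a%:R ^- L' <= e / 4 -> b%:R ^- l' <= e / 4 ->
  L%:R * h1 + (l - L)%:R * h0 - ln 25 <=
    mdimM_at X (@carpet_shift R) (@carpet_dist R) e * ln e^-1 <=
  L'%:R * h1 + (l' - L')%:R * h0.
Proof.
move=> e0 e1 Ll aL bl Ll' aL' bl'.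
have lne : 0 < ln e^-1 by rewrite ln_gt0// invf_gt1.
have [K K2] : exists K, 2 ^- K <= e / 4 :> R.
  have : ((2 : R)^-1) ^+ K @[K --> \oo] --> (0 : R).
    by apply: cvg_expr; rewrite ger0_norm ?invr_ge0// invf_lt1// ltr1n.
  have e40 : 0 < e / 4 by rewrite divr_gt0.
  move=> /cvgrPdist_lt /(_ _ e40)[K _ /(_ K (leqnn K))].
  rewrite sub0r normrN exprVn => h; exists K; apply/ltW.
  by apply: le_lt_trans h; exact: ler_norm.
pose v N : R := ln (covnum X (dN N) X e)%:R.
have up N := covnum_carpet_le N e0 Ll' aL' bl' K2.
have pos N : (0 < covnum X (dN N) X e)%N.
  have [_ [V [_ XV _]]] := up N; apply: (covnum_gt0 XV); exact: carpet_nonempty.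
have lo N : (c N ^ L * c' N ^ (l - L) <= covnum X (dN N) X e * 25 ^ N)%N.
  have [_ [V [Vo XV Vd]]] := up N.
  by apply: (covnum_carpet_ge e0 Ll aL bl _ XV Vd) => k; case: (Vo k).
have [g g0 vg] : exists2 g : R, 0 <= g & v N / N%:R @[N --> \oo] --> g.
  apply: fekete => [N|M N]; first exact: ln_nat_ge0.
  rewrite -lnM ?posrE ?ltr0n// -natrM; apply: ler_ln_nat => //.
  apply: covnum_dyndD => //; first exact: bounded_pmetric_carpet a2 b2 Om.
  by move=> N'; case: (up N').
have -> : mdimM_at X (@carpet_shift R) (@carpet_dist R) e * ln e^-1 = g.
  suff -> : mdimM_at X (@carpet_shift R) (@carpet_dist R) e = g / ln e^-1.
    by rewrite divfK// gt_eqF.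
  apply: cvg_lim => //.
  have h : v N / N%:R / ln e^-1 @[N --> \oo] --> g / ln e^-1.
    by apply: cvgM => //; exact: cvg_cst.
  apply: cvg_trans h.
  by apply: near_eq_cvg; apply: nearW => N /=; rewrite /dimM mulrAC.
apply/andP; split.
  have hlo : (L%:R * ln (c N)%:R + (l - L)%:R * ln (c' N)%:R) / N%:R - ln 25 @[N --> \oo] -->
      L%:R * h1 + (l - L)%:R * h0 - ln 25.
    by apply: cvgB; [exact: cvg_prod|exact: cvg_cst].
  rewrite -(cvg_lim _ vg)// -(cvg_lim _ hlo)//.
  apply: ler_lim; [exact: cvgP hlo|exact: cvgP vg|].
  near=> N; have N0 : (0 < N)%N by near: N; exists 1%N.
  rewrite lerBlDr ler_pdivrMr ?ltr0n// mulrDl divfK ?pnatr_eq0 -?lt0n//.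
  rewrite -ln_prod (_ : ln 25 * N%:R = ln (25 ^ N)%:R); last first.
    by rewrite natrX lnXn ?ltr0n// mulr_natr.
  rewrite /v -lnM ?posrE ?ltr0n ?expn_gt0// -natrM; apply: ler_ln_nat => //.
  by rewrite muln_gt0 !expn_gt0 c_gt0 c'_gt0.
have hup := @cvg_shift_div _ _ _ K (@cvg_prod L' (l' - L')).
rewrite -(cvg_lim _ vg)// -(cvg_lim _ hup)//.
apply: ler_lim; [exact: cvgP vg|exact: cvgP hup|].
apply: nearW => N; rewrite ler_wpM2r// -ln_prod; apply: ler_ln_nat => //.
by case: (up N).
Unshelve. all: by end_near. Qed.

End MetricMeanDimension.

Section Scales.
Context {R : realType} (c : nat).
Hypothesis c2 : (2 <= c)%N.

Lemma ln_base_gt0 : 0 < ln c%:R :> R.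
Proof. by rewrite ln_gt0// ltr1n. Qed.

Let lnX n : ln (c%:R ^- n) = - (n%:R * ln c%:R) :> R.
Proof.
have c0 : 0 < c%:R :> R by rewrite ltr0n (leq_trans _ c2).
by rewrite lnV ?posrE ?exprn_gt0// lnXn// mulr_natl.
Qed.

Let cX n : 0 < c%:R ^- n :> R.
Proof. by rewrite invr_gt0 exprn_gt0// ltr0n (leq_trans _ c2). Qed.

Lemma le_exp_base (s : R) n : 0 < s -> n%:R * ln c%:R <= ln s^-1 -> s <= c%:R ^- n.
Proof. by move=> s0 h; rewrite -ler_ln ?posrE// lnX lerNr -lnV. Qed.

Lemma ge_exp_base (s : R) n : 0 < s -> ln s^-1 <= n%:R * ln c%:R -> c%:R ^- n <= s.
Proof. by move=> s0 h; rewrite -ler_ln ?posrE// lnX lerNl -lnV. Qed.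

End Scales.

Section HasMetricMeanDimension.
Context {R : realType} (a b : nat) (Om : set (fullshift ('I_a * 'I_b)%type)).
Hypotheses (ab : (b <= a)%N) (b2 : (2 <= b)%N).
Hypotheses (Om0 : Om !=set0).
Hypothesis hOm : forall x, Om x -> Om (@seq_shift _ x).

(** In both grids the levels equal ln(1/e) / ln a and ln(1/e) / ln b up to bounded errors. The two
    bounds therefore stay within a constant of ln(1/e) times the claimed value. *)
Lemma carpet_has_mdimM (h1 h0 : R) :
  ln #|words N Om|%:R / N%:R @[N --> \oo] --> h1 ->
  ln #|words N (@proj_snd 'I_a 'I_b @` Om)|%:R / N%:R @[N --> \oo] --> h0 ->
  has_mdimM (@carpet R a b Om) (@carpet_shift R) (@carpet_dist R)
    (h1 / ln a%:R + ((ln b%:R)^-1 - (ln a%:R)^-1) * h0)%:E.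
Proof.
move=> hh1 hh0; have a2 : (2 <= a)%N by exact: leq_trans ab.
have lnb := @ln_base_gt0 R _ b2; have lna := @ln_base_gt0 R _ a2.
have lnab : ln b%:R <= ln a%:R :> R by apply: ler_ln_nat => //; exact: leq_trans b2.
have h00 : 0 <= h0.
  rewrite -(cvg_lim _ hh0)//; apply: limr_ge; first exact: cvgP hh0.
  by apply: nearW => N; rewrite divr_ge0// ln_nat_ge0.
have h10 : h0 <= h1.
  rewrite -(cvg_lim _ hh0)// -(cvg_lim _ hh1)//.
  apply: ler_lim; [exact: cvgP hh0|exact: cvgP hh1|apply: nearW => N].
  rewrite ler_wpM2r//; apply: ler_ln_nat.
    by apply: card_words_gt0; have [z Omz] := Om0; exists (@proj_snd 'I_a 'I_b z), z.
  rewrite (leq_trans _ (leq_imset_card (@snd_word _ _ N) _))//.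
  apply/subset_leq_card/fintype.subsetP => _ /wordsP[_ [z Omz <-] <-].
  by rewrite word_proj_snd imset_f// mem_words.
set T := _ + _ * h0; pose al := (ln (a%:R : R))^-1; pose be := (ln (b%:R : R))^-1.
have al0 : 0 < al by rewrite invr_gt0.
have be0 : 0 < be by rewrite invr_gt0.
have albe : al <= be by rewrite lef_pV2.
(* Grouping by levels, L h1 + (l - L) h0 = L (h1 - h0) + l h0. Both coefficients are nonnegative, so
   bounds on L and l carry over. *)
have TE : T = al * (h1 - h0) + be * h0 by rewrite /T -/al -/be; ring.
(* [ln 2] and [ln 4] come from the scales [2 * e] and [e / 4], the terms [h1 - h0] and [h0] from
   rounding the levels, [ln 25] from the squares met by one set. *)
pose C := (ln 2 + ln 4) * (al * (h1 - h0) + be * h0) + (h1 - h0) + h0 + ln 25.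
have key (e : R) : 0 < e -> 2 * e < 1 ->
    `|mdimM_at (@carpet R a b Om) (@carpet_shift R) (@carpet_dist R) e * ln e^-1 - ln e^-1 * T| <= C.
  move=> e0 e12; have e1 : e < 1 by lra.
  have ln2 : 0 <= ln 2 :> R by rewrite ln_ge0 ?ler1n.
  have ln4 : 0 <= ln 4 :> R by rewrite ln_ge0 ?ler1n.
  have ln25 : 0 <= ln 25 :> R by rewrite ln_ge0 ?ler1n.
  have lam0 : 0 < ln e^-1 by rewrite ln_gt0// invf_gt1.
  have T1E : ln (2 * e)^-1 = ln e^-1 - ln 2.
    by rewrite !lnV ?posrE ?mulr_gt0// lnM ?posrE// opprD addrC.
  have T10 : 0 <= ln (2 * e)^-1 by rewrite ln_ge0// ltW// invf_gt1// mulr_gt0.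
  have T2E : ln (e / 4)^-1 = ln e^-1 + ln 4 by rewrite invfM invrK lnM ?posrE ?invr_gt0.
  have T20 : 0 <= ln (e / 4)^-1 by rewrite T2E; lra.
  pose L := Num.truncn (ln (2 * e)^-1 * al); pose l := Num.truncn (ln (2 * e)^-1 * be).
  pose L' := (Num.truncn (ln (e / 4)^-1 * al)).+1; pose l' := (Num.truncn (ln (e / 4)^-1 * be)).+1.
  have Ll : (L <= l)%N by apply: le_truncn; rewrite ler_wpM2l.
  have Ll' : (L' <= l')%N by rewrite ltnS; apply: le_truncn; rewrite ler_wpM2l.
  have [L1 L2] : L%:R <= ln (2 * e)^-1 * al /\ ln (2 * e)^-1 * al <= L%:R + 1.
    have := @truncn_itv R _ (mulr_ge0 T10 (ltW al0)); rewrite -[X in _ < X]natr1 -/L => /andP[u1 u2].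
    by split=> //; exact: ltW u2.
  have [l1 l2] : l%:R <= ln (2 * e)^-1 * be /\ ln (2 * e)^-1 * be <= l%:R + 1.
    have := @truncn_itv R _ (mulr_ge0 T10 (ltW be0)); rewrite -[X in _ < X]natr1 -/l => /andP[u1 u2].
    by split=> //; exact: ltW u2.
  have [L1' L2'] : L'%:R - 1 <= ln (e / 4)^-1 * al /\ ln (e / 4)^-1 * al <= L'%:R.
    have := @truncn_itv R _ (mulr_ge0 T20 (ltW al0)); rewrite -/L' => /andP[u1 u2].
    by split; [rewrite /L' -[X in X - 1]natr1 addrK|exact: ltW u2].
  have [l1' l2'] : l'%:R - 1 <= ln (e / 4)^-1 * be /\ ln (e / 4)^-1 * be <= l'%:R.
    have := @truncn_itv R _ (mulr_ge0 T20 (ltW be0)); rewrite -/l' => /andP[u1 u2].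
    by split; [rewrite /l' -[X in X - 1]natr1 addrK|exact: ltW u2].
  have /andP[lo up] : L%:R * h1 + (l - L)%:R * h0 - ln 25 <=
      mdimM_at (@carpet R a b Om) (@carpet_shift R) (@carpet_dist R) e * ln e^-1 <=
      L'%:R * h1 + (l' - L')%:R * h0.
    apply: mdimM_at_bounds => //.
    - by apply: le_exp_base => //; [rewrite mulr_gt0|rewrite -ler_pdivlMr].
    - by apply: le_exp_base => //; [rewrite mulr_gt0|rewrite -ler_pdivlMr].
    - by apply: ge_exp_base => //; [rewrite divr_gt0|rewrite -ler_pdivrMr].
    - by apply: ge_exp_base => //; [rewrite divr_gt0|rewrite -ler_pdivrMr].
  move: lo up; rewrite !natrB// TE.
  move: (mdimM_at _ _ _ _ * _) => f lo up.
  have D0 : 0 <= h1 - h0 by rewrite subr_ge0.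
  have k1 := ler_wpM2r D0 L2; have k2 := ler_wpM2r h00 l2.
  have k3 := ler_wpM2r D0 L1'; have k4 := ler_wpM2r h00 l1'.
  have p1 : 0 <= ln 2 * (al * (h1 - h0)) by rewrite !mulr_ge0// ltW.
  have p2 : 0 <= ln 4 * (al * (h1 - h0)) by rewrite !mulr_ge0// ltW.
  have p3 : 0 <= ln 2 * (be * h0) by rewrite !mulr_ge0// ltW.
  have p4 : 0 <= ln 4 * (be * h0) by rewrite !mulr_ge0// ltW.
  rewrite T1E in k1 k2; rewrite T2E in k3 k4.
  rewrite ler_norml /C; apply/andP; split; lra.
have C0 : 0 <= C.
  apply: le_trans (key (4^-1) _ _) => //; lra.
apply: limf_esup_einf_eq => e e0.
near=> x; have x0 : 0 < x by near: x; exact: nbhs_right_gt.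
have x12 : x < 2^-1 by near: x; apply: nbhs_right_lt; rewrite invr_gt0.
have xC : x < expR (- (C / e)) by near: x; apply: nbhs_right_lt; exact: expR_gt0.
have lamC : C <= e * ln x^-1.
  rewrite lnV ?posrE// mulrC -ler_pdivrMr// lerNr -[leRHS]expRK ler_ln ?posrE ?expR_gt0//.
  exact: ltW.
have x21 : 2 * x < 1 by lra.
have lam0 : 0 < ln x^-1 by rewrite ln_gt0// invf_gt1//; lra.
have := key x x0 x21; rewrite [ln _ * T]mulrC -mulrBl normrM (gtr0_norm lam0).
move=> /le_trans /(_ lamC); rewrite ler_pM2r//= ler_distl.
by rewrite !lee_fin => /andP[h2 h3]; apply/andP; split; lra.
Unshelve. all: by end_near. Qed.

End HasMetricMeanDimension.

(** * Mean Hausdorff dimension: upper bound *)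

Section SquareWeight.
Context {R : realType} {A D : finType} (X : set (fullshift (A * D)%type)) (w : R).
Hypotheses (X0 : X !=set0) (w0 : 0 < w).
Variables (N L l : nat).
Hypothesis Ll : (L <= l)%N.
Let Z := weighted_sum w N X.
Let Z0 : 0 < Z. Proof. exact: lt_le_trans (weighted_sum_ge1 X0 w0 N). Qed.

Definition digit_snd (x : {ffun 'I_N -> A * D} + {ffun 'I_N -> D}) : {ffun 'I_N -> D} :=
  match x with inl u => snd_word u | inr v => v end.

(* McMullen's measure: a word u has probability t^(w-1) / Z, with t the number
   of words above the projection of u; the projection has probability t^w / Z. *)
Definition digit_weight (m : nat) x : R :=
  #|fiber_words X (digit_snd x)|%:R `^ w / Z /
  (if (m < L)%N then #|fiber_words X (digit_snd x)|%:R else 1).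

Definition square_weight (q : {ffun 'I_l -> {ffun 'I_N -> A * D} + {ffun 'I_N -> D}}) : R :=
  \prod_(m < l) digit_weight m (q m).

Lemma digit_weight_ge0 m x : 0 <= digit_weight m x.
Proof.
rewrite /digit_weight mulr_ge0//; first by rewrite divr_ge0 ?powR_ge0 ?ltW.
by case: ifP => _; rewrite invr_ge0.
Qed.

Lemma square_weight_ge0 q : 0 <= square_weight q.
Proof. by apply: prodr_ge0 => m _; exact: digit_weight_ge0. Qed.

(** Spreading the weight of [v] uniformly over the words above it preserves the total mass. *)
Lemma sum_fiber_words (F : {ffun 'I_N -> D} -> R) :
  \sum_(u in words N X) F (snd_word u) / #|fiber_words X (snd_word u)|%:R =
  \sum_(v in words N (@proj_snd A D @` X)) F v.
Proof.
rewrite (partition_big (@snd_word A D N) (mem (words N (@proj_snd A D @` X))))/=; last first.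
  by move=> u; exact: snd_word_words.
apply: eq_bigr => v vW.
have -> : \sum_(u in words N X | snd_word u == v) F (snd_word u) / #|fiber_words X (snd_word u)|%:R =
    \sum_(u in fiber_words X v) F v / #|fiber_words X v|%:R.
  apply: eq_big => [u|u /andP[_ /eqP->]//]; by rewrite mem_fiber_words.
rewrite sumr_const -[LHS]mulr_natr divfK// pnatr_eq0 -lt0n; exact: fiber_words_gt0.
Qed.

Lemma sum_digit_weight m : \sum_(x in square_digit_set N L X m) digit_weight m x = 1.
Proof.
rewrite /square_digit_set /digit_weight; case: ifP => _.
  rewrite big_imset/=; last by move=> x y _ _ [].
  rewrite (sum_fiber_words (fun v => #|fiber_words X v|%:R `^ w / Z)).
  by rewrite -mulr_suml divff// gt_eqF.
rewrite big_imset/=; last by move=> x y _ _ [].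
under eq_bigr do rewrite invr1 mulr1.
by rewrite -mulr_suml divff// gt_eqF.
Qed.

Lemma sum_square_weight : \sum_(q in squares N L l X) square_weight q = 1.
Proof.
have -> : \sum_(q in squares N L l X) square_weight q =
    \sum_(q in family (fun m : 'I_l => [pred x in square_digit_set N L X m])) square_weight q.
  by apply: eq_bigl => q; rewrite inE; apply: eq_forallb => m; rewrite inE.
rewrite /square_weight -(bigA_distr_big_dep _ (fun (m : 'I_l) x => digit_weight m x)).
by rewrite big1// => m _; exact: sum_digit_weight.
Qed.

(** This is S(k). *)
Definition log_fiber_sum (u : nat -> {ffun 'I_N -> A * D}) k : R :=
  \sum_(m < k) ln #|fiber_words X (snd_word (u m))|%:R.

Lemma square_weight_square u : (forall m, u m \in words N X) ->
  square_weight (square L l u) =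
  expR (w * log_fiber_sum u l - log_fiber_sum u L - l%:R * ln Z).
Proof.
move=> uX; have t0 m : 0 < #|fiber_words X (snd_word (u m))|%:R :> R.
  by rewrite ltr0n; apply: fiber_words_gt0; exact: snd_word_words.
have -> : log_fiber_sum u L =
    \sum_(m < l) if (m < L)%N then ln #|fiber_words X (snd_word (u m))|%:R else 0.
  by rewrite /log_fiber_sum (big_ord_widen l (fun m => ln #|fiber_words X (snd_word (u m))|%:R))// big_mkcond.
have -> : l%:R * ln Z = \sum_(m < l) ln Z by rewrite sumr_const card_ord mulr_natl.
rewrite /log_fiber_sum mulr_sumr -sumrB -sumrB expR_sum; apply: eq_bigr => m _.
rewrite /digit_weight ffunE !expRB -ln_powR !lnK ?posrE ?powR_gt0//.
have e : digit_snd (if (m < L)%N then inl (u m) else inr (snd_word (u m))) = snd_word (u m).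
  by case: ifP.
rewrite e; case: ifP => _; last by rewrite expR0 invr1 !mulr1.
by rewrite lnK ?posrE// mulrAC.
Qed.

End SquareWeight.

(** If every scale failed, each step would raise the quotient [S k / k] by at least [eta / 2], by
    induction on [i]; after [J] steps this exceeds the a priori bound [M]. The other [eta / 2]
    absorbs the rounding [+ 1] of the levels, thanks to [J <= lev i]. *)
Lemma telescope_levels (R : realType) (S : nat -> R) (w eta M : R) (lev : nat -> nat) J :
  0 < w -> w <= 1 -> 0 < eta -> (forall k, S k <= k%:R * M) -> (forall k, 0 <= S k) ->
  (forall i, (i < J)%N -> (lev i.+1)%:R <= w * (lev i)%:R + 1) ->
  (forall i, (i <= J)%N -> (J <= lev i)%N) -> (0 < lev J)%N ->
  M < J%:R * (eta / 2) ->
  exists2 i, (i < J)%N & - (eta * (lev i)%:R) <= w * S (lev i) - S (lev i.+1).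
Proof.
move=> w0 w1 eta0 SM S0 levS levJ levJ0 MJ; apply: contrapT => h.
have step i : (i < J)%N -> w * S (lev i) + eta * (lev i)%:R < S (lev i.+1).
  move=> iJ; rewrite ltNge; apply/negP => h'; apply: h; exists i => //.
  by rewrite lerNl opprB lerBlDl.
have ind i : (i <= J)%N -> i%:R * (eta / 2) * (lev i)%:R <= S (lev i).
  elim: i => [_|i IH iJ]; first by rewrite !mul0r.
  have h1 := step i iJ; have h2 := levS i iJ; have h3 := IH (ltnW iJ).
  have h4 : i.+1%:R <= (lev i)%:R :> R by rewrite ler_nat (leq_trans iJ)// levJ// ltnW.
  have h5 : w * (i%:R * (eta / 2) * (lev i)%:R) <= w * S (lev i) by rewrite ler_wpM2l// ltW.
  have h6 : i.+1%:R * (eta / 2) * (lev i.+1)%:R <= i.+1%:R * (eta / 2) * (w * (lev i)%:R + 1).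
    by rewrite ler_wpM2l// mulr_ge0// divr_ge0// ltW.
  have h7 : w * (lev i)%:R <= (lev i)%:R by rewrite ler_piMl.
  have h8 : 0 <= eta / 2 * ((lev i)%:R - w * (lev i)%:R).
    by rewrite mulr_ge0 ?subr_ge0// divr_ge0// ltW.
  have h9 : 0 <= eta / 2 * ((lev i)%:R - i.+1%:R).
    by rewrite mulr_ge0 ?subr_ge0// divr_ge0// ltW.
  have e1 : i.+1%:R = i%:R + 1 :> R by rewrite natr1.
  apply: (le_trans h6); rewrite e1 in h9 *; lra.
have h1 := ind J (leqnn J); have h2 := SM (lev J).
have h3 : (lev J)%:R * M < (lev J)%:R * (J%:R * (eta / 2)).
  by rewrite ltr_pM2l// ltr0n.
lra.
Qed.

(** The finite cover is padded with empty sets, which count 0 even for [s = 0]. *)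
Lemma hausdorff_content_le_fin (R : realType) (T : Type) (X : set T)
    (d : T -> T -> R) (s e : R) (I : finType) (P : {set I}) (E : I -> set T) :
  0 < e -> (forall i, E i `<=` X) -> (forall x, X x -> exists2 i, i \in P & E i x) ->
  (forall i, i \in P -> diam d (E i) < e) ->
  (hausdorff_content X d s e <= (\sum_(i in P) diam_pow d s (E i))%:E)%E.
Proof.
move=> e0 EX XE Ed; apply: ereal_inf_lbound.
pose F k := if insub k : option 'I_#|P| is Some j then E (enum_val j) else set0.
exists F.
  split=> [|k]; last first.
    rewrite /F; case: insubP => [j _ _|_]; last by rewrite diam_set0.
    by apply: Ed; exact: enum_valP.
  apply/seteqP; split=> [x /XE[i iP Eix]|x [k _]]; last first.
    by rewrite /F; case: insubP => // j _ _; exact: EX.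
  by exists (enum_rank_in iP i) => //; rewrite /F valK enum_rankK_in.
have p0 k : (0 <= (diam_pow d s (F k))%:E)%E.
  by rewrite lee_fin /diam_pow; case: ifP => // _; exact: powR_ge0.
rewrite (@nneseries_split _ _ 0 #|P|)//= add0n eseries0 ?adde0; last first.
  move=> k Pk _; rewrite /F insubF ?/diam_pow ?eqxx//.
  by apply/negbTE; rewrite -leqNgt.
rewrite big_mkord sumEFin; congr EFin; rewrite [RHS]big_enum_val/=.
by apply: eq_bigr => j _; rewrite /F valK.
Qed.

Section HausdorffUpper.
Context {R : realType} (a b : nat) (Om : set (fullshift ('I_a * 'I_b)%type)).
Hypotheses (ab : (b <= a)%N) (b2 : (2 <= b)%N).
Hypotheses (Om0 : Om !=set0).
Hypothesis hOm : forall x, Om x -> Om (@seq_shift _ x).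

Let a2 : (2 <= a)%N. Proof. exact: leq_trans ab. Qed.
Let X := @carpet R a b Om.
Let dN N := dynd (@carpet_shift R) (@carpet_dist R) N.
Let w : R := ln b%:R / ln a%:R.
Let lna : 0 < ln a%:R :> R. Proof. exact: ln_base_gt0. Qed.
Let lnb : 0 < ln b%:R :> R. Proof. exact: ln_base_gt0. Qed.
Let w0 : 0 < w. Proof. by rewrite divr_gt0. Qed.
Let w1 : w <= 1.
Proof. by rewrite ler_pdivrMr// mul1r; apply: ler_ln_nat => //; exact: leq_trans b2. Qed.
Let hX : forall p, X p -> X (carpet_shift p).
Proof. exact: carpet_shift_stable a2 b2 Om hOm. Qed.

(* The least L with a^-L <= b^-l (or that plus 1), capped at l to keep the square
   well formed *)
Definition x_level (l : nat) : nat := minn l (Num.truncn (w * l%:R)).+1.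

Lemma x_level_le l : (x_level l <= l)%N. Proof. exact: geq_minl. Qed.

Lemma x_level_ge l : w * l%:R <= (x_level l)%:R.
Proof.
rewrite /x_level /minn; case: ifP => _; first by rewrite ler_piMl.
exact/ltW/truncnS_gt.
Qed.

Lemma x_level_leS l : (x_level l)%:R <= w * l%:R + 1.
Proof.
have wl : 0 <= w * l%:R by rewrite mulr_ge0// ltW.
apply: (@le_trans _ _ (Num.truncn (w * l%:R)).+1%:R); first by rewrite ler_nat geq_minr.
by rewrite -natr1 lerD2r; have /andP[] := truncn_itv wl.
Qed.

Lemma x_level_exp l : a%:R ^- x_level l <= b%:R ^- l :> R.
Proof.
have b0 : 0 < b%:R :> R by rewrite ltr0n (leq_trans _ b2).
apply: (ge_exp_base a2); first by rewrite invr_gt0 exprn_gt0.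
rewrite invrK lnXn// -[ln _ *+ _]mulr_natl.
have := x_level_ge l; rewrite -(ler_pM2r lna); apply: le_trans.
have -> : w * l%:R * ln a%:R = l%:R * ln b%:R by rewrite /w; field; rewrite gt_eqF.
by [].
Qed.

Lemma iter_x_level_ge i l : w ^+ i * l%:R <= (iter i x_level l)%:R.
Proof.
elim: i => [|i IH]; first by rewrite expr0 mul1r.
rewrite iterS; apply: le_trans (x_level_ge _).
by rewrite exprS -mulrA ler_wpM2l// ltW.
Qed.

Lemma iter_x_level_le i l : (iter i x_level l <= l)%N.
Proof. by elim: i => //= i IH; exact: leq_trans (x_level_le _) IH. Qed.

Lemma log_fiber_sum_bounds N (u : nat -> {ffun 'I_N -> 'I_a * 'I_b}) k :
  0 <= (log_fiber_sum Om u k : R) <= k%:R * (N%:R * ln a%:R).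
Proof.
have t_le (v : {ffun 'I_N -> 'I_b}) : ln #|fiber_words Om v|%:R <= N%:R * ln a%:R :> R.
  have [->|t0] := posnP #|@fiber_words _ _ N Om v|.
    by rewrite ln0// mulr_ge0// ltW.
  have a0 : 0 < a%:R :> R by rewrite ltr0n (leq_trans _ a2).
  rewrite mulr_natl -lnXn// -natrX; apply: ler_ln_nat => //.
  by rewrite (leq_trans (card_fiber_words_le _ _))// card_ord.
rewrite sumr_ge0 => [|m _]; last exact: ln_nat_ge0.
have -> : k%:R * (N%:R * ln a%:R) = \sum_(m < k) (N%:R * ln a%:R) :> R.
  by rewrite sumr_const card_ord mulr_natl.
exact: ler_sum.
Qed.

Variable N K : nat.
Let M := (N + K)%N.
Let Z : R := weighted_sum w M Om.
Let Z0 : 0 < Z. Proof. exact: lt_le_trans (weighted_sum_ge1 Om0 w0 _). Qed.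

Definition good_square (eta : R) l
    (q : {ffun 'I_l -> {ffun 'I_M -> 'I_a * 'I_b} + {ffun 'I_M -> 'I_b}}) : bool :=
  1 <= expR (l%:R * (ln Z + eta * M%:R)) * square_weight Om w (x_level l) q.

(** A step multiplies the level by at least [w], so [l0 >= J / w ^ J] keeps all levels up to the
    J-th at least [J], as the telescoping requires. Fibers have at most a^M words, hence the bound M
    ln a on the slope. *)
Lemma exists_good_square eta l0 J u : 0 < eta -> (0 < N)%N ->
  J%:R <= w ^+ J * l0%:R -> ln a%:R < J%:R * (eta / 2) ->
  (forall m, u m \in words M Om) ->
  exists2 i, (i < J)%N & good_square eta
    (square (x_level (iter i x_level l0)) (iter i x_level l0) u).
Proof.
move=> eta0 N0 Jl0 Ja uW; have M0 : 0 < M%:R :> R by rewrite ltr0n addn_gt0 N0.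
have J0 : (0 < J)%N.
  by rewrite lt0n; apply/eqP => J0; move: Ja; rewrite J0 mul0r ltNge ltW.
have levJ i : (i <= J)%N -> (J <= iter i x_level l0)%N.
  move=> iJ; rewrite -(ler_nat R); apply: le_trans (iter_x_level_ge i l0).
  apply: (le_trans Jl0); rewrite ler_wpM2r//; apply: ler_wiXn2l => //; exact: ltW.
have [| | | | | | |i iJ hi] := @telescope_levels R (log_fiber_sum Om u) w (eta * M%:R)
  (M%:R * ln a%:R) (fun i => iter i x_level l0) J w0 w1.
- by rewrite mulr_gt0.
- by move=> k; have /andP[] := log_fiber_sum_bounds u k.
- by move=> k; have /andP[] := log_fiber_sum_bounds u k.
- by move=> i _; exact: x_level_leS.
- exact: levJ.
- by rewrite (leq_trans J0)// levJ.
- by rewrite mulrC [X in _ < _ * X]mulrAC mulrA ltr_pM2r.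
exists i => //; rewrite /good_square square_weight_square//; last exact: x_level_le.
rewrite -expRD -[leLHS]expR0 ler_expR.
have e : eta * M%:R * (iter i x_level l0)%:R = (iter i x_level l0)%:R * (eta * M%:R) by rewrite mulrC.
rewrite e in hi; rewrite -/Z mulrDr; move: hi => /=; set x := _ * (eta * _); set y := _ * ln Z.
lra.
Qed.

Definition square_piece L l (q : {ffun 'I_l -> {ffun 'I_M -> 'I_a * 'I_b} + {ffun 'I_M -> 'I_b}}) :
    set ((nat -> R) * (nat -> R)) :=
  [set p | exists z, [/\ forall m, Om (z m), carpet_point z = p &
    square L l (word_array M z) = q]].

Lemma square_piece_sub L l q : @square_piece L l q `<=` X.
Proof. by move=> _ [z [Omz <- _]]; rewrite /X carpetE//; exists z. Qed.

Lemma diam_square_piece l (q : {ffun 'I_l -> _}) : 2 ^- K <= b%:R ^- l :> R ->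
  diam (dN N) (square_piece (x_level l) q) <= 2 * b%:R ^- l.
Proof.
move=> K2; have b0 : 0 < b%:R ^- l :> R by rewrite invr_gt0 exprn_gt0// ltr0n (leq_trans _ b2).
apply: diam_le => [|_ _ [z [_ <- zq]] [z' [_ <- z'q]]]; first by rewrite mulr_ge0// ltW.
apply: le_trans (_ : b%:R ^- l + 2 ^- K <= _); last by lra.
apply: (square_dynd_le a2 b2 (x_level_le l) (x_level_exp l)) => //.
by rewrite zq z'q.
Qed.

(** A piece costs at most exp(- l (ln Z + 2 eta M)), since its diameter is at most 2 b^-l <=
    b^-(l-1). Being good allows this to be multiplied by exp(l (ln Z + eta M)) times the mass of the
    square, and the masses sum to 1. The spare eta M pays for the union over the scales. *)
Lemma sum_good_square_le (eta s : R) l :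
  2 ^- K <= b%:R ^- l :> R -> 0 <= s -> (0 < l)%N ->
  l%:R * (ln Z + 2 * (eta * M%:R)) <= s * ((l%:R - 1) * ln b%:R) ->
  \sum_(q in squares M (x_level l) l Om | good_square eta q)
    diam_pow (dN N) s (square_piece (x_level l) q) <= expR (- (l%:R * (eta * M%:R))).
Proof.
move=> K2 s0 l0 hs.
have b0 : 0 < b%:R :> R by rewrite ltr0n (leq_trans _ b2).
have bl : 0 < b%:R ^- l :> R by rewrite invr_gt0 exprn_gt0.
pose B := expR (- (l%:R * (ln Z + 2 * (eta * M%:R)))).
have dp q : @diam_pow R _ (dN N) s (@square_piece (x_level l) l q) <= B.
  rewrite /diam_pow; case: ifP => _; first exact: expR_ge0.
  have d0 : 0 <= diam (dN N) (square_piece (x_level l) q).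
    apply: (@diam_ge0 _ _ X); last exact: square_piece_sub.
    exact: bounded_pmetric_dynd hX (bounded_pmetric_carpet a2 b2 Om).
  apply: (@le_trans _ _ ((b%:R ^- l.-1) `^ s)).
    apply: ge0_ler_powR; rewrite ?nnegrE// ?invr_ge0 ?exprn_ge0//.
    apply: (le_trans (diam_square_piece q K2)).
    rewrite -{1}(prednK l0) exprS invfM mulrA ler_piMl ?invr_ge0 ?exprn_ge0//.
    by rewrite ler_pdivrMr// mul1r ler_nat.
  rewrite /B -[X in _ <= X]lnK ?posrE ?expR_gt0// -[leLHS]lnK ?posrE ?powR_gt0 ?invr_gt0 ?exprn_gt0//.
  rewrite ler_expR expRK ln_powR lnV ?posrE ?exprn_gt0// lnXn// mulrN lerN2.
  apply: le_trans hs _; rewrite -[ln _ *+ _]mulr_natl.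
  by rewrite -{1}(prednK l0) -[l.-1.+1%:R]natr1 addrK.
have wg0 q : 0 <= square_weight Om w (x_level l) q by exact: square_weight_ge0.
apply: (@le_trans _ _ (\sum_(q in squares M (x_level l) l Om)
    B * (expR (l%:R * (ln Z + eta * M%:R)) * square_weight Om w (x_level l) q))).
  rewrite big_mkcondr/=; apply: ler_sum => q _; case: ifP => [hq|_].
    apply: (le_trans (dp q)); rewrite ler_peMr// expR_ge0//.
  by rewrite !mulr_ge0 ?expR_ge0.
rewrite -!mulr_sumr sum_square_weight// ?x_level_le// mulr1 -expRD ler_expR.
by rewrite le_eqVlt; apply/orP; left; apply/eqP; ring.
Qed.

Lemma hausdorff_content_lt1 (eta s e : R) l0 J : 0 < e -> 0 < eta -> (0 < N)%N ->
  J%:R <= w ^+ J * l0%:R -> ln a%:R < J%:R * (eta / 2) -> J%:R <= eta * N%:R ->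
  2 ^- K <= b%:R ^- l0 :> R -> 0 <= s ->
  (forall i, (i < J)%N -> 2 * b%:R ^- (iter i x_level l0) < e) ->
  (forall i, (i < J)%N -> (iter i x_level l0)%:R * (ln Z + 2 * (eta * M%:R)) <=
     s * (((iter i x_level l0)%:R - 1) * ln b%:R)) ->
  (hausdorff_content X (dN N) s e < 1%:E)%E.
Proof.
move=> e0 eta0 N0 Jl0 Ja JN K2 s0 he hs.
have J0 : (0 < J)%N.
  by rewrite lt0n; apply/eqP => J0; move: Ja; rewrite J0 mul0r ltNge ltW.
pose lev i := iter i x_level l0.
have levJ i : (i <= J)%N -> (J <= lev i)%N.
  move=> iJ; rewrite -(ler_nat R); apply: le_trans (iter_x_level_ge i l0).
  apply: (le_trans Jl0); rewrite ler_wpM2r//; apply: ler_wiXn2l => //; exact: ltW.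
pose sq l := {ffun 'I_l -> {ffun 'I_M -> 'I_a * 'I_b} + {ffun 'I_M -> 'I_b}}.
(* Squares of different scales have different types, so the cover is indexed by a dependent sum. *)
pose I := {i : 'I_J & sq (lev i)}.
pose P : {set I} := [set x : I | (tagged x \in squares M (x_level (lev (tag x))) (lev (tag x)) Om)
  && good_square eta (tagged x)]%SET.
pose E (x : I) := square_piece (x_level (lev (tag x))) (tagged x).
have K2i i : 2 ^- K <= b%:R ^- lev i :> R.
  apply: (le_trans K2); rewrite lef_pV2 ?posrE ?exprn_gt0// ?ltr0n ?(leq_trans _ b2)//.
  by apply: ler_weXn2l; [rewrite ler1n (leq_trans _ b2)|exact: iter_x_level_le].
apply: (@le_lt_trans _ _ (\sum_(x in P) diam_pow (dN N) s (E x))%:E).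
  apply: hausdorff_content_le_fin => //.
  - by move=> x; exact: square_piece_sub.
  - move=> p; rewrite /X carpetE// => -[z Omz <-].
    have [i iJ hi] := exists_good_square eta0 N0 Jl0 Ja (word_array_words M Omz).
    exists (Tagged (fun i : 'I_J => sq (lev i))
      (square (x_level (lev (Ordinal iJ))) (lev (Ordinal iJ)) (word_array M z))).
      by rewrite inE /= hi andbT square_squares//; exact: word_array_words.
    by exists z.
  - move=> x _; apply: le_lt_trans (he (tag x) (ltn_ord _)).
    exact: diam_square_piece.
rewrite lte_fin.
have -> : \sum_(x in P) diam_pow (dN N) s (E x) =
   \sum_(i < J) \sum_(q in squares M (x_level (lev i)) (lev i) Om | good_square eta q)
    diam_pow (dN N) s (square_piece (x_level (lev i)) q).
  by rewrite sig_big_dep/=; apply: eq_bigl => x; rewrite inE.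
(* One scale costs at most exp(-x) <= 1 / (1 + x) with x >= eta N >= J, so the [J] scales together
   cost at most J / (J + 1). *)
apply: (@le_lt_trans _ _ (\sum_(i < J) J.+1%:R^-1)); last first.
  by rewrite sumr_const card_ord -[ltLHS]mulr_natr mulrC ltr_pdivrMr ?ltr0n// mul1r ltr_nat.
apply: ler_sum => i _; apply: le_trans (sum_good_square_le _ _ _ _) _ => //.
- exact: leq_trans (levJ i (ltnW (ltn_ord i))).
- exact: hs.
rewrite expRN lef_pV2 ?posrE ?expR_gt0//.
apply: le_trans (expR_ge1Dx _); rewrite -natr1 addrC lerD2l (le_trans JN)//.
have l1 : 1 <= (lev i)%:R :> R.
  by rewrite ler1n (leq_trans J0)// levJ// ltnW.
apply: (@le_trans _ _ (eta * M%:R)).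
  by rewrite ler_pM2l// ler_nat leq_addr.
by rewrite ler_peMl// mulr_ge0// ltW.
Qed.

End HausdorffUpper.

Lemma exp_base_eventually (R : realType) (c : nat) (e : R) : (2 <= c)%N -> 0 < e ->
  exists n0, forall n, (n0 <= n)%N -> c%:R ^- n <= e.
Proof.
move=> c2 e0; have lnc := @ln_base_gt0 R _ c2.
exists (Num.truncn (ln e^-1 / ln c%:R)).+1 => n hn.
apply: (ge_exp_base c2) => //; rewrite -ler_pdivrMr//.
by rewrite (le_trans (ltW (truncnS_gt _)))// ler_nat.
Qed.

Section HausdorffUpperDimension.
Context {R : realType} (a b : nat) (Om : set (fullshift ('I_a * 'I_b)%type)).
Hypotheses (ab : (b <= a)%N) (b2 : (2 <= b)%N).
Hypotheses (Om0 : Om !=set0).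
Hypothesis hOm : forall x, Om x -> Om (@seq_shift _ x).
Let w : R := ln b%:R / ln a%:R.

Lemma dimH_le_near (h kap e : R) : 0 <= h ->
  ln (weighted_sum w N Om) / N%:R @[N --> \oo] --> h -> 0 < e -> h / ln b%:R < kap ->
  \forall N \near \oo,
    (dimH (@carpet R a b Om) (dynd (@carpet_shift R) (@carpet_dist R) N) e <= (kap * N%:R)%:E)%E.
Proof.
move=> h0 hh e0 hkap.
have lt_of_quarter (x : R) : x <= e / 4 -> 2 * x < e by lra.
have log_bound (u x y z : R) : u <= (h + x) * y -> 2 * (x * z) <= x * y ->
    u + 2 * (x * (y + z)) <= (h + 4 * x) * y by lra.
have level_bound (u x : R) : h + 5 * u <= x * u ->
    x * (h + 4 * u) <= (x - 1) * (h + 5 * u) by lra.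
have a2 : (2 <= a)%N by exact: leq_trans ab.
have lna := @ln_base_gt0 R _ a2; have lnb := @ln_base_gt0 R _ b2.
have w0 : 0 < w by rewrite divr_gt0.
have w1 : w <= 1.
  by rewrite ler_pdivrMr// mul1r; apply: ler_ln_nat => //; exact: leq_trans b2.
(* The five units: one for the convergence of ln Z_N / N, two for the margin in the sum over good
   squares, one for the [K] extra symbols, and one for replacing l by l - 1, which is affordable
   once l >= [l2]. *)
pose eta := (kap * ln b%:R - h) / 5.
have eta0 : 0 < eta by rewrite divr_gt0// subr_gt0 -ltr_pdivrMr.
have kapE : kap * ln b%:R = h + 5 * eta by rewrite /eta; field.
have kap0 : 0 <= kap by apply: ltW; apply: le_lt_trans hkap; rewrite divr_ge0// ltW.
pose J := (Num.truncn (ln a%:R / (eta / 2))).+1.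
have eta20 : 0 < eta / 2 by exact: divr_gt0.
have Ja : ln a%:R < J%:R * (eta / 2).
  by rewrite -ltr_pdivrMr//; exact: truncnS_gt.
have e40 : 0 < e / 4 by rewrite divr_gt0.
have [l1 hl1] := exp_base_eventually b2 e40.
pose l2 := (Num.truncn ((h + 5 * eta) / eta)).+1.
pose lmin := maxn J (maxn l1 l2).
have wJ : 0 < w ^+ J by exact: exprn_gt0.
(* Fine enough that all the scales reached from [l0] in fewer than [J] steps stay at least
   [lmin]. *)
pose l0 := (Num.truncn (lmin%:R / w ^+ J)).+1.
have hl0 : lmin%:R <= w ^+ J * l0%:R.
  by rewrite mulrC -ler_pdivrMr//; exact/ltW/truncnS_gt.
have levmin i : (i < J)%N -> (lmin <= iter i (@x_level R a b) l0)%N.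
  move=> iJ; rewrite -(ler_nat R); apply: le_trans (iter_x_level_ge ab b2 i l0).
  apply: (le_trans hl0); rewrite ler_wpM2r//; apply: ler_wiXn2l; [exact: ltW|exact: w1|exact: ltnW].
have bl0 : 0 < b%:R ^- l0 :> R by rewrite invr_gt0 exprn_gt0// ltr0n (leq_trans _ b2).
have [K hK] := @exp_base_eventually R 2 _ isT bl0.
near=> N.
have N0 : (0 < N)%N by near: N; exists 1%N.
have JN : J%:R <= eta * N%:R.
  by rewrite mulrC -ler_pdivrMr//; near: N; exact: nbhs_infty_ger.
have KN : 2 * (eta * K%:R) <= eta * N%:R.
  have -> : 2 * (eta * K%:R) = eta * (2 * K%:R) by ring.
  by rewrite ler_pM2l//; near: N; exact: nbhs_infty_ger.
have ZN : ln (weighted_sum w (N + K) Om) <= (h + eta) * N%:R.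
  rewrite -ler_pdivrMr ?ltr0n//.
  have : h - eta <= ln (weighted_sum w (N + K) Om) / N%:R <= h + eta.
    rewrite -ler_distlC; near: N.
    by have /cvgrPdist_le := cvg_shift_div K hh; exact.
  by move=> /andP[].
apply: ge_ereal_sup => _ [s [s0 s1] <-]; rewrite lee_fin leNgt; apply/negP => ks.
suff : (hausdorff_content (@carpet R a b Om) (dynd (@carpet_shift R) (@carpet_dist R) N) s e < 1%:E)%E.
  by rewrite ltNge s1.
apply: (@hausdorff_content_lt1 R a b Om ab b2 Om0 hOm N K eta s e l0 J) => //.
- by apply: le_trans hl0; rewrite ler_nat leq_maxl.
- exact: hK.
- move=> i iJ; have h4 := hl1 _ (leq_trans (leq_trans (leq_maxl l1 l2) (leq_maxr J _)) (levmin i iJ)).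
  by exact: lt_of_quarter.
- move=> i iJ; set l := iter i _ l0.
  have ll2 : (l2 <= l)%N.
    exact: leq_trans (leq_trans (leq_maxr l1 l2) (leq_maxr J _)) (levmin i iJ).
  have hl : h + 5 * eta <= l%:R * eta.
    rewrite -ler_pdivrMr//; apply: (@le_trans _ _ l2%:R); last by rewrite ler_nat.
    exact/ltW/truncnS_gt.
  have l1R : 1 <= l%:R :> R by rewrite ler1n (leq_trans _ ll2).
  apply: (@le_trans _ _ (l%:R * ((h + 4 * eta) * N%:R))).
    rewrite ler_wpM2l// natrD; exact: log_bound ZN KN.
  apply: (@le_trans _ _ (kap * N%:R * ((l%:R - 1) * ln b%:R))); last first.
    by rewrite ler_wpM2r// ?mulr_ge0 ?subr_ge0 ?(ltW lnb)// ltW.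
  have -> : kap * N%:R * ((l%:R - 1) * ln b%:R) = N%:R * ((l%:R - 1) * (kap * ln b%:R)) by ring.
  have -> : l%:R * ((h + 4 * eta) * N%:R) = N%:R * (l%:R * (h + 4 * eta)) by ring.
  rewrite kapE ler_wpM2l//; exact: level_bound hl.
Unshelve. all: by end_near. Qed.

End HausdorffUpperDimension.

(** * Mean Hausdorff dimension: lower bound *)

Lemma prodr_ord_prefix (R : realType) (c : R) k P : (k <= P)%N ->
  \prod_(m < P) (if (m < k)%N then c else 1) = c ^+ k.
Proof.
move=> kP; rewrite -big_mkcond/= -(big_ord_widen P (fun=> c))//.
by rewrite prodr_const card_ord.
Qed.

Section UniformMass.
Context {R : realType} {A D : finType} (N : nat) (X : set (fullshift (A * D)%type)).
Variables (V : {set {ffun 'I_N -> D}}) (T : nat).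
Hypothesis V0 : (0 < #|V|)%N.
Hypotheses (T0 : (0 < T)%N) (VT : forall v, v \in V -> (T <= #|fiber_words X v|)%N).

Definition words_over : {set {ffun 'I_N -> A * D}} :=
  [set u in words N X | snd_word u \in V].

Definition uniform_weight (u : {ffun 'I_N -> A * D}) : R :=
  #|V|%:R^-1 / #|fiber_words X (snd_word u)|%:R.

Lemma uniform_weight_ge0 u : 0 <= uniform_weight u.
Proof. by rewrite /uniform_weight divr_ge0// invr_ge0. Qed.

Let fib0 v : v \in V -> 0 < #|fiber_words X v|%:R :> R.
Proof. by move=> vV; rewrite ltr0n (leq_trans T0)// VT. Qed.

Let mem_words_over u : (u \in words_over) = (u \in words N X) && (snd_word u \in V).
Proof. by rewrite inE. Qed.

Lemma sum_uniform_weight_fiber v : v \in V ->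
  \sum_(u in words_over | snd_word u == v) uniform_weight u = #|V|%:R^-1.
Proof.
move=> vV; have -> : \sum_(u in words_over | snd_word u == v) uniform_weight u =
    \sum_(u in fiber_words X v) #|V|%:R^-1 / #|fiber_words X v|%:R.
  apply: eq_big => [u|u /andP[_ /eqP uv]]; last by rewrite /uniform_weight uv.
  rewrite mem_words_over mem_fiber_words; case: eqP => [->|_]; last by rewrite !andbF.
  by rewrite vV !andbT.
by rewrite sumr_const -[LHS]mulr_natr divfK// gt_eqF// fib0.
Qed.

Lemma sum_uniform_weight : \sum_(u in words_over) uniform_weight u = 1.
Proof.
rewrite (partition_big (@snd_word A D N) (mem V))/=; last by move=> u; rewrite mem_words_over => /andP[].
under eq_bigr => v vV do rewrite sum_uniform_weight_fiber//.
by rewrite sumr_const -[LHS]mulr_natr mulVf// pnatr_eq0 -lt0n.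
Qed.

Lemma uniform_weight_le u : u \in words_over -> uniform_weight u <= T%:R^-1 * #|V|%:R^-1.
Proof.
rewrite mem_words_over => /andP[_ uV]; rewrite /uniform_weight mulrC ler_wpM2r ?invr_ge0//.
by rewrite lef_pV2 ?posrE ?fib0 ?ltr0n// ler_nat VT.
Qed.

(** Reading [P] rows as an infinite array lets squares of all levels up to [P] live on one finite
    probability space. *)
Definition extend (g : {ffun 'I_N -> A * D}) P (f : {ffun 'I_P -> {ffun 'I_N -> A * D}}) m :=
  if insub m is Some i then f i else g.

(** The mass factors over the rows. Below [L] the word is prescribed, which costs at most 1 / (T n)
    with n the cardinal of [V]; from [L] to [l] only its projection is, which costs at most 1 / n;
    beyond [l] the row is free. *)
Lemma square_mass_le g P L l (q : {ffun 'I_l -> {ffun 'I_N -> A * D} + {ffun 'I_N -> D}}) :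
  (L <= l)%N -> (l <= P)%N ->
  \sum_(f in ffun_on (mem words_over) | square L l (extend g f) == q)
    \prod_(m < P) uniform_weight (f m) <= T%:R^-1 ^+ L * #|V|%:R^-1 ^+ l.
Proof.
move=> Ll lP.
(* The constraint of [q] on row [m]; it is vacuous for [m >= l], where no index [j] has the value
   [m]. *)
pose cond (m : 'I_P) u := [forall j : 'I_l, (val j == val m) ==>
  ((if (j < L)%N then inl u else inr (snd_word u)) == q j)].
have w0 := uniform_weight_ge0.
apply: (@le_trans _ _ (\sum_(f in family (fun m : 'I_P => [pred u | (u \in words_over) && cond m u]))
    \prod_(m < P) uniform_weight (f m))).
  rewrite big_mkcond [leRHS]big_mkcond; apply: ler_sum => f _.
  case: ifP => [/andP[/ffun_onP fG /eqP fq]|_]; last first.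
    by case: ifP => // _; exact: prodr_ge0.
  rewrite ifT//; apply/familyP => m; rewrite inE fG/=.
  apply/forallP => j; apply/implyP => /eqP jm.
  have /ffunP/(_ j) := fq; rewrite ffunE /extend => <-.
  by rewrite jm valK.
rewrite -(bigA_distr_big_dep _ (fun (m : 'I_P) u => uniform_weight u)).
rewrite -(prodr_ord_prefix _ (leq_trans Ll lP)) -(prodr_ord_prefix _ lP) -big_split/=.
apply: ler_prod => m _; rewrite sumr_ge0//=.
have [mL|Lm] := ltnP m L.
  have ml := leq_trans mL Ll; rewrite ml.
  have [[u0 /andP[u0G u0c]]|none] := pselect (exists u, (u \in words_over) && cond m u).
    rewrite (bigD1 u0)/= ?u0G ?u0c// big1 ?addr0; first exact: uniform_weight_le.
    move=> u /andP[/andP[uG uc] /eqP[]].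
    have /forallP/(_ (Ordinal ml)) := u0c; have /forallP/(_ (Ordinal ml)) := uc.
    by rewrite /= eqxx mL/= => /eqP <- /eqP[].
  rewrite big1 ?mulr_ge0 ?invr_ge0// => u uc; case: none; by exists u.
rewrite mul1r; have [ml|lm] := ltnP m l.
  have [[u0 /andP[u0G u0c]]|none] := pselect (exists u, (u \in words_over) && cond m u).
    have u0V : snd_word u0 \in V by move: u0G; rewrite mem_words_over => /andP[].
    rewrite -(sum_uniform_weight_fiber u0V) big_mkcond [leRHS]big_mkcond.
    apply: ler_sum => u _; case: ifP => [/andP[uG uc]|_]; last by case: ifP.
    rewrite ifT//= uG/=.
    have /forallP/(_ (Ordinal ml)) := u0c; have /forallP/(_ (Ordinal ml)) := uc.
    by rewrite /= eqxx ltnNge Lm/= => /eqP <- /eqP[->].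
  rewrite big1 ?invr_ge0// => u uc; case: none; by exists u.
rewrite -sum_uniform_weight big_mkcond [leRHS]big_mkcond.
by apply: ler_sum => u _; case: ifP => [/andP[-> _]//|_]; case: ifP.
Qed.

End UniformMass.

(* Koenig's lemma: squares are cylinders in the compact space of all arrays. *)
Lemma finite_square_subcover {A D : finType} (N : nat) (G : {set {ffun 'I_N -> A * D}})
    (L l : nat -> nat)
    (Q : forall i, {set {ffun 'I_(l i) -> {ffun 'I_N -> A * D} + {ffun 'I_N -> D}}}) :
  (forall u, (forall m, u m \in G) -> exists i, square (L i) (l i) u \in Q i) ->
  exists k, forall u, (forall m, u m \in G) ->
    exists2 i, (i < k)%N & square (L i) (l i) u \in Q i.
Proof.
move=> h.
have [u _|k hk] := @compact_cylinder_uniform _ [set: fullshift {ffun 'I_N -> A * D}]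
  (fun k u => (forall m, u m \in G) -> exists2 i, (i < k)%N & square (L i) (l i) u \in Q i)
  fullshift_compact; last by exists k => u; exact: hk.
have [uG|] := pselect (forall m, u m \in G).
  have [i ui] := h u uG; exists (l i), i.+1 => y k _ uy ik _; exists i => //.
  suff <- : square (L i) (l i) u = square (L i) (l i) y by [].
  by apply/ffunP => m; rewrite !ffunE uy.
move=> /existsNP[m um]; exists m.+1, 0%N => y k _ uy _ yG; case: um.
by rewrite uy.
Qed.

Section HausdorffLower.
Context {R : realType} (a b : nat) (Om : set (fullshift ('I_a * 'I_b)%type)).
Hypotheses (ab : (b <= a)%N) (b2 : (2 <= b)%N).
Hypothesis hOm : forall x, Om x -> Om (@seq_shift _ x).

Let a2 : (2 <= a)%N. Proof. exact: leq_trans ab. Qed.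
Let X := @carpet R a b Om.
Let dN N := dynd (@carpet_shift R) (@carpet_dist R) N.
Let w : R := ln b%:R / ln a%:R.
Let lna : 0 < ln a%:R :> R. Proof. exact: ln_base_gt0. Qed.
Let lnb : 0 < ln b%:R :> R. Proof. exact: ln_base_gt0. Qed.
Let w0 : 0 < w. Proof. by rewrite divr_gt0. Qed.
Let w1 : w <= 1.
Proof. by rewrite ler_pdivrMr// mul1r; apply: ler_ln_nat => //; exact: leq_trans b2. Qed.
Let hX : forall p, X p -> X (carpet_shift p).
Proof. exact: carpet_shift_stable a2 b2 Om hOm. Qed.
Let b0 : 0 < b%:R :> R. Proof. by rewrite ltr0n (leq_trans _ b2). Qed.

(** By the convention 0^0 = 1 any nonempty set of the cover counts 1. Hence the supremum in [dimH]
    is over a nonempty set and is nonnegative. *)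
Lemma hausdorff_content0_ge1 (d : (nat -> R) * (nat -> R) -> (nat -> R) * (nat -> R) -> R) e :
  X !=set0 -> (1%:E <= hausdorff_content X d 0 e)%E.
Proof.
move=> [p Xp]; apply: le_ereal_inf_tmp => _ [E [XE _] <-].
have [i _ Ei] : (\bigcup_i E i) p by rewrite -XE.
apply: le_trans (nneseries_lim_ge i.+1 _); last first.
  by move=> n _ _; rewrite lee_fin /diam_pow; case: ifP => // _; exact: powR_ge0.
rewrite big_nat_recr//= -[leLHS]add0e; apply: leeD.
  by apply: sume_ge0 => n _; rewrite lee_fin /diam_pow; case: ifP => // _; exact: powR_ge0.
rewrite lee_fin /diam_pow ifF ?powRr0//; apply/negbTE/eqP => E0.
by move: Ei; rewrite E0.
Qed.

(** Rounded down, unlike [x_level]: a^-L must be at least b^-l for a set of diameter at most b^-l /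
    2 to meet at most 25^N squares. *)
Definition x_level_floor (l : nat) : nat := Num.truncn (w * l%:R).

Let wl0 l : 0 <= w * l%:R. Proof. by rewrite mulr_ge0// ltW. Qed.

Lemma x_level_floor_le l : (x_level_floor l <= l)%N.
Proof.
rewrite -(ler_nat R); have /andP[h _] := truncn_itv (wl0 l).
by apply: (le_trans h); rewrite ler_piMl.
Qed.

Lemma x_level_floor_exp l : b%:R ^- l <= a%:R ^- x_level_floor l :> R.
Proof.
apply: (le_exp_base a2); first by rewrite invr_gt0 exprn_gt0.
rewrite invrK lnXn// -[ln _ *+ _]mulr_natl.
have /andP[h _] := truncn_itv (wl0 l).
have -> : l%:R * ln b%:R = w * l%:R * ln a%:R by rewrite /w; field; rewrite gt_eqF.
by rewrite ler_pM2r.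
Qed.

Variables (N T : nat) (V : {set {ffun 'I_N -> 'I_b}}) (s e : R) (lmin : nat).
Hypothesis V0 : (0 < #|V|)%N.
Hypotheses (T0 : (0 < T)%N) (VT : forall v, v \in V -> (T <= #|fiber_words Om v|)%N).
Hypotheses (s0 : 0 < s) (e0 : 0 < e) (he : 2 * e <= b%:R ^- lmin).

Let mass l : R := T%:R^-1 ^+ x_level_floor l * #|V|%:R^-1 ^+ l.

Hypothesis hmass : forall l, (lmin <= l)%N ->
  25 ^+ N * mass l <= 2^-1 * (b%:R ^- l.+2) `^ s.

(** For [dl > 0] take the largest l with [2 * dl <= b^-l]; then b^-(l+1) <= 2 dl and b >= 2 give
    b^-(l+2) <= dl, whence the shift by 2 in [hmass]. For [dl = 0] there is no largest level, and
    one is chosen so deep that the mass falls below the allowance [x]. *)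
Lemma level_of_diam (dl x : R) : 0 <= dl -> dl < e -> 0 < x -> exists l,
  [/\ (lmin <= l)%N, 2 * dl <= b%:R ^- l &
      25 ^+ N * mass l <= 2^-1 * (if dl == 0 then 0 else dl `^ s) + x].
Proof.
move=> dl0 dle x0; case: eqP => [->|/eqP dln].
  have y0 : 0 < (2 * x) `^ s^-1 by rewrite powR_gt0 ?mulr_gt0.
  have [l1 hl1] := exp_base_eventually b2 y0.
  exists (maxn lmin l1); split; first exact: leq_maxl.
    by rewrite mulr0 invr_ge0 exprn_ge0// ltW.
  rewrite mulr0 add0r; apply: le_trans (hmass (leq_maxl _ _)) _.
  rewrite ler_pdivrMl//.
  have -> : 2 * x = ((2 * x) `^ s^-1) `^ s by rewrite -powRrM mulVf ?gt_eqF// powRr1// mulr_ge0// ltW.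
  apply: ge0_ler_powR; rewrite ?nnegrE ?invr_ge0 ?exprn_ge0 ?(ltW b0) ?(ltW s0) ?powR_ge0//.
  by apply: hl1; rewrite (leq_trans (leq_maxr lmin l1))// ltnW.
have dlp : 0 < dl by rewrite lt_neqAle eq_sym dln.
have dl2 : 0 < 2 * dl by rewrite mulr_gt0.
pose y := ln (2 * dl)^-1 / ln b%:R.
have hy : lmin%:R <= y.
  rewrite ler_pdivlMr// lnV ?posrE// lerNr.
  have : 2 * dl <= b%:R ^- lmin by apply: le_trans he; rewrite ler_pM2l// ltW.
  rewrite -ler_ln ?posrE ?invr_gt0 ?exprn_gt0// lnV ?posrE ?exprn_gt0// lnXn//.
  by rewrite [lmin%:R * _]mulr_natl.
have y0 : 0 <= y by apply: le_trans hy.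
have /andP[h1 h2] := truncn_itv y0.
exists (Num.truncn y); split.
- by rewrite truncn_ge_nat.
- by apply: (le_exp_base b2) => //; rewrite -ler_pdivlMr.
apply: (@le_trans _ _ (2^-1 * dl `^ s)); last by rewrite lerDl ltW.
apply: le_trans (hmass _) _; first by rewrite truncn_ge_nat.
rewrite ler_pM2l//; apply: ge0_ler_powR; rewrite ?nnegrE ?invr_ge0 ?exprn_ge0 ?(ltW b0) ?(ltW s0)//.
have h3 : b%:R ^- (Num.truncn y).+1 <= 2 * dl.
  by apply: (ge_exp_base b2) => //; rewrite -ler_pdivrMr// ltW.
rewrite exprS invfM mulrC ler_pdivrMr// (le_trans h3)// mulrC ler_pM2l//.
by rewrite ler_nat.
Qed.

Lemma sum_half_pow_lt k : \sum_(i < k) (2 ^- i.+2 : R) <= 2^-1.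
Proof.
suff : \sum_(i < k) (2 ^- i.+2 : R) <= 2^-1 - 2 ^- k.+1.
  by move=> h; apply: (le_trans h); rewrite gerBl invr_ge0 exprn_ge0.
elim: k => [|k IH]; first by rewrite big_ord0 expr1 subrr.
rewrite big_ord_recr/=.
have h : 2 ^- k.+1 = 2 ^- k.+2 + 2 ^- k.+2 :> R by rewrite [in RHS]exprS; field; rewrite expf_neq0.
lra.
Qed.

(** In a cover of total below 1, the squares met by [E i] have mass at most half the contribution of
    [E i] plus 2^-(i+2). The [E i] are arbitrary sets, but the squares they meet are open in the
    space of arrays, so finitely many indices suffice; their masses add up to less than 1/2 + 1/2,
    against a total mass of 1. *)
Lemma hausdorff_content_ge1 : (1%:E <= hausdorff_content X (dN N) s e)%E.
Proof.
have final (x y : R) : x < 1 -> y <= 2^-1 -> 2^-1 * x + y < 1 by lra.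
rewrite leNgt; apply/negP => /ereal_inf_lt[_ [E [XE Ed] <-] Elt].
have hd := bounded_pmetric_dynd N hX (bounded_pmetric_carpet a2 b2 Om).
have EX i : E i `<=` X by rewrite XE; exact: bigcup_sup.
have dE0 i : 0 <= diam (dN N) (E i) by exact: diam_ge0 hd (EX i).
have dp0 i : 0 <= diam_pow (dN N) s (E i).
  by rewrite /diam_pow; case: ifP => // _; exact: powR_ge0.
have /choice[l hl] i : exists l, [/\ (lmin <= l)%N, 2 * diam (dN N) (E i) <= b%:R ^- l &
    25 ^+ N * mass l <= 2^-1 * diam_pow (dN N) s (E i) + 2 ^- i.+2].
  have x0 : 0 < 2 ^- i.+2 :> R by rewrite invr_gt0 exprn_gt0.
  have [l [h1 h2 h3]] := level_of_diam (dE0 i) (Ed i) x0; exists l; split=> //.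
  apply: (le_trans h3); rewrite lerD2r ler_pM2l// /diam_pow.
  by have [->|_] := eqVneq (E i) set0; [rewrite diam_set0 eqxx|case: ifP => // _; exact: powR_ge0].
pose L i := x_level_floor (l i).
have Ll i : (L i <= l i)%N by exact: x_level_floor_le.
pose Q i : {set {ffun 'I_(l i) -> {ffun 'I_N -> 'I_a * 'I_b} + {ffun 'I_N -> 'I_b}}} :=
  [set q | `[< exists z, E i (carpet_point z) /\ square (L i) (l i) (word_array N z) = q >]]%SET.
have cardQ i : (#|Q i| <= 25 ^ N)%N.
  have [_ h2 _] := hl i.
  apply: (@card_squares_hit R a b a2 b2 N (L i) (l i) (diam (dN N) (E i)) (E i)) => //.
  - exact: le_trans (x_level_floor_exp _).
  - by move=> p q Ep Eq; exact: (diam_ge_sub hd (EX i)).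
  - by move=> q; rewrite inE => /asboolP.
pose G := words_over Om V.
have GW u : u \in G -> u \in words N Om by rewrite inE => /andP[].
have [|k hk] := @finite_square_subcover _ _ N G L l Q.
  move=> u uG; have [z Omz <-] := words_word_array (fun m => GW _ (uG m)).
  have : X (carpet_point z) by rewrite /X carpetE//; exists z.
  rewrite XE => -[i _ Ei]; exists i; rewrite inE; apply/asboolP; by exists z.
have [g gG] : exists g, g \in G.
  have /card_gt0P[v vV] := V0; have /card_gt0P[g] := leq_trans T0 (VT vV).
  rewrite mem_fiber_words => /andP[gW /eqP gv]; exists g.
  by rewrite inE gW gv vV.
pose P := \max_(i < k) l i.
have lP (i : 'I_k) : (l i <= P)%N by exact: (leq_bigmax i).
pose W (f : {ffun 'I_P -> {ffun 'I_N -> 'I_a * 'I_b}}) : R :=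
  \prod_(m < P) uniform_weight Om V (f m).
have W0 f : 0 <= W f by apply: prodr_ge0 => m _; exact: uniform_weight_ge0.
have total : \sum_(f in ffun_on (mem G)) W f = 1.
  rewrite -(bigA_distr_big _ (fun (m : 'I_P) u => uniform_weight Om V u)).
  by rewrite big1// => m _; rewrite (sum_uniform_weight V0 T0 VT).
have massQ (i : 'I_k) :
    \sum_(f in ffun_on (mem G) | square (L i) (l i) (extend g f) \in Q i) W f <=
    2^-1 * diam_pow (dN N) s (E i) + 2 ^- i.+2.
  rewrite (partition_big (fun f => square (L i) (l i) (extend g f)) (mem (Q i)))/=; last first.
    by move=> f /andP[].
  have [_ _ h3] := hl i; apply: le_trans h3.
  apply: (@le_trans _ _ (\sum_(q in Q i) mass (l i))); last first.
    rewrite sumr_const -[leLHS]mulr_natl ler_wpM2r//.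
      by rewrite mulr_ge0// exprn_ge0// invr_ge0.
    by rewrite -natrX ler_nat.
  apply: ler_sum => q qQ; apply: le_trans (square_mass_le V0 T0 VT g q (Ll i) (lP i)).
  rewrite le_eqVlt; apply/orP; left; apply/eqP; apply: eq_bigl => f.
  case: (f \in _) => //=; apply/andP/eqP => [[_ /eqP]//|fq]; by rewrite fq.
have : 1 <= \sum_(i < k) (2^-1 * diam_pow (dN N) s (E i) + 2 ^- i.+2).
  apply: (@le_trans _ _ (\sum_(i < k) \sum_(f in ffun_on (mem G) |
      square (L i) (l i) (extend g f) \in Q i) W f)); last by apply: ler_sum => i _.
  under eq_bigr do rewrite big_mkcondr/=.
  rewrite exchange_big/= -total; apply: ler_sum => f /ffun_onP fG.
  have [|i ik ui] := hk (extend g f).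
    by move=> m; rewrite /extend; case: insubP => [j _ _|_] //; exact: fG.
  rewrite (bigD1 (Ordinal ik))//= ui lerDl sumr_ge0// => j _.
  by case: ifP.
rewrite big_split/= -mulr_sumr.
have h1 : \sum_(i < k) diam_pow (dN N) s (E i) < 1.
  rewrite -lte_fin; apply: le_lt_trans Elt.
  rewrite -sumEFin -(big_mkord xpredT (fun i => (diam_pow (dN N) s (E i))%:E)).
  by apply: nneseries_lim_ge => n _ _; rewrite lee_fin.
have h2 := sum_half_pow_lt k.
by rewrite leNgt final.
Qed.

End HausdorffLower.

(* Pigeonhole on trunc_log 2 of the cardinality of the fibers. *)
Lemma exists_uniform_fibers (R : realType) (A D : finType) (X : set (fullshift (A * D)%type))
    (w : R) N : X !=set0 -> 0 < w -> w <= 1 -> (1 < #|A|)%N ->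
  exists (V : {set {ffun 'I_N -> D}}) (T : nat),
  [/\ (0 < #|V|)%N, (0 < T <= #|A| ^ N)%N, forall v, v \in V -> (T <= #|fiber_words X v|)%N &
      weighted_sum w N X <= 2 * (#|A| * N).+1%:R * (#|V|%:R * T%:R `^ w)].
Proof.
(* A fiber has at most a^N <= 2^(a N) words, with a the size of the alphabet [A], so the dyadic
   logarithm takes at most [B] values. The factor 2 in the conclusion is the loss within a dyadic
   class, as 2^w <= 2. *)
move=> X0 w0 w1 A1; set B := (#|A| * N).+1; set Z := weighted_sum w N X.
have Z0 : 0 < Z by exact: lt_le_trans (weighted_sum_ge1 X0 w0 N).
pose t (v : {ffun 'I_N -> D}) := #|fiber_words X v|.
pose W := words N (@proj_snd A D @` X).
pose V (k : nat) := [set v in W | trunc_log 2 (t v) == k]%SET.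
have t_bounds v : v \in W -> (2 ^ trunc_log 2 (t v) <= t v < 2 ^ (trunc_log 2 (t v)).+1)%N.
  by move=> vW; apply: trunc_log_bounds => //; exact: fiber_words_gt0.
have logB v : v \in W -> (trunc_log 2 (t v) < B)%N.
  move=> vW; rewrite ltnS -(@leq_exp2l 2)//; have /andP[h _] := t_bounds v vW.
  apply: (leq_trans h); apply: (leq_trans (card_fiber_words_le X v)).
  have [->|N0] := posnP N; first by rewrite !muln0 !expn0.
  by rewrite expnM leq_exp2r//; apply: ltnW; exact: ltn_expl.
have [k hk] : exists k, Z <= 2 * B%:R * (#|V k|%:R * (2 ^ k)%:R `^ w).
  apply: contrapT => h.
  have hlt k : #|V k|%:R * (2 ^ k)%:R `^ w < Z / (2 * B%:R).
    rewrite ltr_pdivlMr ?mulr_gt0 ?ltr0n// mulrC ltNge; apply/negP => h'; apply: h.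
    by exists k.
  have : Z < Z; last by rewrite ltxx.
  have {1}-> : Z = \sum_(k < B) \sum_(v in V k) (t v)%:R `^ w.
    rewrite /Z /weighted_sum (partition_big (fun v => inord (trunc_log 2 (t v)) : 'I_B) xpredT)//=.
    apply: eq_bigr => k _; apply: eq_bigl => v; rewrite -/W [RHS]inE.
    case vW : (v \in W) => //=; have vB := logB v vW.
    by rewrite -val_eqE/= inordK.
  apply: (@le_lt_trans _ _ (\sum_(k < B) 2 * (#|V k|%:R * (2 ^ k)%:R `^ w))).
    apply: ler_sum => k _.
    apply: (@le_trans _ _ (\sum_(v in V k) 2 * (2 ^ k)%:R `^ w)); last first.
      by rewrite sumr_const -[leLHS]mulr_natl mulrCA.
    apply: ler_sum => v; rewrite inE => /andP[vW /eqP vk].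
    have /andP[_ h2] := t_bounds v vW; rewrite vk expnS in h2.
    apply: (@le_trans _ _ ((2 * 2 ^ k)%:R `^ w)).
      by apply: ge0_ler_powR; rewrite ?nnegrE ?ler0n ?(ltW w0)// ler_nat ltnW.
    rewrite natrM powRM ?ler0n// ler_wpM2r ?powR_ge0//.
    by apply: ler1_powR => //; rewrite ler1n.
  have {1}-> : Z = \sum_(k < B) 2 * (Z / (2 * B%:R)).
    rewrite sumr_const card_ord -[RHS]mulr_natl; field.
    by rewrite pnatr_eq0.
  apply: ltr_sum; last by move=> k _; rewrite ltr_pM2l.
  by apply/hasP; exists ord0; rewrite ?mem_index_enum.
have V0 : (0 < #|V k|)%N.
  by rewrite lt0n; apply/eqP => V0; move: hk; rewrite V0 mul0r mulr0 leNgt Z0.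
have VT v : v \in V k -> (2 ^ k <= t v)%N.
  by rewrite inE => /andP[vW /eqP <-]; have /andP[] := t_bounds v vW.
exists (V k), (2 ^ k)%N; split=> //; rewrite expn_gt0/=.
have /card_gt0P[v vV] := V0.
exact: leq_trans (VT v vV) (card_fiber_words_le X v).
Qed.

Section HausdorffLowerDimension.
Context {R : realType} (a b : nat) (Om : set (fullshift ('I_a * 'I_b)%type)).
Hypotheses (ab : (b <= a)%N) (b2 : (2 <= b)%N).
Hypotheses (Om0 : Om !=set0).
Hypothesis hOm : forall x, Om x -> Om (@seq_shift _ x).
Let w : R := ln b%:R / ln a%:R.

(** The pigeonhole factor is subexponential. The value of [k] makes the slope of the bound ln x <= x
    / k + ln k equal to [eta / 2]. *)
Lemma log_linear_le (c eta : R) : 0 < c -> 0 < eta ->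
  \forall N \near \oo, ln (2 * (c * N%:R + 1)) <= eta * N%:R.
Proof.
move=> c0 eta0; pose k := 4 * c / eta.
have k0 : 0 < k by rewrite divr_gt0// mulr_gt0.
near=> N.
have hN : 2 * (2 / k + ln k) / eta <= N%:R by near: N; exact: nbhs_infty_ger.
have x0 : 0 < 2 * (c * N%:R + 1) by rewrite mulr_gt0// ltr_wpDl// mulr_ge0// ltW.
have h : ln (2 * (c * N%:R + 1)) <= 2 * (c * N%:R + 1) / k + ln k.
  rewrite -lerBlDr -ln_div ?posrE//; apply/ltW/ln_sublinear; exact: divr_gt0.
apply: (le_trans h).
have -> : 2 * (c * N%:R + 1) / k = eta / 2 * N%:R + 2 / k.
  by rewrite /k; field; rewrite !gt_eqF.
rewrite ler_pdivrMr// in hN; have e : eta * N%:R = eta / 2 * N%:R + N%:R * eta / 2 by field.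
rewrite e -addrA lerD2l ler_pdivlMr// mulrC.
exact: hN.
Unshelve. all: by end_near. Qed.

Lemma dimH_ge_near (h kap : R) :
  ln (weighted_sum w N Om) / N%:R @[N --> \oo] --> h -> 0 < kap -> kap < h / ln b%:R ->
  exists2 e0 : R, 0 < e0 & forall e, 0 < e -> e < e0 -> \forall N \near \oo,
    ((kap * N%:R)%:E <= dimH (@carpet R a b Om) (dynd (@carpet_shift R) (@carpet_dist R) N) e)%E.
Proof.
move=> hh kap0 hkap.
have mass_bound (x l h' u c g k : R) : 0 <= x -> g + c + k + 2 * h' <= 4 * u * l -> 0 <= u ->
    (x * g + x * c - l * ((h' - u) * x)) <= - (x * k) - x * ((h' - 5 * u) * (l + 2)).
  move=> x0 h1 u0; have := ler_wpM2l x0 h1; have := mulr_ge0 x0 u0; lra.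
have log_bound (z t y u x : R) : z <= t + y -> (h - u / 2) * x <= z -> t <= u / 2 * x ->
    (h - u) * x <= y by lra.
have final_bound (ww l t n c x y z g k v : R) :
    ww * l * t - x * c <= y * t -> l * z <= l * (n + ww * t) ->
    x * g + x * c - l * z <= - (x * k) - v -> k <= x * k ->
    x * g + (y * - t + l * - n) <= - k + - v by lra.
have a2 : (2 <= a)%N by exact: leq_trans ab.
have lna := @ln_base_gt0 R _ a2; have lnb := @ln_base_gt0 R _ b2.
have w0 : 0 < w by rewrite divr_gt0.
have w1 : w <= 1.
  by rewrite ler_pdivrMr// mul1r; apply: ler_ln_nat => //; exact: leq_trans b2.
have a0 : 0 < a%:R :> R by rewrite ltr0n (leq_trans _ a2).
have b0 : 0 < b%:R :> R by rewrite ltr0n (leq_trans _ b2).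
(* One unit is shared by the convergence of ln Z_N / N and the pigeonhole factor; the other four,
   multiplied by l, have to outweigh [C]. *)
pose eta := (h - kap * ln b%:R) / 5.
have eta0 : 0 < eta by rewrite divr_gt0// subr_gt0 -ltr_pdivlMr.
have kapE : kap * ln b%:R = h - 5 * eta by rewrite /eta; field.
have eta20 : 0 < eta / 2 by exact: divr_gt0.
have eta4 : 0 < 4 * eta by exact: mulr_gt0.
(* The costs that do not grow with l, per unit of time: the 25^N squares met by a set, the rounding
   of L, the factor 1/2, and the passage from l to l + 2. *)
pose C := ln 25 + ln a%:R + ln 2 + 2 * h.
pose lmin := (Num.truncn (C / (4 * eta))).+1.
have hlmin l : (lmin <= l)%N -> C <= 4 * eta * l%:R.
  move=> hl; rewrite mulrC -ler_pdivrMr//; apply: (@le_trans _ _ lmin%:R).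
    exact/ltW/truncnS_gt.
  by rewrite ler_nat.
exists (b%:R ^- lmin / 2); first by rewrite divr_gt0// invr_gt0 exprn_gt0.
move=> e e0 ee; near=> N.
have N0 : (0 < N)%N by near: N; exists 1%N.
have N0R : 0 < N%:R :> R by rewrite ltr0n.
have N1R : 1 <= N%:R :> R by rewrite ler1n.
have ZN : (h - eta / 2) * N%:R <= ln (weighted_sum w N Om).
  rewrite -ler_pdivlMr//.
  have : h - eta / 2 <= ln (weighted_sum w N Om) / N%:R <= h + eta / 2.
    rewrite -ler_distlC; near: N.
    by have /cvgrPdist_le/(_ _ eta20) := hh; exact.
  by move=> /andP[].
have BN : ln (2 * (a%:R * N%:R + 1)) <= eta / 2 * N%:R.
  by near: N; exact: log_linear_le.
have A1 : (1 < #|'I_a|)%N by rewrite card_ord.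
have [V [T [V0 /andP[T0 Ta] VT ZV]]] := @exists_uniform_fibers R _ _ Om w N Om0 w0 w1 A1.
rewrite !card_ord in Ta ZV.
have n0 : 0 < #|V|%:R :> R by rewrite ltr0n.
have T0R : 0 < T%:R :> R by rewrite ltr0n.
have s0 : 0 < kap * N%:R by rewrite mulr_gt0.
apply: ereal_sup_ubound; exists (kap * N%:R) => //; split; first exact: ltW.
apply: (@hausdorff_content_ge1 R a b Om ab b2 hOm N T V (kap * N%:R) e lmin) => //.
  by rewrite mulrC -ler_pdivlMr// ltW.
move=> l hl; set L := x_level_floor a b l.
have nT : (h - eta) * N%:R <= ln #|V|%:R + w * ln T%:R.
  apply: (log_bound _ _ _ _ _ _ ZN BN).
  have Z0 : 0 < weighted_sum w N Om by exact: lt_le_trans (weighted_sum_ge1 Om0 w0 N).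
  have p1 : 0 < 2 * (a%:R * N%:R + 1) :> R by rewrite mulr_gt0// ltr_wpDl// mulr_ge0// ltW.
  have p2 : 0 < #|V|%:R * T%:R `^ w :> R by rewrite mulr_gt0// powR_gt0.
  rewrite -ln_powR -[ln #|V|%:R + _]lnM ?posrE ?powR_gt0//.
  rewrite -lnM ?posrE// ler_ln ?posrE//; last exact: mulr_gt0.
  by move: ZV; rewrite -[(a * N).+1%:R]natr1 natrM.
have lnT : 0 <= ln (T%:R : R) <= N%:R * ln a%:R.
  by rewrite ln_nat_ge0/= mulr_natl -lnXn// -natrX ler_ln_nat.
have LT : w * l%:R * ln T%:R - N%:R * ln a%:R <= L%:R * ln T%:R.
  have wl : 0 <= w * l%:R by rewrite mulr_ge0// ltW.
  have /andP[_ h2] := truncn_itv wl.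
  have /andP[t0 tN] := lnT.
  rewrite lerBlDr; apply: (@le_trans _ _ (L%:R * ln T%:R + ln T%:R)); last by rewrite lerD2l.
  by rewrite -[X in _ + X]mul1r -mulrDl ler_wpM2r// natr1 ltW.
have Ti : 0 < T%:R^-1 ^+ L :> R by rewrite exprn_gt0// invr_gt0.
have ni : 0 < #|V|%:R^-1 ^+ l :> R by rewrite exprn_gt0// invr_gt0.
have bi : 0 < (b%:R ^- l.+2) `^ (kap * N%:R) by rewrite powR_gt0// invr_gt0 exprn_gt0.
have p25 : 0 < 25 ^+ N :> R by rewrite exprn_gt0.
rewrite -ler_ln ?posrE; [|exact: mulr_gt0 p25 (mulr_gt0 Ti ni)|exact: mulr_gt0].
rewrite (lnM p25 (mulr_gt0 Ti ni)) (lnM Ti ni) lnM ?posrE// ln_powR.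
rewrite !lnXn ?invr_gt0// !lnV ?posrE ?exprn_gt0// lnXn//.
rewrite -[ln 25 *+ N]mulr_natl -[- ln T%:R *+ _]mulr_natl -[- ln _ *+ l]mulr_natl -[ln b%:R *+ _]mulr_natl.
have h1 := hlmin l hl.
have h2 : l%:R * ((h - eta) * N%:R) <= l%:R * (ln #|V|%:R + w * ln T%:R) by rewrite ler_wpM2l.
have h3 := mass_bound N%:R l%:R h eta (ln a%:R) (ln 25) (ln 2) (ltW N0R) h1 (ltW eta0).
have e1 : kap * N%:R * - (l.+2%:R * ln b%:R) = - (N%:R * ((h - 5 * eta) * (l%:R + 2))).
  by rewrite -kapE -[l.+2]addn2 natrD; ring.
have l2 : ln 2 <= N%:R * ln 2 :> R by rewrite ler_peMl// ln_ge0// ler1n.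
rewrite e1; exact: final_bound LT h2 h3 l2.
Unshelve. all: by end_near. Qed.

End HausdorffLowerDimension.

(** * Mean Hausdorff dimension and conclusion *)

Lemma cvg_ereal_squeeze (R : realType) (T : Type) (F : set_system T) (f : T -> \bar R) (c : R) :
  Filter F -> (forall dl, 0 < dl -> \forall x \near F, ((c - dl)%:E <= f x <= (c + dl)%:E)%E) ->
  f x @[x --> F] --> c%:E.
Proof.
move=> FF h; apply/fine_cvgP; split.
  apply: filterS (h 1 ltr01) => x /andP[h1 h2].
  by rewrite fin_numElt (lt_le_trans _ h1) ?ltNyr//= (le_lt_trans h2) ?ltry.
apply/cvgrPdist_le => dl dl0; apply: filterS (h dl dl0) => x /=.
case: (f x) => [r| |] //=; rewrite ?leNye ?lee_fin /=; first by rewrite ler_distlC.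
by rewrite andbF.
Qed.

Section HasMeanHausdorffDimension.
Context {R : realType} (a b : nat) (Om : set (fullshift ('I_a * 'I_b)%type)).
Hypotheses (ab : (b <= a)%N) (b2 : (2 <= b)%N).
Hypotheses (Om0 : Om !=set0).
Hypothesis hOm : forall x, Om x -> Om (@seq_shift _ x).

Let X := @carpet R a b Om.
Let dN N := dynd (@carpet_shift R) (@carpet_dist R) N.

Lemma dimH_ge0 N e : (0%:E <= dimH X (dN N) e)%E.
Proof.
apply: ereal_sup_ubound; exists 0 => //; split=> //.
by apply: hausdorff_content0_ge1; exact: carpet_nonempty.
Qed.

(** The upper bound holds at every scale, the lower one only below a threshold depending on the
    tolerance. The lower bound requires a positive exponent; when [c - dl <= 0] nonnegativity of
    [dimH] replaces it. *)
Lemma carpet_has_mdimH (h : R) : 0 <= h ->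
  ln (weighted_sum (ln b%:R / ln a%:R) N Om) / N%:R @[N --> \oo] --> h ->
  has_mdimH X (@carpet_shift R) (@carpet_dist R) (h / ln b%:R)%:E.
Proof.
move=> h0 hh; have lnb := @ln_base_gt0 R _ b2.
set c := h / ln b%:R; have c0 : 0 <= c by rewrite divr_ge0// ltW.
pose u e N := (dimH X (dN N) e * (N%:R^-1)%:E)%E.
have up e : 0 < e -> (limn_esup (u e) <= c%:E)%E.
  move=> e0; apply/lee_addgt0Pr => dl dl0; rewrite -EFinD; apply: limf_esup_le.
  have ck : h / ln b%:R < c + dl by rewrite ltrDl.
  near=> N; have N0 : 0 < N%:R :> R by rewrite ltr0n; near: N; exists 1%N.
  rewrite /u /= lee_pdivrMr// -EFinM.
  by near: N; exact: (dimH_le_near ab b2 Om0 hOm h0 hh e0 ck).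
have lo dl : 0 < dl -> \forall e \near 0^'+, ((c - dl)%:E <= limn_einf (u e))%E.
  move=> dl0; have [k0|k0] := ltP 0 (c - dl); last first.
    near=> e.
    have ge0 : \forall N \near \oo, ((c - dl)%:E <= u e N)%E.
      apply: nearW => N; apply: (@le_trans _ _ 0%:E); first by rewrite lee_fin.
      by rewrite mule_ge0 ?dimH_ge0// lee_fin.
    exact: limf_einf_ge ge0.
  have ck : c - dl < h / ln b%:R by rewrite ltrBlDr ltrDl.
  have [e1 e10 he1] := dimH_ge_near ab b2 Om0 hOm hh k0 ck.
  near=> e.
  have e0 : 0 < e by near: e; exact: nbhs_right_gt.
  have ee1 : e < e1 by near: e; exact: nbhs_right_lt.
  have ge_kap : \forall N \near \oo, ((c - dl)%:E <= u e N)%E.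
    have hN := he1 e e0 ee1.
    near=> N; have N0 : 0 < N%:R :> R by rewrite ltr0n; near: N; exists 1%N.
    by rewrite /u /= lee_pdivlMr// -EFinM; near: N.
  exact: limf_einf_ge ge_kap.
have einf_le e : (limn_einf (u e) <= limn_esup (u e))%E by exact: limn_einf_sup.
split; apply: cvg_lim => //; apply: cvg_ereal_squeeze => dl dl0.
  near=> e; have e0 : 0 < e by near: e; exact: nbhs_right_gt.
  apply/andP; split; last by rewrite (le_trans (up e e0))// lee_fin lerDl ltW.
  by apply: le_trans (einf_le e); near: e; exact: lo.
near=> e; have e0 : 0 < e by near: e; exact: nbhs_right_gt.
apply/andP; split; first by near: e; exact: lo.
by rewrite (le_trans (einf_le e))// (le_trans (up e e0))// lee_fin lerDl ltW.
Unshelve. all: by end_near. Qed.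

End HasMeanHausdorffDimension.

Theorem theorem5p3 (R : realType) (a b : nat) (hab : (b <= a)%N)
    (hb : (2 <= b)%N)
    (Om : set (fullshift ('I_a * 'I_b)%type)) (Om0 : Om !=set0)
    (Omclosed : closed Om) (Omshift : (@seq_shift _) @` Om `<=` Om)
    (* any metrics inducing the topologies of Omega and Omega' *)
    (d : fullshift ('I_a * 'I_b)%type -> fullshift ('I_a * 'I_b)%type -> R)
    (d' : fullshift 'I_b -> fullshift 'I_b -> R)
    (hd : compatible_metric Om d) (hd' : compatible_metric (@proj_snd 'I_a 'I_b @` Om) d') :
  let pi := @proj_snd 'I_a 'I_b in
  let X := @carpet R a b Om in
  has_mdimH X (@carpet_shift R) (@carpet_dist R)
    (whtop (ln b%:R / ln a%:R) pi Om (@seq_shift _) d (pi @` Om) (@seq_shift _) d'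
     * ((ln b%:R)^-1)%:E)%E
  /\
  has_mdimM X (@carpet_shift R) (@carpet_dist R)
    (htop Om (@seq_shift _) d * ((ln a%:R)^-1)%:E
     + ((ln b%:R)^-1 - (ln a%:R)^-1)%:E * htop (pi @` Om) (@seq_shift _) d')%E.
Proof.
move=> pi X; have ha : (2 <= a)%N by exact: leq_trans hab.
have lna := @ln_base_gt0 R _ ha; have lnb := @ln_base_gt0 R _ hb.
have hOm x : Om x -> Om (@seq_shift _ x) by move=> Omx; apply: Omshift; exists x.
have cOm : compact Om.
  exact: subclosed_compact Omclosed (@fullshift_compact ('I_a * 'I_b)%type) _.
have w0 : 0 < ln b%:R / ln a%:R :> R by rewrite divr_gt0.
have w1 : ln b%:R / ln a%:R <= 1 :> R.
  by rewrite ler_pdivrMr// mul1r; apply: ler_ln_nat => //; exact: leq_trans hb.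
have hOm' := seq_shift_proj_snd hOm.
have Om'0 : (pi @` Om) !=set0 by have [x Omx] := Om0; exists (pi x), x.
have [hw hw0 hwcvg] := weighted_entropy_cvg Om0 w0 hOm.
have [h1 _ h1cvg] := @word_entropy_cvg R _ Om Om0 hOm.
have [h0 _ h0cvg] := @word_entropy_cvg R _ (pi @` Om) Om'0 hOm'.
(* All three entropies become real numbers, so the extended-real expressions of the statement reduce
   to real ones. *)
rewrite (whtop_weighted_sum cOm Om0 w0 w1 hOm hd hd' hwcvg).
rewrite (htop_word_entropy cOm Om0 hOm hd h1cvg).
rewrite (htop_word_entropy (compact_proj_snd cOm) Om'0 hOm' hd' h0cvg).
rewrite -!EFinM -EFinD; split; first exact: carpet_has_mdimH.
exact: carpet_has_mdimM.
Qed.
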